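(* Let $r\ge1$, let $\mathcal X$ be a Polish space with compatible complete metric $d_{\mathcal X}$ and fixed point $x_0\in\mathcal X$, let $d\in\mathbb N$, let $\mu$ be a continuous (atomless) probability on $\mathcal X$ and $\nu$ a probability on $\mathbb{R}^d$, both with finite $r$-th moments. Let $c:\mathcal X\times\mathbb{R}^d\to\mathbb{R}$ be continuous with at most growth of order $d_{\mathcal X}(x,x_0)^r+|y|^r$. Then \begin{align*} \sup_{\pi\in\Pi(\mu,\nu)}\int c\big(x,b(\pi_x)\big)\,\mu(dx) &=\inf\Big\{\int\phi\,d\mu+\int\psi\,d\nu:\ c(x,y_1)\le\phi(x)+\psi(y_2)+\Delta(y_1)\cdot(y_2-y_1)\ \forall x,y_1,y_2\Big\}\\ &=\inf\Big\{\int\phi\,d\mu+\int\psi\,d\nu:\ c(x,y)\le\phi(x)+\psi(y)\ \forall x,y,\ \psi\text{ convex}\Big\}, \end{align*} where the infima are over continuous $\phi:\mathcal X\to\mathbb{R}$, $\psi:\mathbb{R}^d\to\mathbb{R}$ bounded in absolute value by a multiple of $x\mapsto(1+d_{\mathcal X}(x,x_0))^r$ and $y\mapsto(1+|y|)^r$ respectively, and (in the first infimum) over measurable $\Delta:\mathbb{R}^d\to\mathbb{R}^d$.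
   Context: $\Pi(\mu,\nu)$ denotes the set of couplings of $\mu$ and $\nu$; for $\pi\in\Pi(\mu,\nu)$, $(\pi_x)_{x\in\mathcal X}$ denotes its disintegration with respect to $\mu$; for a probability $p$ on $\mathbb{R}^d$ with finite first moment, $b(p)=\int y\,p(dy)$ denotes its barycenter. *)

(* Defs.v *)
From HB Require Import structures.
From mathcomp Require Import all_boot all_order all_algebra.
From mathcomp Require Import all_classical all_reals all_analysis.
From mathcomp Require Import measurable_realfun.
Set Implicit Arguments. Unset Strict Implicit. Unset Printing Implicit Defensive.
Import Order.TTheory GRing.Theory Num.Theory.
Local Open Scope classical_set_scope.
Local Open Scope ring_scope.

Section metric.
Context {R : realType} {X : Type} (dX : X -> X -> R).

Definition is_metric : Prop :=
  [/\ forall x y, 0 <= dX x y,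
      forall x y, dX x y = 0 <-> x = y,
      forall x y, dX x y = dX y x &
      forall x y z, dX x z <= dX x y + dX y z].

Definition mopen (U : set X) : Prop :=
  forall x, U x -> exists2 e : R, 0 < e & forall y, dX x y < e -> U y.

Definition mcomplete : Prop :=
  forall u : nat -> X,
    (forall e : R, 0 < e -> exists N, forall m k, (N <= m)%N -> (N <= k)%N -> dX (u m) (u k) < e) ->
    exists l, forall e : R, 0 < e -> exists N, forall m, (N <= m)%N -> dX (u m) l < e.

Definition mseparable : Prop :=
  exists s : nat -> X, forall x (e : R), 0 < e -> exists k, dX x (s k) < e.
End metric.

(* ---------- R^n represented as n.-tuple R (with its product Borel sigma-algebra) ---------- *)
Section euclid.
Context {R : realType} {n : nat}.
Definition tnorm (y : n.-tuple R) : R := Num.sqrt (\sum_(i < n) tnth y i ^+ 2).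
Definition tsub (y z : n.-tuple R) : n.-tuple R := [tuple tnth y i - tnth z i | i < n].
Definition tdot (y z : n.-tuple R) : R := \sum_(i < n) tnth y i * tnth z i.
Definition tconvcomb (t : R) (y z : n.-tuple R) : n.-tuple R :=
  [tuple t * tnth y i + (1 - t) * tnth z i | i < n].
Definition convex_fun (psi : n.-tuple R -> R) : Prop :=
  forall (t : R) y z, 0 <= t <= 1 ->
    psi (tconvcomb t y z) <= t * psi y + (1 - t) * psi z.
End euclid.

Definition barycenter {R : realType} {n : nat}
  (p : probability (n.-tuple R) R) : n.-tuple R :=
  [tuple fine (\int[p]_y (tnth y i)%:E)%E | i < n].

Definition mcontinuous {R : realType} {X : Type} (dX : X -> X -> R) (f : X -> R) : Prop :=
  forall x (e : R), 0 < e -> exists2 del : R, 0 < del &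
    forall x', dX x x' < del -> `|f x - f x'| < e.

Definition econtinuous {R : realType} {n : nat} (f : n.-tuple R -> R) : Prop :=
  forall y (e : R), 0 < e -> exists2 del : R, 0 < del &
    forall y', tnorm (tsub y y') < del -> `|f y - f y'| < e.

Definition mecontinuous2 {R : realType} {X : Type} {n : nat} (dX : X -> X -> R)
    (c : X -> n.-tuple R -> R) : Prop :=
  forall x y (e : R), 0 < e -> exists2 del : R, 0 < del &
    forall x' y', dX x x' < del -> tnorm (tsub y y') < del -> `|c x y - c x' y'| < e.

Section couplings.
Context {R : realType} {d : measure_display} {X : measurableType d} {n : nat}.

Definition is_coupling (mu : probability X R) (nu : probability (n.-tuple R) R)
    (pi : probability (X * n.-tuple R)%type R) : Prop :=
  (forall A, measurable A -> pi (A `*` setT) = mu A) /\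
  (forall B, measurable B -> pi (setT `*` B) = nu B).

Definition is_disintegration (mu : probability X R)
    (pi : probability (X * n.-tuple R)%type R) (k : X -> probability (n.-tuple R) R) : Prop :=
  (forall B, measurable B -> measurable_fun [set: X] ((fun x => k x B) : X -> \bar R)) /\
  (forall A B, measurable A -> measurable B ->
     pi (A `*` B) = (\int[mu]_(x in A) k x B)%E).
End couplings.

(* Main.v *)
Require Import Defs.
From HB Require Import structures.
From mathcomp Require Import all_boot all_order all_algebra.
From mathcomp Require Import all_classical all_reals all_analysis.
From mathcomp Require Import measurable_realfun lra ring giry.
Import Order.TTheory GRing.Theory Num.Theory.
Import numFieldNormedType.Exports.
Local Open Scope classical_set_scope.
Local Open Scope ring_scope.

(** Write V, D1, D2 for the three quantities. Jensen's inequality at the barycenters gives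
    V <= D2. A competitor of D1 yields one of D2 by taking the supremum over (x, y1) of the
    affine functions y |-> c x y1 - phi x - Delta y1 . (y - y1); conversely, approximate
    subgradients of psi picked in a countable dense set form a measurable Delta, so
    D1 = D2.

    For D2 <= V, the cost is first replaced by a bounded Lipschitz one. The error is at most
    a x + b y with small integrals and b convex, so that Jensen's inequality controls it in
    V as well. Then X and R^n are cut into finitely many cells, and kernels are described
    by their densities with respect to nu, constant on cells. The optimal value is concave
    in the second marginal, and a supergradient at nu, obtained by separating a convex cone
    of R^J x R, is a solution (phi_i, psi_j) of a discrete dual problem. Inf-convolution
    with L |.| extends it to the whole space: as the cost is L-Lipschitz, the dual
    constraint survives and no compactness of the dual solutions is needed. A nearly
    optimal mixture of discrete kernels becomes a genuine kernel by cutting the cells of X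
    into pieces of prescribed mass, which is where mu has to be atomless. *)

(** * Tuples as a Euclidean space, measurability, growth *)

(** The integrand [c x (barycenter (k x))] is not linear in the kernel, so averaging two kernels
    does not average their values. Concavity in the second marginal comes only from randomizing over
    kernels; to undo the randomization without changing the value, different points of one cell of X
    must receive different kernels. The two quantizations play unequal roles. The barycenter of a
    kernel with cellwise constant density is computed exactly from the moments of the cells, so
    quantizing R^n puts no error into the barycenters and is paid for only when psi is integrated.
    Quantizing X costs L times the mean distance to the representatives, once on the primal and once
    on the dual side. An error bound a x + b y with b convex has the form of a dual constraint. Weak
    duality for the difference of two costs thus bounds the primal loss, and adding a and b to the
    potentials repairs the dual side. *)

Lemma measurable_first {d} {X : measurableType d} (P : nat -> set X) :
  (forall k, measurable (P k)) -> (forall x, exists k, P k x) ->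
  exists K : X -> nat, (forall x, P (K x) x) /\
    forall k, measurable (K @^-1` [set k]).
Proof.
move=> mP exP.
have exb x : exists k, `[< P k x >] by have [k Pk] := exP x; exists k; apply/asboolP.
pose K x := ex_minn (exb x).
have KP x k : K x = k <-> P k x /\ forall j, (j < k)%N -> ~ P j x.
  rewrite /K; case: ex_minnP => m /asboolP Pm mmin; split.
    move=> <-; split => // j jm /asboolP /mmin; by rewrite leqNgt jm.
  move=> [Pk kmin]; apply/eqP; rewrite eqn_leq mmin ?andbT; last exact/asboolP.
  by rewrite leqNgt; apply/negP => /kmin.
exists K; split => [x|k]; first by have /KP[] : K x = K x by [].
rewrite (_ : _ @^-1` _ = P k `&` \bigcap_(j < k) ~` P j).
  apply: measurableI => //; by apply: bigcap_measurableType => j _; exact: measurableC.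
apply/seteqP; split => x /=; first by move/KP => [].
by move=> [Pk h]; apply/KP.
Qed.

Lemma measurable_glue {d d'} {X : measurableType d} {Y : measurableType d'}
  (K : X -> nat) (f : nat -> X -> Y) :
  (forall k, measurable (K @^-1` [set k])) ->
  (forall k, measurable_fun setT (f k)) ->
  measurable_fun setT (fun x => f (K x) x).
Proof.
move=> mK mf _ B mB; rewrite setTI.
rewrite (_ : _ @^-1` _ = \bigcup_k (K @^-1` [set k] `&` f k @^-1` B)).
  apply: bigcup_measurable => k _; apply: measurableI => //.
  by rewrite -[X in measurable X]setTI; exact: mf.
apply/seteqP; split => x /=; first by exists (K x).
by move=> [k _ [/= -> ]].
Qed.

(** Equivalent to [tnorm], but its triangle inequality, convexity and measurability reduce to
    coordinates; the Euclidean norm is met only through the comparison of the two. *)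
Definition l1norm {R : realType} {n} (y : n.-tuple R) : R := \sum_(i < n) `|tnth y i|.
Definition l1dist {R : realType} {n} (y z : n.-tuple R) : R :=
  \sum_(i < n) `|tnth y i - tnth z i|.

Section euclidean_basics.
Context {R : realType} {n : nat}.
Implicit Types y z w : n.-tuple R.

Lemma l1norm_ge0 y : 0 <= l1norm y.
Proof. by rewrite sumr_ge0. Qed.

Lemma l1dist_ge0 y z : 0 <= l1dist y z.
Proof. by rewrite sumr_ge0. Qed.

Lemma l1distxx y : l1dist y y = 0.
Proof. by rewrite /l1dist big1// => i _; rewrite subrr normr0. Qed.

Lemma l1distC y z : l1dist y z = l1dist z y.
Proof. by apply: eq_bigr => i _; rewrite distrC. Qed.

Lemma l1dist_triangle y z w : l1dist y w <= l1dist y z + l1dist z w.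
Proof. by rewrite -big_split; apply: ler_sum => i _; exact: ler_distD. Qed.

Lemma tnorm_ge0 y : 0 <= tnorm y.
Proof. exact: sqrtr_ge0. Qed.

Lemma coord_le_tnorm y i : `|tnth y i| <= tnorm y.
Proof.
rewrite -sqrtr_sqr ler_wsqrtr// (bigD1 i)//= lerDl sumr_ge0// => j _.
exact: sqr_ge0.
Qed.

Lemma tnorm_le_l1norm y : tnorm y <= l1norm y.
Proof.
have sum_sqr (s : seq 'I_n) :
    \sum_(i <- s) tnth y i ^+ 2 <= (\sum_(i <- s) `|tnth y i|) ^+ 2.
  elim: s => [|i s IH]; first by rewrite !big_nil expr0n.
  rewrite !big_cons sqrrD real_normK ?num_real// -addrA lerD2l.
  rewrite (le_trans IH)// lerDr mulrn_wge0// mulr_ge0// sumr_ge0//.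
by rewrite -[leRHS]ger0_norm ?l1norm_ge0// -sqrtr_sqr ler_wsqrtr// sum_sqr.
Qed.

Lemma l1norm_le_tnorm y : l1norm y <= n%:R * tnorm y.
Proof.
rewrite mulr_natl -[X in _ *+ X]card_ord -sumr_const.
by apply: ler_sum => i _; exact: coord_le_tnorm.
Qed.

Lemma l1dist_tsub y z : l1dist y z = l1norm (tsub y z).
Proof. by apply: eq_bigr => i _; rewrite tnth_mktuple. Qed.

Lemma l1norm_le_dist y z : l1norm y <= l1norm z + l1dist y z.
Proof.
rewrite -big_split; apply: ler_sum => i _ /=.
by rewrite -[X in `|X| <= _](subrK (tnth z i)) addrC ler_normD.
Qed.

Lemma l1dist_le_norm y z : l1dist y z <= l1norm y + l1norm z.
Proof. by rewrite -big_split; apply: ler_sum => i _; exact: ler_normB. Qed.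

Lemma econtinuous_l1 (f : n.-tuple R -> R) :
  (forall y e, 0 < e -> exists2 del, 0 < del &
    forall y', l1dist y y' < del -> `|f y - f y'| < e) -> econtinuous f.
Proof.
move=> h y e e0; have [del del0 hd] := h y e e0.
(* [n.+1] rather than [n], so that dimension 0 needs no separate case. *)
exists (del / n.+1%:R); first by rewrite divr_gt0.
move=> y' yy'; apply: hd; rewrite l1dist_tsub (le_lt_trans (l1norm_le_tnorm _))//.
move: yy'; rewrite ltr_pdivlMr// mulrC; apply: le_lt_trans.
by rewrite ler_wpM2r ?tnorm_ge0// ler_nat.
Qed.

Lemma econtinuous_l1E (f : n.-tuple R -> R) : econtinuous f ->
  forall y e, 0 < e -> exists2 del, 0 < del &
    forall y', l1dist y y' < del -> `|f y - f y'| < e.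
Proof.
move=> cf y e e0; have [del del0 hd] := cf y e e0; exists del => // y' h.
by apply: hd; rewrite (le_lt_trans (tnorm_le_l1norm _))// -l1dist_tsub.
Qed.

Lemma dense_tuples : exists q : nat -> n.-tuple R,
  forall y e, 0 < e -> exists k, l1dist y (q k) < e.
Proof.
(* Rational points, enumerated by decoding [k]; a number that codes no tuple gives the origin. *)
pose q k : n.-tuple R := [tuple ratr (tnth (odflt [tuple 0%Q | i < n] (unpickle k)) i) | i < n].
exists q => y e e0.
have e'0 : 0 < e / n.+1%:R by rewrite divr_gt0.
have /choice[g gP] : forall i : 'I_n, exists r : rat, `|tnth y i - ratr r| < e / n.+1%:R.
  move=> i; have /rat_in_itvoo[r] : tnth y i - e / n.+1%:R < tnth y i + e / n.+1%:R.
    by rewrite ltrBlDr -addrA ltrDl addr_gt0.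
  by rewrite in_itv/= => /andP[h1 h2]; exists r; rewrite ltr_distlC h1.
exists (pickle [tuple g i | i < n]); rewrite /l1dist /q pickleK /=.
apply: (@le_lt_trans _ _ (\sum_(i < n) e / n.+1%:R)).
  by apply: ler_sum => i _; rewrite !tnth_mktuple ltW.
rewrite sumr_const card_ord -[_ *+ n]mulr_natr -mulrA gtr_pMr//.
by rewrite mulrC ltr_pdivrMr// mul1r ltr_nat.
Qed.

Lemma measurable_l1norm : measurable_fun setT (@l1norm R n).
Proof.
apply: measurable_sum => i; apply: measurableT_comp => //; exact: measurable_tnth.
Qed.

Lemma measurable_l1dist z : measurable_fun setT (fun y => l1dist y z).
Proof.
apply: measurable_sum => i; apply: measurableT_comp => //.
by apply: measurable_funB => //; exact: measurable_tnth.
Qed.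

Lemma measurable_tnorm : measurable_fun setT (@tnorm R n).
Proof.
apply: (@measurableT_comp _ _ _ _ _ _ (@Num.sqrt R)) => //.
  by apply: continuous_measurable_fun => x; exact: sqrt_continuous.
apply: measurable_sum => i; apply: measurable_funX; exact: measurable_tnth.
Qed.

(** Replacing [g x] by a dense point within 1/(m+1) leaves countably many values, where
    measurability is a gluing; continuity in the second variable gives the limit. This is what makes
    [c x (barycenter (k x))] measurable. *)
Lemma measurable_caratheodory {d} {X : measurableType d}
  (F : X -> n.-tuple R -> R) (g : X -> n.-tuple R) :
  (forall x, econtinuous (F x)) -> (forall y, measurable_fun setT (F ^~ y)) ->
  measurable_fun setT g -> measurable_fun setT (fun x => F x (g x)).
Proof.
move=> cF mF mg; have [q qP] := dense_tuples.
have /choice[K KP] : forall m : nat, exists K : X -> nat,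
    (forall x, l1dist (g x) (q (K x)) < m.+1%:R^-1) /\
    forall k, measurable (K @^-1` [set k]).
  move=> m; apply: (@measurable_first _ _ (fun k => [set x | l1dist (g x) (q k) < m.+1%:R^-1])).
    move=> k; rewrite -[X in measurable X]setTI.
    rewrite (_ : [set x | _] = (l1dist^~ (q k) \o g) @^-1` `]-oo, m.+1%:R^-1[).
      apply: (measurableT_comp (measurable_l1dist _) mg) => //.
    by apply/seteqP; split => x /=; rewrite in_itv.
  by move=> x; apply: qP; rewrite invr_gt0.
apply: (@measurable_fun_cvg _ _ _ _ (fun m x => F x (q (K m x)))).
  by move=> m; apply: (@measurable_glue _ _ _ _ (K m) (fun k x => F x (q k))) => //; exact: (KP m).2.
move=> x _; apply/cvgrPdist_lt => e e0.
have [del del0 hd] := econtinuous_l1E _ (cF x) (g x) e e0.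
near=> m; apply: hd; apply: lt_trans ((KP m).1 x) _.
near: m; exact: near_infty_natSinv_lt (PosNum del0).
Unshelve. all: by end_near.
Qed.

Lemma econtinuous_measurable (f : n.-tuple R -> R) : econtinuous f -> measurable_fun setT f.
Proof.
move=> cf; apply: (@measurable_caratheodory _ _ (fun=> f) id) => //.
Qed.

End euclidean_basics.

Section metric_measurability.
Context {R : realType} {d : measure_display} {X : measurableType d} (dX : X -> X -> R).

Lemma mcontinuous_measurable (f : X -> R) :
  (measurable : set (set X)) = <<s mopen dX >> -> mcontinuous dX f ->
  measurable_fun setT f.
Proof.
move=> mE cf; apply: (measurability (@RGenOInfty.G R)); first exact: RGenOInfty.measurableE.
move=> _ [_ [a ->] <-]; rewrite setTI mE; apply: sub_sigma_algebra => x /=.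
rewrite in_itv/= andbT => ax.
have [del del0 hd] := cf x (f x - a) ltac:(lra).
exists del => // y /hd; rewrite ltr_distlC => /andP[h _].
by rewrite /= in_itv/= andbT; lra.
Qed.

(** Asking only that [dX] be nonnegative lets the lemma serve for [l1dist] too. *)
Lemma mlipschitz_continuous (f : X -> R) (L : R) :
  (forall x y, 0 <= dX x y) -> (forall x y, `|f x - f y| <= L * dX x y) ->
  mcontinuous dX f.
Proof.
move=> dX0 h x e e0; exists (e / (`|L| + 1)); first by rewrite divr_gt0// ltr_wpDl.
move=> y; rewrite ltr_pdivlMr ?ltr_wpDl// => hy; apply: le_lt_trans (h x y) _.
apply: le_lt_trans hy; rewrite mulrC ler_wpM2l// (le_trans (ler_norm _))//; lra.
Qed.

End metric_measurability.

(** Growth bounds come in two shapes, (1 + a)^r for potentials and 1 + a^r for costs; this passes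
    from the first to the second. *)
Lemma powR_1D_le {R : realType} (r a : R) : 0 <= a -> 1 <= r ->
  (1 + a) `^ r <= 2 `^ r * (1 + a `^ r).
Proof.
move=> a0 r1; have r0 : 0 <= r by lra.
have [a1|a1] := leP a 1.
  apply: (@le_trans _ _ (2 `^ r)); first by rewrite ge0_ler_powR ?nnegrE; lra.
  by rewrite ler_peMr ?powR_ge0// lerDl powR_ge0.
apply: (@le_trans _ _ ((2 * a) `^ r)); first by rewrite ge0_ler_powR ?nnegrE; lra.
by rewrite powRM// ler_wpM2l ?powR_ge0// lerDr.
Qed.

Lemma le_powR_self {R : realType} (r a : R) : 0 <= a -> 1 <= r -> a <= 1 + a `^ r.
Proof.
move=> a0 r1; have [a1|a1] := leP a 1; first by rewrite (le_trans a1)// lerDl powR_ge0.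
by rewrite -[leLHS]powRr1// (le_trans (ler_powR (ltW a1) r1))// lerDr.
Qed.

Lemma measurable_powRT {R : realType} {d} {T : measurableType d} (g : T -> R) (r : R) :
  measurable_fun setT g -> measurable_fun setT (fun x => g x `^ r).
Proof.
by move=> mg; apply: (@measurableT_comp _ _ _ _ _ _ (@powR R ^~ r)) => //; exact: measurable_powR.
Qed.

Section growth.
Context {R : realType} {d : measure_display} {T : measurableType d}
  (P : probability T R) (g : T -> R) (r : R).
Hypotheses (r1 : 1 <= r) (g0 : forall x, 0 <= g x) (mg : measurable_fun setT g)
  (Pg : (\int[P]_x (g x `^ r)%:E < +oo)%E).

Lemma integrable_moment : P.-integrable setT (fun x => (g x `^ r)%:E).
Proof.
apply/integrableP; split; first by apply/measurable_EFinP; exact: measurable_powRT.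
by under eq_integral do rewrite gee0_abs ?lee_fin ?powR_ge0//.
Qed.

Lemma integrable_growth (f : T -> R) (C : R) : measurable_fun setT f ->
  (forall x, `|f x| <= C * (1 + g x `^ r)) -> P.-integrable setT (EFin \o f).
Proof.
move=> mf fC.
apply: (le_integrable measurableT (g := fun x => (C%:E * (1%:E + (g x `^ r)%:E))%E)).
- exact/measurable_EFinP.
- move=> x _; rewrite /= lee_fin.
  by rewrite (le_trans (fC x))// ler_norm.
- apply: integrableZl => //; apply: integrableD => //.
    exact: finite_measure_integrable_cst.
  exact: integrable_moment.
Qed.

Lemma integrable_growth_powR (f : T -> R) (C : R) : measurable_fun setT f ->
  (forall x, `|f x| <= C * (1 + g x) `^ r) -> P.-integrable setT (EFin \o f).
Proof.
move=> mf fC; apply: (@integrable_growth _ (`|C| * 2 `^ r)) => // x.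
rewrite (le_trans (fC x))// (le_trans (ler_wpM2r (powR_ge0 _ _) (ler_norm C)))//.
by rewrite -mulrA ler_wpM2l// powR_1D_le.
Qed.

Lemma integrable_base : P.-integrable setT (EFin \o g).
Proof.
apply: (@integrable_growth _ 1) => // x.
by rewrite mul1r ger0_norm// le_powR_self.
Qed.

End growth.

(** * Continuity of locally bounded convex functions *)

Section convex_continuity.
Context {R : realType} {n : nat}.
Implicit Types (psi : n.-tuple R -> R) (y z : n.-tuple R).

(** Prolonging the segment from y to z up to distance 1 from y, on both sides, and applying
    convexity twice gives |psi z - psi y| <= 2 K |z - y|, where K bounds psi on the unit ball around
    y. *)
Lemma convex_locally_bounded_continuous psi : convex_fun psi ->
  (forall y, exists K, forall z, l1dist y z <= 1 -> `|psi z| <= K) -> econtinuous psi.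
Proof.
move=> cpsi bpsi; apply: econtinuous_l1 => y e e0.
have [K hK] := bpsi y.
have K0 : 0 <= K by rewrite (le_trans _ (hK y _)) ?l1distxx.
pose del := Num.min 1 (e / (2 * K + 1)).
have del0 : 0 < del by rewrite lt_min ltr01 divr_gt0//; lra.
exists del => // z yz.
have [->|/eqP zy] := eqVneq z y; first by rewrite subrr normr0.
have s0 : 0 < l1dist y z.
  rewrite lt_neqAle l1dist_ge0 andbT; apply/eqP => h; apply: zy.
  apply: eq_from_tnth => i; apply/eqP; rewrite eq_sym -subr_eq0 -normr_eq0 eq_le normr_ge0 andbT.
  by rewrite h /l1dist (bigD1 i)//= lerDl sumr_ge0.
set s := l1dist y z in yz s0.
have [s1 se] : s < 1 /\ s * (2 * K + 1) < e.
  move: yz; rewrite lt_min => /andP[-> h]; split => //.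
  by rewrite -ltr_pdivlMr//; lra.
have sneq : s != 0 by rewrite gt_eqF.
(* The points at distance 1 from y on the line through z: beyond z for [sg] = 1, opposite to z for
   [sg] = -1. *)
pose refl (sg : R) : n.-tuple R := [tuple tnth y i + sg * (tnth z i - tnth y i) / s | i < n].
have refl1 sg : `|sg| = 1 -> `|psi (refl sg)| <= K.
  move=> sg1; apply: hK; rewrite (_ : l1dist _ _ = 1)//.
  rewrite -(divff sneq) -[X in _ = X / _]/(\sum_i `|tnth y i - tnth z i|) mulr_suml; apply: eq_bigr => i _.
  rewrite tnth_mktuple opprD addrA subrr add0r normrN !normrM sg1 mul1r distrC.
  by rewrite normfV (gtr0_norm s0).
have psiy : `|psi y| <= K by apply: hK; rewrite l1distxx.
move: psiy; rewrite ler_norml => /andP[psiy1 psiy2].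
have h1 : psi z - psi y <= s * (2 * K).
  have -> : z = tconvcomb s (refl 1) y.
    apply: eq_from_tnth => i; rewrite !tnth_mktuple; field => //.
  have s01 : 0 <= s <= 1 by rewrite !ltW.
  have := cpsi s (refl 1) y s01; have := refl1 1 (normr1 _).
  rewrite ler_norml => /andP[a1 a2] h; nra.
have h2 : psi y - psi z <= s * (2 * K).
  have ns : 1 + s != 0 by rewrite gt_eqF//; lra.
  (* For the lower bound y itself is the intermediate point, between the opposite point and z. *)
  have yE : y = tconvcomb (s / (1 + s)) (refl (-1)) z.
    apply: eq_from_tnth => i; rewrite !tnth_mktuple; field; apply/andP; split => //.
  have s01 : 0 <= s / (1 + s) <= 1.
    apply/andP; split; first by rewrite divr_ge0//; lra.
    by rewrite ler_pdivrMr; lra.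
  have := cpsi _ (refl (-1)) z s01; rewrite -yE.
  have := refl1 (-1) ltac:(by rewrite normrN normr1).
  rewrite ler_norml => /andP[a1 a2] h.
  have {}h : (1 + s) * psi y <= s * psi (refl (-1)) + psi z.
    have := ler_wpM2l (_ : 0 <= 1 + s) h => /(_ ltac:(lra)) h'.
    apply: (le_trans h'); rewrite le_eqVlt; apply/orP; left; apply/eqP.
    by field.
  nra.
rewrite ltr_norml; apply/andP; split; nra.
Qed.

(** The convex potentials and majorants built below get their continuity from here. *)
Lemma convex_growth_continuous psi (r C : R) : 1 <= r -> convex_fun psi ->
  (forall y, `|psi y| <= C * (1 + tnorm y) `^ r) -> econtinuous psi.
Proof.
move=> r1 cpsi gpsi; apply: convex_locally_bounded_continuous => // y.
exists (`|C| * (1 + (l1norm y + 1)) `^ r) => z yz.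
rewrite (le_trans (gpsi z))// (le_trans (ler_wpM2r (powR_ge0 _ _) (ler_norm C)))//.
rewrite ler_wpM2l//; apply: ge0_ler_powR; rewrite ?nnegrE.
- by lra.
- by have := tnorm_ge0 z; lra.
- by have := l1norm_ge0 y; lra.
- rewrite lerD2l (le_trans (tnorm_le_l1norm z))// (le_trans (l1norm_le_dist z y))//.
  by rewrite lerD2l l1distC.
Qed.

End convex_continuity.

(** * Separation in finite dimension, subgradients, Jensen's inequality *)

(** The infimum of the a with [C v a] is a finite sublinear function of v, and this is the
    Hahn-Banach theorem along e 0, ..., e (k-1). The last direction receives its value first; the
    induction then runs on an enlarged cone in the same space. *)
Lemma cone_functional_step {R : realType} {V : lmodType R} (C : V -> R -> Prop) :
  (forall v a w b, C v a -> C w b -> C (v + w) (a + b)) ->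
  (forall t v a, 0 < t -> C v a -> C (t *: v) (t * a)) ->
  (forall v, exists a, C v a) -> (forall a, C 0 a -> 0 <= a) ->
  forall (k : nat) (e : nat -> V), exists alpha : nat -> R,
    forall (t : nat -> R) a, C (\sum_(i < k) t i *: e i) a ->
      \sum_(i < k) t i * alpha i <= a.
Proof.
move=> CD CZ CT C0 k e; elim: k C CD CZ CT C0 => [|k IH] C CD CZ CT C0.
  by exists (fun=> 0) => t a; rewrite !big_ord0 => /C0.
pose S := [set b | C (e k) b].
have SN b b' : C (e k) b -> C (- e k) b' -> - b' <= b.
  by move=> h h'; have := CD _ _ _ _ h h'; rewrite subrr => /C0; lra.
have [b0' Hb0'] := CT (- e k).
have Sinf : has_inf S.
  split; first by have [b Hb] := CT (e k); exists b.
  by exists (- b0') => b Sb; exact: SN.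
pose al := inf S.
(* For t > 0 this is that [al] bounds [S] below; for t < 0 it is that [al] is the greatest lower
   bound, tested against [C (- e k)]. *)
have al1 t b : C (t *: e k) b -> t * al <= b.
  have [t0|t0|->] := ltgtP t 0; last by rewrite scale0r mul0r => /C0.
    move=> h; have nt : 0 < (- t)^-1 by rewrite invr_gt0; lra.
    have := CZ _ _ _ nt h; rewrite scalerA invrN mulNr mulVf ?ltr0_neq0// scaleN1r => h'.
    have : - (- t^-1 * b) <= al.
      by apply: lb_le_inf; [case: Sinf|move=> x Sx; exact: SN Sx h'].
    rewrite -mulNr opprK => h2.
    have := ler_wnM2l (ltW t0) h2.
    by rewrite mulrA divff ?ltr0_neq0// mul1r.
  move=> h; have it : 0 < t^-1 by rewrite invr_gt0.
  have := CZ _ _ _ it h; rewrite scalerA mulVf ?gt_eqF// scale1r => h'.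
  have : al <= t^-1 * b by apply: ge_inf => //; case: Sinf.
  by move=> h2; rewrite -ler_pdivlMl.
(* Adding to the cone the line spanned by (e k, al); [al1] keeps it nonnegative over the origin. *)
pose C' := fun v a => exists t, C (v + t *: e k) (a + t * al).
have [|||| alpha Halpha] := IH C'.
- move=> v a w b [t ht] [s hs]; exists (t + s).
  by rewrite scalerDl mulrDl addrACA [a + b + _]addrACA; exact: CD.
- move=> t v a t0 [s hs]; exists (t * s).
  by rewrite -scalerA -scalerDr -mulrA -mulrDr; exact: CZ.
- by move=> v; have [a ha] := CT v; exists a, 0; rewrite scale0r mul0r !addr0.
- move=> a [t]; rewrite add0r => /al1; lra.
exists (fun i => if i == k then al else alpha i) => t a.
rewrite !big_ord_recr /= eqxx => h.
have h1 : \sum_(i < k) t i * alpha i <= a - t k * al.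
  by apply: Halpha; exists (t k); rewrite subrK.
rewrite -lerBrDr (le_trans _ h1)// ler_sum// => i _.
by rewrite ltn_eqF.
Qed.

(* Separation of the origin from a convex cone of [R^n x R] that projects onto
   [R^n]. *)
Lemma cone_functional {R : realType} {n : nat} (C : ('I_n -> R) -> R -> Prop) :
  (forall v a w b, C v a -> C w b -> C (v + w) (a + b)) ->
  (forall t v a, 0 < t -> C v a -> C (t *: v) (t * a)) ->
  (forall v, exists a, C v a) -> (forall a, C 0 a -> 0 <= a) ->
  exists alpha : 'I_n -> R,
    forall v a, C v a -> \sum_(i < n) v i * alpha i <= a.
Proof.
move=> CD CZ CT C0.
have [al Hal] := cone_functional_step C CD CZ CT C0 n
  (fun i j => (i == j :> nat)%:R).
exists (fun i => al i) => v a Cva.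
pose t (i : nat) := oapp v 0 (insub i : option 'I_n).
have tE (i : 'I_n) : t i = v i by rewrite /t valK.
under eq_bigr do rewrite -tE; apply: Hal.
rewrite (_ : \sum_(i < n) _ = v)//.
apply/funext => j; rewrite fct_sumE (bigD1 j)//= big1 ?addr0.
  by rewrite -[LHS]/(t j * _) eqxx mulr1.
move=> i ij; rewrite -[LHS]/(t i * _) (_ : (_ == _) = false) ?mulr0//.
exact/negbTE.
Qed.

(** The cone [C] is spanned by the epigraph of psi recentred at (y, psi y). Its scaling factor w
    makes sums correspond to convex combinations of weights w/(w+w') and w'/(w+w'). *)
Lemma convex_subgradient {R : realType} {n : nat} (psi : n.-tuple R -> R) :
  convex_fun psi -> forall y, exists g : n.-tuple R,
    forall z, psi y + tdot g (tsub z y) <= psi z.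
Proof.
move=> cpsi y.
pose shift (v : 'I_n -> R) w : n.-tuple R := [tuple tnth y i + v i / w | i < n].
pose C v a := exists2 w, 0 < w & w * (psi (shift v w) - psi y) <= a.
have [|||| al Hal] := cone_functional C.
- move=> v a v' b [w w0 hw] [w' w0' hw']; exists (w + w'); first exact: addr_gt0.
  pose t := w / (w + w').
  have ww0 : 0 < w + w' by exact: addr_gt0.
  have t01 : 0 <= t <= 1.
    rewrite /t; apply/andP; split; first by rewrite divr_ge0// ltW.
    by rewrite ler_pdivrMr// mul1r lerDl ltW.
  have tE : (w + w') * t = w by rewrite /t mulrC divfK ?gt_eqF.
  have -> : shift (v + v') (w + w') = tconvcomb t (shift v w) (shift v' w').
    apply: eq_from_tnth => i; rewrite !tnth_mktuple /t.
    rewrite -[(v + v') i]/(v i + v' i); field.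
    by rewrite !gt_eqF.
  have h := cpsi t (shift v w) (shift v' w') t01.
  have {}h := ler_wpM2l (ltW ww0) h.
  rewrite mulrBr lerBlDr; apply: (le_trans h).
  have -> : forall A B, (w + w') * (t * A + (1 - t) * B) = w * A + w' * B.
    move=> A B; transitivity ((w + w') * t * A + (w + w' - (w + w') * t) * B).
      by ring.
    by rewrite tE; ring.
  by move: hw hw'; rewrite !mulrBr; lra.
- move=> t v a t0 [w w0 hw]; exists (t * w); first exact: mulr_gt0.
  have -> : shift (t *: v) (t * w) = shift v w.
    apply: eq_from_tnth => i; rewrite !tnth_mktuple.
    rewrite -[(t *: v) i]/(t * v i); field.
    by rewrite !gt_eqF.
  by rewrite -mulrA ler_pM2l.
- by move=> v; exists (1 * (psi (shift v 1) - psi y)), 1.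
- move=> a [w w0].
  have -> : shift 0 w = y.
    by apply: eq_from_tnth => i; rewrite !tnth_mktuple mul0r addr0.
  by rewrite subrr mulr0.
exists [tuple al i | i < n] => z.
rewrite -lerBrDl; have := Hal (fun i => tnth z i - tnth y i) (psi z - psi y).
rewrite /tdot; under [X in _ -> X <= _]eq_bigr do rewrite !tnth_mktuple mulrC.
apply; exists 1 => //; rewrite mul1r lerB//.
rewrite le_eqVlt; apply/orP; left; apply/eqP; congr psi.
by apply: eq_from_tnth => i; rewrite !tnth_mktuple divr1 addrC subrK.
Qed.

Section rintegral_extra.
Context {d} {T : measurableType d} {R : realType} (mu : {measure set T -> \bar R}).

Lemma Rintegral_sum (D : set T) {I : Type} (s : seq I) (f : I -> T -> R) : measurable D ->
  (forall i, mu.-integrable D (EFin \o f i)) ->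
  \int[mu]_(x in D) (\sum_(i <- s) f i x) = \sum_(i <- s) \int[mu]_(x in D) f i x.
Proof.
move=> mD intf; elim: s => [|i s IH].
  by rewrite big_nil (_ : (fun _ => _) = cst 0) ?Rintegral_cst ?mul0r//; apply/funext => x; rewrite big_nil.
rewrite big_cons -IH -RintegralD//.
  by congr Rintegral; apply/funext => x; rewrite big_cons.
have := @integrable_sum _ _ _ mu D mD _ s xpredT (fun i => EFin \o f i) (fun i _ => intf i).
by under eq_fun do rewrite sumEFin.
Qed.

(** Replacing f by the minimum of f and g, equal to f almost everywhere, reduces to a comparison at
    every point. *)
Lemma ae_le_integral (f g : T -> \bar R) :
  mu.-integrable setT f -> mu.-integrable setT g ->
  {ae mu, forall x, f x <= g x}%E -> (\int[mu]_x f x <= \int[mu]_x g x)%E.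
Proof.
move=> intf intg fg.
have mf := measurable_int mu intf; have mg := measurable_int mu intg.
have mmin : measurable_fun setT (fun x => mine (f x) (g x)) by exact: measurable_mine.
rewrite (ae_eq_integral (fun x => mine (f x) (g x)))//.
  apply: le_integral => //; last by move=> x _; rewrite ge_min lexx orbT.
  apply: (le_integrable measurableT (g := fun x => (`|f x| + `|g x|)%E)) => //.
    move=> x _; rewrite [leRHS]gee0_abs ?adde_ge0//.
    by rewrite /mine; case: ifPn => _; rewrite ?leeDl ?leeDr.
  by apply: integrableD => //; exact: integrable_abse.
by apply: filterS fg => x fgx _; rewrite min_l.
Qed.

End rintegral_extra.

Lemma Rintegral_prob_cst {d} {T : measurableType d} {R : realType}
  (P : probability T R) (a : R) : \int[P]_x a = a.
Proof.
have PT : fine (P setT) = 1 by rewrite probability_setT.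
by rewrite Rintegral_cst// -[RHS]mulr1; congr (_ * _); exact: PT.
Qed.

(** Integrate the affine function supporting psi at the barycenter: its linear part has mean
    zero. *)
Lemma jensen_barycenter {R : realType} {n : nat} (p : probability (n.-tuple R) R)
    (psi : n.-tuple R -> R) :
  p.-integrable setT (EFin \o l1norm) -> convex_fun psi ->
  p.-integrable setT (EFin \o psi) ->
  psi (barycenter p) <= \int[p]_y psi y.
Proof.
move=> ip cpsi ipsi.
have icoord i : p.-integrable setT (EFin \o (fun y : n.-tuple R => tnth y i)).
  apply: (le_integrable measurableT _ _ ip).
    by apply/measurable_EFinP; exact: measurable_tnth.
  move=> y _; rewrite /= lee_fin [leRHS]ger0_norm ?l1norm_ge0//.
  by rewrite /l1norm (bigD1 i)//= lerDl sumr_ge0.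
have icst (c : R) : p.-integrable setT (EFin \o cst c).
  exact: finite_measure_integrable_cst.
have [g hg] := convex_subgradient psi cpsi (barycenter p).
set b := barycenter p in hg *.
have idiff i : p.-integrable setT (EFin \o (fun y : n.-tuple R => tnth y i - tnth b i)).
  rewrite (_ : _ \o _ = fun y => (tnth y i)%:E - (tnth b i)%:E)%E//.
  by apply: integrableB => //; [exact: icoord|exact: icst].
have iterm i : p.-integrable setT (EFin \o (fun y : n.-tuple R => tnth g i * (tnth y i - tnth b i))).
  rewrite (_ : _ \o _ = fun y => (tnth g i)%:E * (tnth y i - tnth b i)%:E)%E//.
  by apply: integrableZl => //; exact: idiff.
have isum : p.-integrable setT (EFin \o (fun y : n.-tuple R => \sum_(i < n) tnth g i * (tnth y i - tnth b i))).
  have := @integrable_sum _ _ _ p setT measurableT _ (index_enum 'I_n) xpredT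
    (fun i => EFin \o (fun y : n.-tuple R => tnth g i * (tnth y i - tnth b i)))
    (fun i _ => iterm i).
  by under eq_fun do rewrite sumEFin.
apply: (@le_trans _ _ (\int[p]_y (psi b + \sum_(i < n) tnth g i * (tnth y i - tnth b i)))).
  rewrite RintegralD//; last exact: icst.
  rewrite Rintegral_prob_cst Rintegral_sum//.
  rewrite big1 ?addr0// => i _.
  rewrite RintegralZl// RintegralB//; do ?[exact: icoord|exact: icst].
  by rewrite Rintegral_prob_cst tnth_mktuple subrr mulr0.
apply: le_Rintegral => //.
  by have := integrableD measurableT (icst (psi b)) isum.
move=> y _; rewrite (le_trans _ (hg y))// lerD2l.
by rewrite /tdot; under [leRHS]eq_bigr do rewrite tnth_mktuple.
Qed.

(** * Integration along a coupling *)

Section coupling_integration.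
Context {R : realType} {d : measure_display} {X : measurableType d} {n : nat}
  (mu : probability X R) (nu : probability (n.-tuple R) R)
  (pi : probability (X * n.-tuple R)%type R) (k : X -> probability (n.-tuple R) R).
Hypotheses (cpl : is_coupling mu nu pi) (dis : is_disintegration mu pi k).

Let mk : measurable_fun [set: X] (fun x => k x : giry (n.-tuple R) R).
Proof. by apply: measurable_giry_codensity => // B mB; exact: dis.1. Qed.

Lemma measurable_kernel_integral (h : n.-tuple R -> \bar R) :
  measurable_fun setT h -> (forall y, 0 <= h y)%E ->
  measurable_fun setT (fun x => \int[k x]_y h y)%E.
Proof.
move=> mh h0; apply: (@measurable_fun_integral_kernel _ _ _ _ _ (fun x => k x)) => // U mU.
exact: dis.1.
Qed.

(** The disintegration on sets [setT] x B says that nu is the Giry bind of mu along k. *)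
Lemma ge0_coupling_integral (h : n.-tuple R -> \bar R) :
  measurable_fun setT h -> (forall y, 0 <= h y)%E ->
  (\int[nu]_y h y = \int[mu]_x (\int[k x]_y h y))%E.
Proof.
move=> mh h0.
have := giry_int_bind (mu : giry X R) mk mh h0; rewrite /giry_int => <-.
apply: eq_measure_integral => B mB _.
transitivity (pi (setT `*` B)); first by rewrite (cpl.2 B mB).
rewrite (dis.2 setT B measurableT mB).
have := giry_int_map mk (mu : giry X R) (measurable_giry_ev mB).
by move=> hB; apply/esym/hB => m; exact: measure_ge0.
Qed.

Let r_integrable (h : n.-tuple R -> R) (x : X) :
  measurable_fun setT h -> (\int[k x]_y (`|h y|)%:E < +oo)%E ->
  (k x).-integrable setT (EFin \o h).
Proof. by move=> mh h0; apply/integrableP; split => //; exact/measurable_EFinP. Qed.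

Lemma coupling_integral (h : n.-tuple R -> R) :
  nu.-integrable setT (EFin \o h) ->
  mu.-integrable setT (fun x => \int[k x]_y (h y)%:E)%E /\
  (\int[nu]_y (h y)%:E = \int[mu]_x (\int[k x]_y (h y)%:E))%E.
Proof.
move=> inth; have mh := measurable_int nu inth.
pose u x := (\int[k x]_y (EFin \o h)^\+ y)%E.
pose v x := (\int[k x]_y (EFin \o h)^\- y)%E.
have mu' : measurable_fun setT u.
  by apply: measurable_kernel_integral => //; exact: measurable_funepos.
have mv' : measurable_fun setT v.
  by apply: measurable_kernel_integral => //; exact: measurable_funeneg.
have uE : (\int[mu]_x u x = \int[nu]_y (EFin \o h)^\+ y)%E.
  by rewrite -ge0_coupling_integral//; exact: measurable_funepos.
have vE : (\int[mu]_x v x = \int[nu]_y (EFin \o h)^\- y)%E.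
  by rewrite -ge0_coupling_integral//; exact: measurable_funeneg.
have u0 x : (0 <= u x)%E by exact: integral_ge0.
have v0 x : (0 <= v x)%E by exact: integral_ge0.
have iu : mu.-integrable setT u.
  apply/integrableP; split => //; under eq_integral do rewrite gee0_abs//.
  rewrite uE; have /integrableP[_] := integrable_funepos measurableT inth.
  by under eq_integral do rewrite gee0_abs//.
have iv : mu.-integrable setT v.
  apply/integrableP; split => //; under eq_integral do rewrite gee0_abs//.
  rewrite vE; have /integrableP[_] := integrable_funeneg measurableT inth.
  by under eq_integral do rewrite gee0_abs//.
have uvE : (fun x => \int[k x]_y (h y)%:E)%E = (fun x => u x - v x)%E.
  by apply/funext => x; rewrite integralE.
split; first by rewrite uvE; exact: integrableB.
by rewrite integralE -uE -vE -integralB// uvE.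
Qed.

(** Applied to [l1norm], it shows that [barycenter (k x)] is a true mean for almost every x; the
    values that [fine] produces elsewhere stay on a null set. *)
Lemma coupling_ae_integrable (h : n.-tuple R -> R) :
  nu.-integrable setT (EFin \o h) ->
  {ae mu, forall x, (k x).-integrable setT (EFin \o h)}.
Proof.
move=> inth; have mh := measurable_int nu inth.
have inta : nu.-integrable setT (EFin \o (fun y => `|h y|)).
  by have := integrable_abse inth.
have [ia _] := coupling_integral _ inta.
have := integrable_ae measurableT ia.
apply: filterS => x /(_ I) fx; apply: r_integrable; first exact/measurable_EFinP.
by rewrite ltey_eq fx.
Qed.

Lemma measurable_barycenter : measurable_fun setT (fun x => barycenter (k x)).
Proof.
apply/measurable_fun_tnthP => i.
rewrite (_ : _ \o _ = fun x => fine (\int[k x]_y (tnth y i)%:E)); last first.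
  by apply/funext => x /=; rewrite tnth_mktuple.
apply: (@measurableT_comp _ _ _ _ _ _ (@fine R)) => //.
have mi : measurable_fun setT (fun y : n.-tuple R => (tnth y i)%:E).
  by apply/measurable_EFinP; exact: measurable_tnth.
under eq_fun do rewrite integralE.
apply: emeasurable_funB.
- by apply: measurable_kernel_integral => //; exact: measurable_funepos.
- by apply: measurable_kernel_integral => //; exact: measurable_funeneg.
Qed.

Lemma coupling_jensen_ae (psi : n.-tuple R -> R) :
  nu.-integrable setT (EFin \o l1norm) -> convex_fun psi ->
  nu.-integrable setT (EFin \o psi) ->
  {ae mu, forall x, (psi (barycenter (k x)))%:E <= \int[k x]_y (psi y)%:E}%E.
Proof.
move=> i1 cpsi ipsi.
apply: filterS2 (coupling_ae_integrable _ i1) (coupling_ae_integrable _ ipsi) => x h1 h2.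
have /= := jensen_barycenter (k x) psi h1 cpsi h2.
rewrite -lee_fin /Rintegral fineK//; exact: integrable_fin_num.
Qed.

Lemma coupling_jensen (psi : n.-tuple R -> R) :
  nu.-integrable setT (EFin \o l1norm) -> convex_fun psi ->
  nu.-integrable setT (EFin \o psi) ->
  mu.-integrable setT (fun x => (psi (barycenter (k x)))%:E) ->
  (\int[mu]_x (psi (barycenter (k x)))%:E <= \int[nu]_y (psi y)%:E)%E.
Proof.
move=> i1 cpsi ipsi ib; have [iI ->] := coupling_integral _ ipsi.
by apply: ae_le_integral => //; exact: coupling_jensen_ae.
Qed.

(** For nonnegative psi, Jensen's inequality itself dominates psi at the barycenters by an
    integrable function. *)
Lemma ge0_coupling_jensen_integrable (psi : n.-tuple R -> R) :
  nu.-integrable setT (EFin \o l1norm) -> convex_fun psi ->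
  measurable_fun setT psi -> (forall y, 0 <= psi y) ->
  nu.-integrable setT (EFin \o psi) ->
  mu.-integrable setT (fun x => (psi (barycenter (k x)))%:E).
Proof.
move=> i1 cpsi mpsi psi0 ipsi.
have mb : measurable_fun setT (fun x => (psi (barycenter (k x)))%:E).
  by apply/measurable_EFinP; apply: (measurableT_comp mpsi); exact: measurable_barycenter.
apply/integrableP; split => //.
under eq_integral do rewrite gee0_abs ?lee_fin//.
have [/integrableP[_ iI] _] := coupling_integral _ ipsi.
apply: le_lt_trans iI; apply: ae_ge0_le_integral => //.
- by move=> x _; rewrite lee_fin.
- apply: measurableT_comp => //; apply: measurable_kernel_integral => //.
  exact/measurable_EFinP.
- apply: filterS (coupling_jensen_ae _ i1 cpsi ipsi) => x h _.
  by rewrite (le_trans h)// lee_abs.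
Qed.

End coupling_integration.

Section moments.
Context {R : realType} {n : nat} (nu : probability (n.-tuple R) R) (r : R).
Hypotheses (r1 : 1 <= r) (nur : (\int[nu]_y (tnorm y `^ r)%:E < +oo)%E).

Lemma l1norm_powR_le (y : n.-tuple R) : l1norm y `^ r <= n%:R `^ r * tnorm y `^ r.
Proof.
rewrite -powRM ?tnorm_ge0//; apply: ge0_ler_powR; rewrite ?nnegrE ?l1norm_ge0 ?l1norm_le_tnorm//.
- by move: r1; lra.
- by rewrite mulr_ge0// tnorm_ge0.
Qed.

Lemma integrable_l1norm_powR : nu.-integrable setT (EFin \o (fun y => l1norm y `^ r)).
Proof.
apply: (integrable_growth nu (@tnorm R n) r measurable_tnorm nur _ (n%:R `^ r)).
  by apply: measurable_powRT; exact: measurable_l1norm.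
move=> y; rewrite ger0_norm ?powR_ge0// (le_trans (l1norm_powR_le y))//.
by rewrite ler_wpM2l ?powR_ge0// lerDr.
Qed.

Lemma l1norm_powR_lty : (\int[nu]_y (l1norm y `^ r)%:E < +oo)%E.
Proof.
have /integrableP[_] := integrable_l1norm_powR.
by under eq_integral do rewrite gee0_abs ?lee_fin ?powR_ge0//.
Qed.

Lemma integrable_l1norm : nu.-integrable setT (EFin \o l1norm).
Proof.
exact: (integrable_base nu _ r r1 l1norm_ge0 measurable_l1norm l1norm_powR_lty).
Qed.

End moments.

Section convex_examples.
Context {R : realType} {n : nat}.
Implicit Types f g : n.-tuple R -> R.

Lemma convex_l1norm : convex_fun (@l1norm R n).
Proof.
move=> t y z /andP[t0 t1]; rewrite /l1norm !mulr_sumr -big_split.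
apply: ler_sum => i _; rewrite tnth_mktuple (le_trans (ler_normD _ _))//= !normrM.
by rewrite (ger0_norm t0) (@ger0_norm _ (1 - t)) ?subr_ge0.
Qed.

Lemma convex_funD f g : convex_fun f -> convex_fun g -> convex_fun (fun y => f y + g y).
Proof.
by move=> cf cg t y z t01; have := cf t y z t01; have := cg t y z t01; lra.
Qed.

Lemma convex_fun_cst (a : R) : convex_fun (fun _ : n.-tuple R => a).
Proof. by move=> t y z _; lra. Qed.

Lemma convex_funZ (a : R) f : 0 <= a -> convex_fun f -> convex_fun (fun y => a * f y).
Proof.
move=> a0 cf t y z t01; have h := ler_wpM2l a0 (cf t y z t01).
by rewrite (le_trans h)//; lra.
Qed.

Lemma convex_fun_max0 f : convex_fun f -> convex_fun (fun y => Num.max 0 (f y)).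
Proof.
move=> cf t y z t01; have /andP[t0 t1] := t01; have h := cf t y z t01.
rewrite ge_max; apply/andP; split.
  by rewrite addr_ge0// mulr_ge0 ?subr_ge0// le_max lexx.
rewrite (le_trans h)// lerD// ler_wpM2l ?subr_ge0// le_max lexx orbT//.
Qed.

Lemma convex_l1norm_powR (r : R) : 1 <= r -> convex_fun (fun y : n.-tuple R => l1norm y `^ r).
Proof.
move=> r1 t y z t01; have /andP[t0 t1] := t01.
have h := convex_l1norm t y z t01.
apply: (@le_trans _ _ ((t * l1norm y + (1 - t) * l1norm z) `^ r)).
  apply: ge0_ler_powR; rewrite ?nnegrE ?l1norm_ge0//; first lra.
  by rewrite (le_trans _ h)// l1norm_ge0.
pose tt := Itv01 t0 t1.
have in0 (u : n.-tuple R) : l1norm u \in (`[0, +oo[%classic : set R).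
  by rewrite inE /= in_itv/= l1norm_ge0.
have := convex_powR r1 tt (in0 y) (in0 z).
by rewrite !convRE /= => h2; move: h2; rewrite /unstable.onem; lra.
Qed.

End convex_examples.

Section weak_duality.
Context {R : realType} {d : measure_display} {X : measurableType d} {n : nat}
  (mu : probability X R) (nu : probability (n.-tuple R) R) (r : R) (g : X -> R).
Hypotheses (r1 : 1 <= r) (g0 : forall x, 0 <= g x) (mg : measurable_fun setT g)
  (mur : (\int[mu]_x (g x `^ r)%:E < +oo)%E)
  (nur : (\int[nu]_y (tnorm y `^ r)%:E < +oo)%E).
Context (pi : probability (X * n.-tuple R)%type R) (k : X -> probability (n.-tuple R) R).
Hypotheses (cpl : is_coupling mu nu pi) (dis : is_disintegration mu pi k).

Lemma coupling_barycenter_moment :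
  mu.-integrable setT (fun x => (l1norm (barycenter (k x)) `^ r)%:E).
Proof.
apply: (ge0_coupling_jensen_integrable mu nu pi k cpl dis (fun y => l1norm y `^ r)).
- exact: (integrable_l1norm nu r).
- exact: convex_l1norm_powR.
- by apply: measurable_powRT; exact: measurable_l1norm.
- by move=> y; exact: powR_ge0.
- exact: (integrable_l1norm_powR nu r).
Qed.

Lemma coupling_cost_integrable (F : X -> n.-tuple R -> R) (C : R) :
  (forall x, econtinuous (F x)) -> (forall y, measurable_fun setT (F ^~ y)) ->
  (forall x y, `|F x y| <= C * (1 + g x `^ r + tnorm y `^ r)) ->
  mu.-integrable setT (fun x => (F x (barycenter (k x)))%:E).
Proof.
move=> cF mF FC.
have mFb : measurable_fun setT (fun x => F x (barycenter (k x))).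
  by apply: measurable_caratheodory => //; exact: (measurable_barycenter mu pi).
have r0 : 0 <= r by move: r1; lra.
apply: (le_integrable measurableT
  (g := fun x => (`|C|%:E * (1%:E + (g x `^ r)%:E + (l1norm (barycenter (k x)) `^ r)%:E))%E)).
- exact/measurable_EFinP.
- move=> x _; rewrite /= lee_fin.
  set b := barycenter (k x).
  have pos (u v : R) : 0 <= 1 + u `^ r + v `^ r by rewrite !addr_ge0// powR_ge0.
  rewrite (le_trans (FC _ _))// (le_trans (ler_wpM2r (pos _ _) (ler_norm C)))//.
  rewrite [leRHS]ger0_norm; last by rewrite mulr_ge0// pos.
  rewrite ler_wpM2l// lerD2l; apply: ge0_ler_powR => //.
  - by rewrite nnegrE tnorm_ge0.
  - by rewrite nnegrE l1norm_ge0.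
  - exact: tnorm_le_l1norm.
- apply: integrableZl => //; apply: integrableD => //.
    apply: integrableD => //; first exact: finite_measure_integrable_cst.
    exact: (integrable_moment mu g r).
  exact: coupling_barycenter_moment.
Qed.

Lemma integrable_convex_barycenter (psi : n.-tuple R -> R) (C : R) : convex_fun psi ->
  (forall y, `|psi y| <= C * (1 + tnorm y) `^ r) ->
  mu.-integrable setT (fun x => (psi (barycenter (k x)))%:E).
Proof.
move=> cpsi gpsi; apply: (coupling_cost_integrable (fun=> psi) (`|C| * 2 `^ r)) => //.
  by move=> _; exact: convex_growth_continuous gpsi.
move=> x y; rewrite (le_trans (gpsi y))//.
rewrite (le_trans (ler_wpM2r (powR_ge0 _ _) (ler_norm C)))//.
rewrite -mulrA ler_wpM2l// (le_trans (powR_1D_le r _ (tnorm_ge0 y) r1))//.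
by rewrite ler_wpM2l ?powR_ge0// lerD2r lerDl powR_ge0.
Qed.

(** The cost is a free [F] because there are two uses: the inequality V <= D2, and the difference
    between a cost and its approximation. *)
Lemma weak_duality (F : X -> n.-tuple R -> R) (C : R) (phi : X -> R) (psi : n.-tuple R -> R) :
  (forall x, econtinuous (F x)) -> (forall y, measurable_fun setT (F ^~ y)) ->
  (forall x y, `|F x y| <= C * (1 + g x `^ r + tnorm y `^ r)) ->
  mu.-integrable setT (EFin \o phi) ->
  convex_fun psi -> (exists C, forall y, `|psi y| <= C * (1 + tnorm y) `^ r) ->
  (forall x y, F x y <= phi x + psi y) ->
  (\int[mu]_x (F x (barycenter (k x)))%:E <=
   \int[mu]_x (phi x)%:E + \int[nu]_y (psi y)%:E)%E.
Proof.
move=> cF mF FC iphi cpsi [Cpsi gpsi] Fle.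
have ib := integrable_convex_barycenter psi Cpsi cpsi gpsi.
have mpsi : measurable_fun setT psi.
  by apply: econtinuous_measurable; exact: convex_growth_continuous gpsi.
apply: (@le_trans _ _ (\int[mu]_x ((phi x)%:E + (psi (barycenter (k x)))%:E))%E).
  apply: le_integral => //.
  - exact: coupling_cost_integrable FC.
  - exact: integrableD.
  - by move=> x _; rewrite -EFinD lee_fin.
rewrite integralD// leeD2l//; apply: (coupling_jensen mu nu pi k cpl dis psi) => //.
- exact: (integrable_l1norm nu r).
- exact: (integrable_growth_powR nu (@tnorm R n) r r1 tnorm_ge0 measurable_tnorm nur psi Cpsi).
Qed.

End weak_duality.

(** * Equality of the two dual problems *)

Section dual_problems.
Context {R : realType} {X : Type} {n : nat}.
Implicit Types (y z : n.-tuple R) (c : X -> n.-tuple R -> R).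

Lemma tdot_le y z : `|tdot y z| <= l1norm y * l1norm z.
Proof.
rewrite /l1norm mulr_suml (le_trans (ler_norm_sum _ _ _))//.
apply: ler_sum => i _; rewrite normrM ler_wpM2l//.
by rewrite (bigD1 i)//= lerDl sumr_ge0.
Qed.

Lemma le_1D_powR (r a : R) : 0 <= a -> 1 <= r -> 1 + a <= (1 + a) `^ r.
Proof. by move=> a0 r1; rewrite -[leLHS]powRr1 ?ler_powR//; lra. Qed.

(* [Delta] makes every [c x y1 - phi x] a value at [y1] of an affine minorant of
   [psi]; [psi'] is the supremum of these minorants. *)
Lemma dual_convexify c (phi : X -> R) (psi : n.-tuple R -> R)
    (Delta : n.-tuple R -> n.-tuple R) (x0 : X) (r C : R) : 1 <= r ->
  (forall y, `|psi y| <= C * (1 + tnorm y) `^ r) ->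
  (forall x y1 y2, c x y1 <= phi x + psi y2 + tdot (Delta y1) (tsub y2 y1)) ->
  exists psi' : n.-tuple R -> R, [/\ convex_fun psi',
    (exists C' : R, forall y, `|psi' y| <= C' * (1 + tnorm y) `^ r),
    (forall x y, c x y <= phi x + psi' y) & forall y, psi' y <= psi y].
Proof.
move=> r1 gpsi hc.
pose aff (u : X * n.-tuple R) y := c u.1 u.2 - phi u.1 - tdot (Delta u.2) (tsub y u.2).
pose S y := range (aff ^~ y).
have affle u y : aff u y <= psi y by rewrite /aff; have := hc u.1 u.2 y; lra.
have ubS y : ubound (S y) (psi y) by move=> _ [u _ <-]; exact: affle.
pose o : n.-tuple R := [tuple 0 | i < n].
have S0 y : S y !=set0 by exists (aff (x0, o) y), (x0, o).
have supS y : has_sup (S y) by split => //; exists (psi y); exact: ubS.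
pose psi' y := sup (S y).
have affle' u y : aff u y <= psi' y.
  by apply: ub_le_sup; [exact: (supS y).2|exists u].
have psi'le y : psi' y <= psi y by apply: ge_sup; [exact: S0|exact: ubS].
exists psi'; split => //.
- move=> t y z /andP[t0 t1]; apply: ge_sup => // _ [u _ <-].
  have -> : aff u (tconvcomb t y z) = t * aff u y + (1 - t) * aff u z.
    rewrite /aff; suff -> : tdot (Delta u.2) (tsub (tconvcomb t y z) u.2) =
      t * tdot (Delta u.2) (tsub y u.2) + (1 - t) * tdot (Delta u.2) (tsub z u.2) by lra.
    rewrite /tdot !mulr_sumr -big_split; apply: eq_bigr => i _ /=.
    by rewrite !tnth_mktuple; ring.
  by rewrite lerD// ler_wpM2l ?subr_ge0.
(* A single minorant, the one attached to (x0, o), gives the lower growth bound; the upper one comes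
   from [psi' <= psi]. *)
- pose K := `|c x0 o - phi x0| + l1norm (Delta o) * n%:R.
  have K0 : 0 <= K by rewrite addr_ge0// mulr_ge0// l1norm_ge0.
  exists (Num.max `|C| K) => y.
  have P1 := le_1D_powR r (tnorm y) (tnorm_ge0 y) r1.
  have Py : 0 <= (1 + tnorm y) `^ r by exact: powR_ge0.
  rewrite ler_norml; apply/andP; split; last first.
    rewrite (le_trans (psi'le y))// (le_trans (ler_norm _))// (le_trans (gpsi y))//.
    by rewrite ler_wpM2r// le_max ler_norm.
  rewrite (le_trans _ (affle' (x0, o) y))// lerNl /aff /=.
  have yo : tsub y o = y.
    by apply: eq_from_tnth => i; rewrite !tnth_mktuple subr0.
  rewrite yo (@le_trans _ _ (K * (1 + tnorm y)))//; last first.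
    rewrite (le_trans (ler_wpM2l K0 P1))//.
    by rewrite ler_wpM2r// le_max lexx orbT.
  have h1 := ler_norm (- (c x0 o - phi x0)); rewrite normrN in h1.
  have h2 := le_trans (ler_norm _) (tdot_le (Delta o) y).
  have h3 := ler_wpM2l (l1norm_ge0 (Delta o)) (l1norm_le_tnorm y).
  have h4 := tnorm_ge0 y; have h5 := normr_ge0 (c x0 o - phi x0).
  have h6 : 0 <= l1norm (Delta o) * n%:R by rewrite mulr_ge0// l1norm_ge0.
  have h7 : 0 <= `|c x0 o - phi x0| * tnorm y by rewrite mulr_ge0.
  by rewrite /K mulrDl !mulrDr !mulr1; lra.
(* At its own base point y the minorant attached to (x, y) has a vanishing linear term. *)
- move=> x y; have := affle' (x, y) y; rewrite /aff /=.
  rewrite (_ : tdot _ _ = 0) ?subr0; first by lra.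
  by rewrite /tdot big1// => i _; rewrite tnth_mktuple subrr mulr0.
Qed.

(** The error must depend on y2 alone in order to be absorbed into psi. A slope within e / (1 +
    |y1|) of a subgradient achieves this, since |y2| + |y1| <= (1 + |y1|) (1 + |y2|). *)
Lemma convex_measurable_subgradient c (phi : X -> R) (psi : n.-tuple R -> R) (e : R) :
  0 < e -> convex_fun psi -> econtinuous psi ->
  (forall x y, c x y <= phi x + psi y) ->
  exists Delta : n.-tuple R -> n.-tuple R, measurable_fun setT Delta /\
    forall x y1 y2, c x y1 <=
      phi x + (psi y2 + e * (1 + l1norm y2)) + tdot (Delta y1) (tsub y2 y1).
Proof.
move=> e0 cpsi ctpsi hc; have [q qP] := @dense_tuples R n.
have mpsi := econtinuous_measurable psi ctpsi.
pose P k : set (n.-tuple R) := [set y1 | forall y2,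
  psi y1 + tdot (q k) (tsub y2 y1) <= psi y2 + e * (1 + l1norm y2)].
have tdotB (a u v : n.-tuple R) : tdot a (tsub u v) = tdot a u - tdot a v.
  by rewrite /tdot -sumrB; apply: eq_bigr => i _; rewrite tnth_mktuple mulrBr.
(* With the slope fixed, the terms in y1 and y2 separate: [P k] is a sublevel set of [f] at the
   level inf [h], and nonemptiness of [P k] makes this infimum finite. *)
have mP k : measurable (P k).
  have [->|/set0P[y Py]] := eqVneq (P k) set0; first exact: measurable0.
  pose f y1 := psi y1 - tdot (q k) y1.
  pose h y2 := psi y2 + e * (1 + l1norm y2) - tdot (q k) y2.
  have hlb : has_lbound (range h).
    by exists (f y) => _ [z _ <-]; have := Py z; rewrite tdotB /f /h; lra.
  have hne : range h !=set0 by exists (h y), y.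
  have mf : measurable_fun setT f.
    apply: measurable_funB => //; apply: measurable_sum => i.
    by apply: measurable_funM => //; exact: measurable_tnth.
  rewrite (_ : P k = f @^-1` `]-oo, inf (range h)]).
    by rewrite -[X in measurable X]setTI; exact: mf.
  apply/seteqP; split => z /=; rewrite in_itv/=.
    move=> Pz; apply: lb_le_inf => // _ [w _ <-].
    by have := Pz w; rewrite tdotB /f /h; lra.
  move=> fz w; have : inf (range h) <= h w by apply: ge_inf => //; exists w.
  by move: fz; rewrite tdotB /f /h; lra.
have exP y : exists k, P k y.
  have [g hg] := convex_subgradient psi cpsi y.
  have ny : 0 < 1 + l1norm y by have := l1norm_ge0 y; lra.
  have [k qk] := qP g (e / (1 + l1norm y)) (divr_gt0 e0 ny).
  exists k => z; apply: le_trans (lerD (hg z) (lexx _)).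
  rewrite -addrA lerD2l.
  have -> : tdot (q k) (tsub z y) = tdot g (tsub z y) + tdot (tsub (q k) g) (tsub z y).
    by rewrite /tdot -big_split; apply: eq_bigr => i _ /=; rewrite !tnth_mktuple; ring.
  rewrite lerD2l (le_trans (ler_norm _))// (le_trans (tdot_le _ _))//.
  rewrite -!l1dist_tsub l1distC.
  apply: (@le_trans _ _ (e / (1 + l1norm y) * (l1norm z + l1norm y))).
    by rewrite ler_pM ?l1dist_ge0 ?l1dist_le_norm// ltW.
  rewrite -mulrA ler_pM2l// mulrC ler_pdivrMr//.
  by have := l1norm_ge0 z; have := l1norm_ge0 y; nra.
have [K [KP mK]] := measurable_first P mP exP.
(* Opposite sign: the constraint bounds the cost from above, so the slope of the minorant of psi
   enters negatively. *)
exists (fun y => [tuple - tnth (q (K y)) i | i < n]); split.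
  exact: (@measurable_glue _ _ _ _ K (fun k _ => [tuple - tnth (q k) i | i < n])).
move=> x y1 y2; rewrite (le_trans (hc x y1))// -addrA lerD2l.
have -> : tdot [tuple - tnth (q (K y1)) i | i < n] (tsub y2 y1) =
    - tdot (q (K y1)) (tsub y2 y1).
  by rewrite /tdot -sumrN; apply: eq_bigr => i _; rewrite tnth_mktuple mulNr.
by have := KP y1 y2; lra.
Qed.

End dual_problems.

(** * Cutting an atomless probability *)

Lemma exists_natSinv_lt {R : realType} (e : R) : 0 < e ->
  exists m : nat, m.+1%:R^-1 < e.
Proof.
move=> e0; have [m _ mP] := near_infty_natSinv_lt (PosNum e0).
by exists m; apply: (mP m) => /=.
Qed.

(** * Injective coding of binary sequences by real numbers *)

Section ternary_code.
Context {R : realType}.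
Implicit Types b : nat -> bool.

Let w (j : nat) : R := 3%:R^-1 ^+ j.
Let psum b (N : nat) : R := \sum_(j < N) (b j)%:R * w j.

(** A Cantor-set code: digits 0 and 1 in base 3 avoid the double expansions of base 2. *)
Definition ternary b : R := sup (range (psum b)).

Let w_gt0 j : 0 < w j. Proof. by rewrite exprn_gt0// invr_gt0. Qed.

Let wS j : w j.+1 = w j / 3. Proof. by rewrite /w exprSr. Qed.

Let psumS b N : psum b N.+1 = psum b N + (b N)%:R * w N.
Proof. by rewrite /psum big_ord_recr. Qed.

(** 3/2 w N is the sum of all the weights from rank N on, hence the most that the remaining digits
    can add. *)
Let psum_tail b m N : (m <= N)%N -> psum b N + 3 / 2 * w N <= psum b m + 3 / 2 * w m.
Proof.
move=> /subnK <-; elim: (N - m)%N => [//|i IH].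
rewrite addSn psumS wS (le_trans _ IH)//.
by have := w_gt0 (i + m); case: (b _); rewrite ?mul1r ?mul0r; lra.
Qed.

Let psum_le b m N : psum b N <= psum b m + 3 / 2 * w m.
Proof.
have [mN|/ltnW Nm] := leqP m N.
  by have := psum_tail b _ _ mN; have := w_gt0 N; lra.
have h : psum b N <= psum b m.
  move/subnK: Nm => <-; elim: (m - N)%N => [//|i IH].
  by rewrite addSn psumS (le_trans IH)// lerDl mulr_ge0// ltW.
by have := w_gt0 m; lra.
Qed.

Let has_sup_psum b : has_sup (range (psum b)).
Proof.
split; first by exists (psum b 0), 0%N.
by exists (psum b 0 + 3 / 2 * w 0) => _ [N _ <-]; exact: psum_le.
Qed.

Let psum_le_ternary b N : psum b N <= ternary b.
Proof. by apply: ub_le_sup; [exact: (has_sup_psum b).2|exists N]. Qed.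

Let ternary_le b m : ternary b <= psum b m + 3 / 2 * w m.
Proof.
by apply: ge_sup; [exact: (has_sup_psum b).1|move=> _ [N _ <-]; exact: psum_le].
Qed.

Lemma ternary_ge0 b : 0 <= ternary b.
Proof. by rewrite (le_trans _ (psum_le_ternary b 0))// /psum big_ord0. Qed.

Lemma ternary_le2 b : ternary b <= 2.
Proof.
by rewrite (le_trans (ternary_le b 0))// /psum big_ord0 /w expr0; lra.
Qed.

(** At the first differing digit m, the later digits are worth at most w m / 2, which cannot make up
    for w m. *)
Lemma ternary_inj b c : ternary b = ternary c -> b = c.
Proof.
have lt_tern b1 c1 m : (forall j, (j < m)%N -> b1 j = c1 j) -> b1 m -> ~~ c1 m ->
    ternary c1 < ternary b1.
  move=> bc bm /negbTE cm.
  have h1 := psum_le_ternary b1 m.+1; have h2 := ternary_le c1 m.+1.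
  have e : psum c1 m = psum b1 m.
    by apply: eq_bigr => j _; rewrite bc.
  move: h1 h2; rewrite !psumS bm cm wS mul1r mul0r e; have := w_gt0 m; lra.
move=> h; apply/funext => m; elim/ltn_ind: m => m IH.
case bm : (b m); case cm : (c m) => //.
  by have := lt_tern b c m IH bm (negbT cm); rewrite h ltxx.
have IH' j : (j < m)%N -> c j = b j by move=> /IH.
by have := lt_tern c b m IH' cm (negbT bm); rewrite h ltxx.
Qed.

Lemma measurable_ternary {d} {X : measurableType d} (b : X -> nat -> bool) :
  (forall j, measurable [set x | b x j]) -> measurable_fun setT (fun x => ternary (b x)).
Proof.
move=> mb.
have mp N : measurable_fun setT (fun x => psum (b x) N).
  apply: measurable_sum => j; apply: measurable_funM => //.
  rewrite (_ : (fun _ => _) = \1_[set x | b x j]); first exact: measurable_indic.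
  by apply/funext => x; rewrite indicE mem_setE.
apply: (measurability (@RGenOInfty.G R)); first exact: RGenOInfty.measurableE.
move=> _ [_ [a ->] <-]; rewrite setTI.
rewrite (_ : _ @^-1` _ = \bigcup_N ((fun x => psum (b x) N) @^-1` `]a, +oo[)).
  by apply: bigcup_measurable => N _; rewrite -[X in measurable X]setTI; exact: mp.
apply/seteqP; split => x /=; rewrite in_itv/= andbT.
  move=> /(sup_gt (has_sup_psum (b x)).1)[_ [N _ <-] aN].
  by exists N => //=; rewrite in_itv/= andbT.
by move=> [N _ /=]; rewrite in_itv/= andbT => /lt_le_trans; apply.
Qed.

End ternary_code.

Section atomless.
Context {R : realType} {d : measure_display} {X : measurableType d} (mu : probability X R).

(** An intermediate value argument: the mass of the part of A where f <= s grows with s, and does so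
    continuously because the fibres of f are null. *)
Lemma atomless_cut (f : X -> R) (A : set X) (t : R) : measurable_fun setT f ->
  (forall x, 0 <= f x <= 2) -> (forall a, mu (f @^-1` [set a]) = 0%E) ->
  measurable A -> 0 <= t -> (t%:E <= mu A)%E ->
  exists E, [/\ measurable E, E `<=` A & mu E = t%:E].
Proof.
move=> mf f02 f0 mA t0; rewrite le_eqVlt => /predU1P[tA|tA].
  by exists A; split.
pose L s := A `&` f @^-1` `]-oo, s].
have mL s : measurable (L s).
  by apply: measurableI => //; rewrite -[X in measurable X]setTI; exact: mf.
have Lmono s s' : s <= s' -> L s `<=` L s'.
  by move=> ss' x [Ax]; rewrite /= !in_itv/= => fs; split => //=; rewrite in_itv/= (le_trans fs).
(* The range of f makes [L (-1)] empty and [L s] equal to A for s > 2, so [S] has a supremum. *)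
pose S := [set s | (mu (L s) <= t%:E)%E].
have S1 : S (-1).
  rewrite /S /= (_ : L _ = set0) ?measure0 ?lee_fin//.
  apply/seteqP; split => // x [_]; rewrite /= in_itv/=.
  by have /andP[] := f02 x; lra.
have ubS : ubound S 2.
  move=> s Ss; rewrite leNgt; apply/negP => s2; move: Ss; rewrite /S /=.
  rewrite (_ : L s = A); first by rewrite leNgt tA.
  apply/seteqP; split => [x []//|x Ax]; split => //=; rewrite in_itv/=.
  by have /andP[] := f02 x; lra.
have supS : has_sup S by split; [exists (-1)|exists 2].
pose s := sup S.
exists (L s); split => //; first by move=> x [].
have mL' : measurable (A `&` f @^-1` `]-oo, s[).
  by apply: measurableI => //; rewrite -[X in measurable X]setTI; exact: mf.
apply/eqP; rewrite eq_le; apply/andP; split.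
  apply: (@le_trans _ _ (mu (A `&` f @^-1` `]-oo, s[))).
    have mfs : measurable (f @^-1` [set s]).
      by rewrite -[X in measurable X]setTI; exact: mf.
    apply: (@le_trans _ _ (mu ((A `&` f @^-1` `]-oo, s[) `|` f @^-1` [set s]))).
      apply: le_measure; rewrite ?inE//; first exact: measurableU.
      move=> x [Ax]; rewrite /= in_itv/= le_eqVlt => /predU1P[->|fs]; [by right|left].
      by split => //=; rewrite in_itv.
    rewrite (le_trans (measureU2 _ mL' mfs))//.
    by have := f0 s => /= ->; rewrite adde0.
  (* From below: these sets increase to the strict sublevel set, which differs from [L s] by a null
     fibre. *)
  pose F m := L (s - m.+1%:R^-1).
  have FE : A `&` f @^-1` `]-oo, s[ = \bigcup_m F m.
    apply/seteqP; split => x.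
      move=> [Ax]; rewrite /= in_itv/= => fs.
      have [m mP] : exists m, m.+1%:R^-1 < s - f x.
        by apply: exists_natSinv_lt; rewrite subr_gt0.
      exists m => //; split => //=; rewrite in_itv/=.
      by rewrite lerBrDr addrC -lerBrDr ltW.
    move=> [m _ [Ax]]; rewrite /= in_itv/= => fs; split => //=; rewrite in_itv/=.
    by rewrite (le_lt_trans fs)// ltrBlDr ltrDl invr_gt0.
  have cF : mu (F m) @[m --> \oo] --> mu (\bigcup_m F m).
    apply: nondecreasing_cvg_mu.
    - by move=> m; exact: mL.
    - by apply: bigcup_measurable => m _; exact: mL.
    move=> a b ab; apply/subsetPset; apply: Lmono.
    by rewrite lerB// lef_pV2 ?posrE// ler_nat ltnS.
  rewrite FE -(cvg_lim _ cF)//; apply: lime_le; first by apply/cvg_ex; eexists; exact: cF.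
  apply: nearW => m.
  have m0 : 0 < m.+1%:R^-1 :> R by rewrite invr_gt0.
  have [s' Ss' ss'] := sup_adherent m0 supS.
  apply: (@le_trans _ _ (mu (L s'))); last exact: Ss'.
  by apply: le_measure; rewrite ?inE; [exact: mL|exact: mL|apply: Lmono; exact: ltW].
(* From above: no level beyond s belongs to [S], and these sets decrease to [L s]. *)
pose F m := L (s + m.+1%:R^-1).
have FE : L s = \bigcap_m F m.
  apply/seteqP; split => x.
    move=> Lx m _; apply: Lmono Lx; by rewrite lerDl invr_ge0.
  move=> Fx; have [Ax _] := Fx 0%N I; split => //=; rewrite in_itv/=.
  rewrite leNgt; apply/negP => sf.
  have [m mP] : exists m, m.+1%:R^-1 < f x - s.
    by apply: exists_natSinv_lt; rewrite subr_gt0.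
  have [_] := Fx m I; rewrite /= in_itv/= leNgt => /negP; apply.
  by rewrite addrC -ltrBrDr.
have cF : mu (F m) @[m --> \oo] --> mu (\bigcap_m F m).
  apply: nonincreasing_cvg_mu.
  - by rewrite -ge0_fin_numE//; apply: fin_num_measure; exact: mL.
  - by move=> m; exact: mL.
  - by apply: bigcap_measurableType => m _; exact: mL.
  move=> a b ab; apply/subsetPset; apply: Lmono.
  by rewrite lerD2l lef_pV2 ?posrE// ler_nat ltnS.
rewrite FE -(cvg_lim _ cF)//; apply: lime_ge; first by apply/cvg_ex; eexists; exact: cF.
apply: nearW => m; rewrite leNgt; apply/negP => h.
have : S (s + m.+1%:R^-1) by exact: ltW.
by move=> /(ub_le_sup supS.2); rewrite -/s gerDl leNgt invr_gt0 ltr0Sn.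
Qed.

(** Membership in countably many balls separates points, so the ternary code of these memberships is
    a measurable injection into the reals; its fibres are empty or single points, hence null. *)
Lemma atomless_separable_cut (dX : X -> X -> R) : is_metric dX -> mseparable dX ->
  (measurable : set (set X)) = <<s mopen dX >> -> (forall x, mu [set x] = 0%E) ->
  forall (A : set X) (t : R), measurable A -> 0 <= t -> (t%:E <= mu A)%E ->
  exists E, [/\ measurable E, E `<=` A & mu E = t%:E].
Proof.
move=> [d0 deq dC dT] [s sP] mE mu0.
(* Balls of radius 1/(m+1) around the dense points, indexed by codes of pairs; other indices give
   the empty set. *)
pose ball (i : nat) : set X := [set x | if (unpickle i : option (nat * nat)) is Some p
  then dX x (s p.1) < p.2.+1%:R^-1 else false].
have mball i : measurable (ball i).
  rewrite mE; apply: sub_sigma_algebra; rewrite /ball => x /=.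
  case: (unpickle i) => [[k m]|] //= h.
  exists (m.+1%:R^-1 - dX x (s k)); first by rewrite subr_gt0.
  by move=> y xy; have := dT y x (s k); rewrite (dC y x) => /le_lt_trans; apply; rewrite -ltrBrDr.
pose b x i := x \in ball i.
have binj x y : b x = b y -> x = y.
  move=> bxy; apply: contrapT => xy.
  have dxy : 0 < dX x y.
    by rewrite lt_neqAle d0 andbT eq_sym; apply/eqP => /deq.
  have dxy2 : 0 < dX x y / 2 by lra.
  have [m mP] := exists_natSinv_lt _ dxy2.
  have [k kP] := sP x m.+1%:R^-1 ltac:(by rewrite invr_gt0).
  have bx : b x (pickle (k, m)) by apply/mem_set; rewrite /ball /= pickleK.
  have : b y (pickle (k, m)) by rewrite -bxy.
  move=> /set_mem; rewrite /ball /= pickleK /= => h.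
  have := dT x (s k) y; rewrite (dC (s k)).
  have := lt_trans kP mP; have := lt_trans h mP; lra.
move=> A t mA t0 tA; apply: (@atomless_cut (fun x => ternary (b x))) => //.
- apply: measurable_ternary => j.
  by rewrite (_ : [set x | _] = ball j)//; apply/seteqP; split => x /=; rewrite /b inE.
- by move=> x; rewrite ternary_ge0 ternary_le2.
- move=> a; have [->|/set0P[x xa]] := eqVneq ((fun x => ternary (b x)) @^-1` [set a]) set0.
    by rewrite measure0.
  rewrite (_ : _ @^-1` _ = [set x])//; apply/seteqP; split => y /=; last by move=> ->.
  by rewrite -xa => /ternary_inj/binj.
Qed.

(** One labelling [g] serves all the disjoint [A i]: label k takes from each of them a piece
    proportional to the k-th weight. Each step cuts off the first weight and shifts the labels of
    the rest, which is why the weights need not sum to 1. *)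
Lemma split_weights (N : nat) :
  (forall (A : set X) (t : R), measurable A -> 0 <= t -> (t%:E <= mu A)%E ->
     exists E, [/\ measurable E, E `<=` A & mu E = t%:E]) ->
  forall (alpha : 'I_N -> R) (ws : seq R) (A : 'I_N -> set X),
  (forall i, 0 <= alpha i) -> (forall w, w \in ws -> 0 <= w) ->
  (forall i, measurable (A i)) -> (forall i j, i != j -> A i `&` A j = set0) ->
  (forall i, mu (A i) = (alpha i * \sum_(w <- ws) w)%:E) ->
  exists g : X -> nat, (forall k, measurable (g @^-1` [set k])) /\
    forall i k, (k < size ws)%N -> mu (A i `&` g @^-1` [set k]) = (alpha i * nth 0 ws k)%:E.
Proof.
move=> cut alpha ws; elim: ws => [|w ws IH] A a0 ws0 mA dA muA.
  exists (fun=> 0%N); split => // k; have [->|k0] := eqVneq k 0%N.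
    by rewrite (_ : _ @^-1` _ = setT)//; apply/seteqP; split.
  rewrite (_ : _ @^-1` _ = set0)//; apply/seteqP; split => // x /= h.
  by move: k0; rewrite -h eqxx.
have w0 : 0 <= w by apply: ws0; rewrite inE eqxx.
have ws0' v : v \in ws -> 0 <= v by move=> vw; apply: ws0; rewrite inE vw orbT.
have wss0 : 0 <= \sum_(v <- ws) v by rewrite big_seq sumr_ge0.
have /choice[E EP] : forall i, exists E, [/\ measurable E, E `<=` A i & mu E = (alpha i * w)%:E].
  move=> i; apply: cut => //; first exact: mulr_ge0.
  by rewrite muA lee_fin ler_wpM2l// big_cons lerDl.
have mEi i : measurable (E i) by case: (EP i).
have EA i : E i `<=` A i by case: (EP i).
have [|||g [mg gP]] := IH (fun i => A i `\` E i) a0 ws0'.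
- by move=> i; exact: measurableD.
- move=> i j /dA AA; apply/seteqP; split => // x [[Ai _] [Aj _]].
  by rewrite -AA.
- move=> i; have [_ _ muE] := EP i.
  have -> : mu (A i `\` E i) = (mu (A i) - mu (E i))%E.
    rewrite measureD//; last by rewrite -ge0_fin_numE// fin_num_measure.
    by congr (_ - mu _)%E; apply/setIidPr; exact: EA.
  by rewrite muA muE big_cons -EFinB; congr EFin; ring.
pose EE := \bigcup_i E i.
have mEE : measurable EE by apply: fin_bigcup_measurable.
exists (fun x => if x \in EE then 0%N else (g x).+1).
have pre0 : (fun x => if x \in EE then 0%N else (g x).+1) @^-1` [set 0%N] = EE.
  by apply/seteqP; split => x /=; [case: ifPn => // /set_mem|move=> /mem_set ->].
have preS k : (fun x => if x \in EE then 0%N else (g x).+1) @^-1` [set k.+1] =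
    g @^-1` [set k] `\` EE.
  apply/seteqP; split => x /=; first by case: ifPn => // /negP xE [gx]; split => // /mem_set.
  by move=> [/= gx nEE]; case: ifPn => [/set_mem //|_]; rewrite gx.
split.
  by case=> [|k]; rewrite ?pre0// preS; exact: measurableD.
have AEE i : A i `&` EE = E i.
  apply/seteqP; split => x; last by move=> Ex; split; [exact: EA|exists i].
  move=> [Ax [j _ Ej]]; have [->//|ij] := eqVneq i j.
  by have : (A i `&` A j) x; [split => //; exact: EA|rewrite dA].
move=> i [_|k]; rewrite ?pre0 ?preS /=.
  by rewrite AEE; case: (EP i).
rewrite ltnS => ks; rewrite -(gP i k ks); congr (mu _).
apply/seteqP; split => x.
  by move=> [Ax [gx nEx]]; split => //; split => // Ex; apply: nEx; exists i.
move=> [[Ax nEx] gx]; split => //; split => // EEx; apply: nEx.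
by rewrite -AEE.
Qed.

End atomless.

(** * Duality for finitely many cells *)

Section finite_duality.
Context {R : realType} {I J : finType}.
Implicit Types (theta beta : J -> R).

Definition is_density (v : J -> R) (theta : J -> R) : Prop :=
  (forall j, 0 <= theta j) /\ \sum_j v j * theta j = 1.

Variables (m : I -> R) (v : J -> R) (cost : I -> (J -> R) -> R) (B : R).
Hypotheses (m0 : forall i, 0 <= m i) (m1 : \sum_i m i = 1)
  (v0 : forall j, 0 <= v j) (v1 : \sum_j v j = 1)
  (costB : forall i theta, is_density v theta -> `|cost i theta| <= B).

Definition selection : Type := {f : I -> J -> R | forall i, is_density v (f i)}.

(* A list of selections with weights [`|p.1|]: the absolute value spares a side condition. *)
Implicit Types s : seq (R * selection).

(** The density, with respect to v, of the second marginal of the mixture. Total weights other than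
    1 are allowed, so that mixtures form a cone. *)
Definition mix_density s (j : J) : R :=
  \sum_(p <- s) `|p.1| * \sum_i m i * sval p.2 i j.

Definition mix_value s : R :=
  \sum_(p <- s) `|p.1| * \sum_i m i * cost i (sval p.2 i).

Let mix_density_cat s s' j : mix_density (s ++ s') j = mix_density s j + mix_density s' j.
Proof. exact: big_cat. Qed.

Let mix_value_cat s s' : mix_value (s ++ s') = mix_value s + mix_value s'.
Proof. exact: big_cat. Qed.

Let scale (t : R) s := [seq (t * p.1, p.2) | p <- s].

Let mix_density_scale t s j : 0 <= t -> mix_density (scale t s) j = t * mix_density s j.
Proof.
move=> t0; rewrite /mix_density big_map mulr_sumr; apply: eq_bigr => p _ /=.
by rewrite normrM ger0_norm// mulrA.
Qed.

Let mix_value_scale t s : 0 <= t -> mix_value (scale t s) = t * mix_value s.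
Proof.
move=> t0; rewrite /mix_value big_map mulr_sumr; apply: eq_bigr => p _ /=.
by rewrite normrM ger0_norm// mulrA.
Qed.

Lemma mix_mass s : \sum_j v j * mix_density s j = \sum_(p <- s) `|p.1|.
Proof.
under eq_bigr do rewrite mulr_sumr.
rewrite exchange_big /=; apply: eq_bigr => p _.
rewrite -[RHS]mulr1 -[in RHS]m1.
under eq_bigr do rewrite mulrCA mulr_sumr.
rewrite -mulr_sumr exchange_big /=; congr (_ * _); apply: eq_bigr => i _.
under eq_bigr do rewrite mulrCA.
by rewrite -mulr_sumr (svalP p.2 i).2 mulr1.
Qed.

Let mean_cost (f : selection) : `|\sum_i m i * cost i (sval f i)| <= B.
Proof.
rewrite (le_trans (ler_norm_sum _ _ _))// -[leRHS]mul1r -m1 mulr_suml.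
apply: ler_sum => i _; rewrite normrM ger0_norm// ler_wpM2l// costB//.
exact: (svalP f i).
Qed.

Let mix_value_le s : `|mix_value s| <= B * \sum_j v j * mix_density s j.
Proof.
rewrite mix_mass (le_trans (ler_norm_sum _ _ _))// mulr_sumr; apply: ler_sum => p _.
by rewrite normrM normr_id mulrC ler_wpM2r.
Qed.

Let density1 : is_density v (fun=> 1).
Proof. by split => // ; under eq_bigr do rewrite mulr1. Qed.

Let single theta (d : is_density v theta) : selection :=
  exist (fun f => forall i, is_density v (f i)) (fun=> theta) (fun=> d).

Let mix_single (w : R) theta (d : is_density v theta) j : 0 <= w ->
  mix_density [:: (w, single _ d)] j = w * theta j.
Proof.
by move=> w0; rewrite /mix_density big_seq1 /= ger0_norm// -mulr_suml m1 mul1r.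
Qed.

(** Equality of densities v-almost everywhere: nothing is asked on null cells, which later forces
    psi to vanish there. *)
Definition represents s beta := forall j, v j * mix_density s j = v j * beta j.

Let vals := [set a | exists2 s, represents s (fun=> 1) & a = mix_value s].

Let sup_vals : has_sup vals.
Proof.
split.
  exists (mix_value [:: (1, single _ density1)]), [:: (1, single _ density1)] => // j.
  by rewrite mix_single// mul1r.
exists B => _ [s rs ->]; rewrite (le_trans (ler_norm _))// (le_trans (mix_value_le s))//.
by under eq_bigr do rewrite rs mulr1; rewrite v1 mulr1.
Qed.

Let U := sup vals.

(** psi is a supergradient, at the density 1, of the largest mixture value as a function of the
    marginal density. That function is positively homogeneous, so the inequality carries no constant
    term. *)
Lemma finite_dual_functional : exists psi : J -> R,
  (forall s beta, represents s beta -> mix_value s <= \sum_j psi j * beta j) /\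
  forall e, 0 < e -> exists2 s, represents s (fun=> 1) & \sum_j psi j <= mix_value s + e.
Proof.
pose ix (j : J) := enum_rank j.
(* (u, a) records a displacement u from the constant density l, and the value l [U] - [mix_value s]
   lost along it. *)
pose C (u : 'I_#|J| -> R) a := exists2 l, 0 < l &
  exists2 s, represents s (fun j => l + u (ix j)) & a = l * U - mix_value s.
have [|||| al Hal] := cone_functional C.
- move=> u a u' b [l l0 [s rs ->]] [l' l0' [s' rs' ->]].
  exists (l + l'); first exact: addr_gt0.
  exists (s ++ s'); last by rewrite mix_value_cat; ring.
  by move=> j; rewrite mix_density_cat mulrDr rs rs' -[(u + u') _]/(u _ + u' _); ring.
- move=> t u a t0 [l l0 [s rs ->]]; exists (t * l); first exact: mulr_gt0.
  exists (scale t s); last by rewrite mix_value_scale ?ltW//; ring.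
  move=> j; rewrite mix_density_scale ?ltW// mulrCA rs -[(t *: u) _]/(t * u _); ring.
- move=> u; pose l := 1 + \sum_j `|u (ix j)|.
  pose beta j := l + u (ix j); pose W := \sum_j v j * beta j.
  have beta1 j : 1 <= beta j.
    have : `|u (ix j)| <= \sum_j `|u (ix j)|.
      by rewrite [leRHS](bigD1 j)//= lerDl sumr_ge0.
    by rewrite /beta /l; have := ler_norm (- u (ix j)); rewrite normrN; lra.
  have W1 : 1 <= W.
    by rewrite -v1; apply: ler_sum => j _; rewrite ler_peMr.
  have Wn0 : W != 0 by rewrite gt_eqF// (lt_le_trans ltr01).
  have d : is_density v (fun j => beta j / W).
    split; first by move=> j; rewrite divr_ge0// (le_trans ler01).
    by under eq_bigr do rewrite mulrA; rewrite -mulr_suml divff.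
  exists (l * U - mix_value [:: (W, single _ d)]), l.
    by rewrite ltr_pwDl// sumr_ge0.
  exists [:: (W, single _ d)] => // j.
  rewrite mix_single ?(le_trans ler01)//; congr (_ * _).
  by rewrite mulrC divfK.
- move=> a [l l0 [s rs ->]].
  rewrite subr_ge0 -ler_pdivrMl//.
  apply: ub_le_sup; first exact: sup_vals.2.
  exists (scale l^-1 s); last by rewrite mix_value_scale// invr_ge0 ltW.
  move=> j; rewrite mix_density_scale ?invr_ge0 ?ltW// mulrCA rs addr0.
  by rewrite mulrCA mulVf ?gt_eqF.
have C_le u a : C u a -> \sum_j u (ix j) * al (ix j) <= a.
  move=> /Hal; rewrite (reindex ix)//; apply: onW_bij.
  by exists enum_val; [exact: enum_rankK|exact: enum_valK].
exists (fun j => - al (ix j)); split.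
  (* Reaching [beta] from the constant density l and letting l tend to 0 removes the terms in [U]
     and in the sum of [al]; [K] makes them at most e. *)
  move=> s beta rs; apply/ler_addgt0Pr => e e0.
  pose K := `|U| + `|\sum_j al (ix j)| + 1.
  have K0 : 0 < K by rewrite ltr_wpDl// addr_ge0.
  pose l := e / K; have l0 : 0 < l by rewrite divr_gt0.
  have := C_le (fun i => beta (enum_val i) - l) (l * U - mix_value s).
  have h : C (fun i => beta (enum_val i) - l) (l * U - mix_value s).
    exists l => //; exists s => // j.
    by rewrite enum_rankK rs; congr (_ * _); ring.
  move=> /(_ h).
  have -> : \sum_j (beta (enum_val (ix j)) - l) * al (ix j) =
      - (\sum_j - al (ix j) * beta j) - l * \sum_j al (ix j).
    rewrite mulr_sumr -sumrN -sumrB; apply: eq_bigr => j _; rewrite enum_rankK; ring.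
  have : l * (U + \sum_j al (ix j)) <= e.
    rewrite /l mulrAC ler_pdivrMr// ler_pM2l// /K.
    have := ler_norm U; have := ler_norm (\sum_j al (ix j)); lra.
  by rewrite mulrDr; lra.
move=> e e0; have [_ [s rs ->] sU] := sup_adherent e0 sup_vals.
exists s => //; rewrite sumrN.
(* The empty mixture, reached from the density 1 by the displacement -1, bounds the sum of psi by
   [U]. *)
have := C_le (fun=> -1) (1 * U - mix_value [::]).
have h : C (fun=> -1) (1 * U - mix_value [::]).
  exists 1 => //; exists [::] => // j.
  by rewrite /mix_density big_nil subrr.
move=> /(_ h); rewrite -mulr_sumr mulN1r /mix_value big_nil.
by move: sU; rewrite -/U /mix_value; lra.
Qed.

(** phi i is the least value allowed by the constraint, a supremum over densities. Nearly optimal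
    densities, one for each i, form a single selection, and the supergradient inequality for it
    makes the mean of phi nonpositive: psi carries the whole value. *)
Lemma finite_duality : exists (phi : I -> R) (psi : J -> R), [/\
  forall i theta, is_density v theta -> cost i theta <= phi i + \sum_j psi j * theta j,
  \sum_i m i * phi i <= 0,
  forall j, v j = 0 -> psi j = 0 &
  forall e, 0 < e -> exists2 s, represents s (fun=> 1) & \sum_j psi j <= mix_value s + e].
Proof.
have [psi [hpsi hU]] := finite_dual_functional.
have hsel (f : selection) : \sum_i m i * (cost i (sval f i) - \sum_j psi j * sval f i j) <= 0.
  have := hpsi [:: (1, f)] (fun j => \sum_i m i * sval f i j).
  have h : represents [:: (1, f)] (fun j => \sum_i m i * sval f i j).
    by move=> j; rewrite /mix_density big_seq1 normr1 mul1r.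
  move=> /(_ h); rewrite /mix_value big_seq1 normr1 mul1r => h1.
  under eq_bigr do rewrite mulrBr.
  rewrite sumrB subr_le0 (le_trans h1)// le_eqVlt; apply/orP; left; apply/eqP.
  under eq_bigr do rewrite mulr_sumr.
  rewrite exchange_big /=; apply: eq_bigr => i _; rewrite mulr_sumr.
  by apply: eq_bigr => j _; ring.
pose S i := [set a | exists2 theta, is_density v theta & a = cost i theta - \sum_j psi j * theta j].
have supS i : has_sup (S i).
  split; first by exists (cost i (fun=> 1) - \sum_j psi j * 1), (fun=> 1).
  (* Using theta on every cell in the supergradient inequality bounds its psi-sum below by a mean
     cost, hence by - B. *)
  exists (2 * B) => _ [theta d ->].
  have h := hsel (single _ d); move: h; rewrite /= => h.
  have : - B <= \sum_j psi j * theta j.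
    have := mean_cost (single _ d); rewrite /= ler_norml => /andP[+ _].
    move=> h2; rewrite (le_trans h2)//.
    move: h; under eq_bigr do rewrite mulrBr.
    by rewrite sumrB -mulr_suml m1 mul1r subr_le0.
  have := le_trans (ler_norm _) (costB i _ d); lra.
exists (fun i => sup (S i)), psi; split => //.
- move=> i theta d; rewrite -lerBlDr; apply: ub_le_sup; first exact: (supS i).2.
  by exists theta.
- apply/ler_addgt0Pr => e e0; rewrite add0r.
  have /choice[f fP] : forall i, exists theta, is_density v theta /\
      sup (S i) - e < cost i theta - \sum_j psi j * theta j.
    by move=> i; have [_ [theta d ->] h] := sup_adherent e0 (supS i); exists theta.
  have := hsel (exist (fun f => forall i, is_density v (f i)) f (fun i => (fP i).1)); rewrite /= => h.
  have : \sum_i m i * sup (S i) <=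
      \sum_i m i * (cost i (f i) - \sum_j psi j * f i j) + \sum_i m i * e.
    rewrite -big_split; apply: ler_sum => i _ /=; rewrite -mulrDr ler_wpM2l//.
    by have := (fP i).2; lra.
  rewrite -mulr_suml m1 mul1r; lra.
- move=> j vj.
  (* The empty mixture represents any multiple, of either sign, of the indicator of a null cell. *)
  have hj (sg : R) : 0 <= psi j * sg.
    have := hpsi [::] (fun j' => if j' == j then sg else 0).
    have h : represents [::] (fun j' => if j' == j then sg else 0).
      move=> j'; rewrite /mix_density big_nil mulr0.
      by case: eqP => [->|_]; rewrite ?vj ?mul0r ?mulr0.
    move=> /(_ h); rewrite /mix_value big_nil (bigD1 j)//= eqxx big1 ?addr0//.
    by move=> j' /negbTE ->; rewrite mulr0.
  by have := hj 1; have := hj (-1); lra.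
Qed.

End finite_duality.

(** * Quantization *)

Lemma measurable_fin_glue {d d'} {X : measurableType d} {Y : measurableType d'}
  {I : finType} (K : X -> I) (f : I -> X -> Y) :
  (forall i, measurable (K @^-1` [set i])) ->
  (forall i, measurable_fun setT (f i)) ->
  measurable_fun setT (fun x => f (K x) x).
Proof.
move=> mK mf _ B mB; rewrite setTI.
rewrite (_ : _ @^-1` _ = \bigcup_(i in setT) (K @^-1` [set i] `&` f i @^-1` B)).
  apply: fin_bigcup_measurable => // i _; apply: measurableI => //.
  by rewrite -[X in measurable X]setTI; exact: mf.
apply/seteqP; split => x /=; first by exists (K x).
by move=> [i _ [/= -> ]].
Qed.

Section quantization.
Context {R : realType} {d : measure_display} {T : measurableType d} (P : probability T R).

Lemma dominated_small (f : nat -> T -> R) (g : T -> R) (e : R) : 0 < e ->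
  (forall m, measurable_fun setT (f m)) -> P.-integrable setT (EFin \o g) ->
  (forall m x, 0 <= f m x <= g x) -> (forall x, f ^~ x @ \oo --> 0) ->
  exists m, (\int[P]_x (f m x)%:E < e%:E)%E.
Proof.
move=> e0 mf ig fg f0.
have cvgf := @dominated_cvg _ _ _ P setT measurableT (fun m x => (f m x)%:E)
  (fun=> 0%E) (EFin \o g).
have : (\int[P]_x (f m x)%:E)%E @[m --> \oo] --> (\int[P]_x (0%E : \bar R))%E.
  apply: cvgf => //.
  - by move=> m; exact/measurable_EFinP.
  - by move=> x _; apply: cvg_EFin; [exact: nearW|exact: f0].
  - by move=> m x _; have /andP[h1 h2] := fg m x; rewrite /= lee_fin ger0_norm.
rewrite integral0 => h.
have fin m : (\int[P]_x (f m x)%:E)%E \is a fin_num.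
  apply: integrable_fin_num => //; apply: le_integrable ig => //; first exact/measurable_EFinP.
  move=> x _; have /andP[h1 h2] := fg m x.
  by rewrite /= lee_fin !ger0_norm// (le_trans h1).
have /fine_cvgP[_ /cvgrPdist_lt/(_ e e0)[m _ /(_ m (leqnn m))]] := h.
rewrite /= sub0r normrN => hm; exists m.
by rewrite -(fineK (fin m)) lte_fin (le_lt_trans (ler_norm _)).
Qed.

Lemma integral_prob_cst (a : R) : (\int[P]_x a%:E = a%:E)%E.
Proof. by rewrite integral_cst// -[RHS]mule1; congr (_ * _)%E; exact: probability_setT. Qed.

(** Points close to one of the first N dense points go there, within e/2; all others go to x0, and
    integrability of the distance to x0 makes their contribution small for large N. *)
Lemma quantization (dist : T -> T -> R) (q : nat -> T) (x0 : T) (e : R) :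
  (forall x y, 0 <= dist x y) -> (forall y, measurable_fun setT (dist ^~ y)) ->
  (forall x e', 0 < e' -> exists k, dist x (q k) < e') ->
  P.-integrable setT (EFin \o (dist ^~ x0)) -> 0 < e ->
  exists (N : nat) (idx : T -> 'I_N.+1) (pts : 'I_N.+1 -> T),
    [/\ forall i, measurable (idx @^-1` [set i]),
        P.-integrable setT (fun x => (dist x (pts (idx x)))%:E) &
        (\int[P]_x (dist x (pts (idx x)))%:E <= e%:E)%E].
Proof.
move=> d0 md qP id0 e0; have e20 : 0 < e / 2 by lra.
have [|| K [KP mK]] := @measurable_first _ _ (fun k => [set x | dist x (q k) < e / 2]).
- move=> k; rewrite -[X in measurable X]setTI.
  rewrite (_ : [set x | _] = (dist ^~ (q k)) @^-1` `]-oo, e / 2[); first exact: md.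
  by apply/seteqP; split => x /=; rewrite in_itv.
- by move=> x; exact: qP.
pose h (N : nat) x := if (N <= K x)%N then dist x x0 else 0.
have mh N : measurable_fun setT (h N).
  apply: (@measurable_glue _ _ _ _ K (fun k x => if (N <= k)%N then dist x x0 else 0) mK).
  by move=> k; case: (N <= k)%N => //; exact: measurable_cst.
have [||N hN] := dominated_small h (dist ^~ x0) (e / 2) e20 mh id0.
- by move=> m x; rewrite /h; case: ifP => _; rewrite ?lexx ?d0.
- move=> x; apply/cvgrPdist_lt => e' e'0; exists (K x).+1 => // m /= Km.
  by rewrite /h leqNgt Km subrr normr0.
(* The last label N is the overflow cell, represented by x0. *)
pose idx x : 'I_N.+1 := inord (minn (K x) N).
pose pts (i : 'I_N.+1) := if (i < N)%N then q i else x0.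
have idxE x : idx x = minn (K x) N :> nat by rewrite inordK// ltnS geq_minr.
have ptsE x : dist x (pts (idx x)) <= e / 2 + h N x.
  rewrite /pts /h idxE; have [KN|NK] := ltnP (K x) N.
    by rewrite KN addr0 ltW//; exact: KP.
  by rewrite ltnn; lra.
have midx i : measurable (idx @^-1` [set i]).
  rewrite (_ : _ @^-1` _ = \bigcup_(k in [set k | minn k N = i]) K @^-1` [set k]).
    by apply: bigcup_measurable => k _; exact: mK.
  apply/seteqP; split => x /=; first by move=> <-; exists (K x) => //=; rewrite idxE.
  by move=> [k /= ki Kk]; apply: ord_inj; rewrite idxE Kk.
have mD : measurable_fun setT (fun x => dist x (pts (idx x))).
  exact: (@measurable_fin_glue _ _ _ _ _ idx (fun i x => dist x (pts i)) midx).
have hint : P.-integrable setT (fun x => (e / 2 + h N x)%:E).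
  apply: (@le_integrable _ _ _ P setT measurableT _ (fun x => ((e / 2)%:E + (dist x x0)%:E)%E)).
  - by apply/measurable_EFinP; apply: measurable_funD.
  - move=> x _; rewrite /= lee_fin /h; have := d0 x x0.
    by case: ifP => _ dx; rewrite !ger0_norm; lra.
  - by apply: integrableD => //; exact: finite_measure_integrable_cst.
have Dint : P.-integrable setT (fun x => (dist x (pts (idx x)))%:E).
  apply: le_integrable hint => //; first exact/measurable_EFinP.
  move=> x _; rewrite /= lee_fin ger0_norm//.
  by rewrite (le_trans (ptsE x))// ler_norm.
exists N, idx, pts; split => //.
apply: (@le_trans _ _ (\int[P]_x (e / 2 + h N x)%:E)%E).
  by apply: le_integral => // x _; rewrite lee_fin.
under eq_integral do rewrite EFinD.
rewrite ge0_integralD//; last 3 first.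
- by move=> x _; rewrite lee_fin ltW.
- by move=> x _; rewrite lee_fin /h; case: ifP.
- exact/measurable_EFinP.
rewrite integral_prob_cst.
apply: (@le_trans _ _ ((e / 2)%:E + (e / 2)%:E)%E); first by rewrite leeD2l// ltW.
by rewrite -EFinD lee_fin; lra.
Qed.

End quantization.

(** * Couplings given by a density *)

Section density_probability.
Context {R : realType} {d : measure_display} {T : measurableType d}
  (P : {measure set T -> \bar R}) (h : T -> R).

(* The unused arguments carry the facts that make this a probability measure. *)
Definition with_density (_ : measurable_fun setT h) (_ : forall x, 0 <= h x)
    (_ : (\int[P]_x (h x)%:E = 1)%E) (A : set T) : \bar R :=
  (\int[P]_(x in A) (h x)%:E)%E.

Hypotheses (mh : measurable_fun setT h) (h0 : forall x, 0 <= h x)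
  (h1 : (\int[P]_x (h x)%:E = 1)%E).

Let mu := with_density mh h0 h1.

Let mu_set0 : mu set0 = 0%E. Proof. exact: integral_set0. Qed.

Let mu_ge0 A : (0 <= mu A)%E.
Proof. by apply: integral_ge0 => x _; rewrite lee_fin. Qed.

Let mu_sigma_additive : semi_sigma_additive mu.
Proof.
move=> F mF tF mUF; rewrite /mu /with_density ge0_integral_bigcup//.
- by apply: is_cvg_ereal_nneg_natsum_cond => i _ _; exact: mu_ge0.
- by apply/measurable_EFinP; exact: measurable_funTS.
- by move=> x _; rewrite lee_fin.
Qed.

HB.instance Definition _ := isMeasure.Build _ _ _ (with_density mh h0 h1)
  mu_set0 mu_ge0 mu_sigma_additive.

HB.instance Definition _ := Measure_isProbability.Build _ _ _ (with_density mh h0 h1) h1.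

Import HBNNSimple.

Let p : probability T R := with_density mh h0 h1.

Lemma ge0_integral_with_density (f : T -> \bar R) :
  measurable_fun setT f -> (forall x, 0 <= f x)%E ->
  (\int[p]_x f x = \int[P]_x (f x * (h x)%:E))%E.
Proof.
move=> mf f0.
pose g := nnsfun_approx measurableT mf.
pose gE := fun n => EFin \o g n.
have mgE n : measurable_fun [set: T] (gE n) by exact/measurable_EFinP.
have gE_ge0 n x : (0 <= gE n x)%E by rewrite lee_fin.
have nd_gE x : {homo gE ^~ x : n m / (n <= m)%O >-> (n <= m)%E}.
  by move=> *; exact/lefP/nd_nnsfun_approx.
have mEh : measurable_fun setT (EFin \o h) by exact/measurable_EFinP.
transitivity (limn (fun n => \int[p]_x gE n x))%E.
  rewrite -monotone_convergence//; apply: eq_integral => t _.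
  by apply/esym/cvg_lim => //; exact: cvg_nnsfun_approx.
transitivity (limn (fun n => \int[P]_x (gE n x * (h x)%:E)))%E.
  apply: congr_lim; apply/funext => n.
  rewrite integralT_nnsfun sintegralE /gE.
  transitivity (\int[P]_x (\sum_(r \in range (g n)) ((r * \1_(g n @^-1` [set r]) x)%:E * (h x)%:E)))%E; last first.
    apply: eq_integral => x _; rewrite /= fimfunE -fsumEFin// ge0_mule_fsuml// => r.
    by rewrite EFinM nnfun_muleindic_ge0.
  rewrite ge0_integral_fsum//; last 2 first.
  - move=> r; apply: emeasurable_funM => //; apply/measurable_EFinP.
    by apply: measurable_funM => //; exact: measurable_indic.
  - by move=> r x _; rewrite mule_ge0 ?nnfun_muleindic_ge0 ?lee_fin.
  apply: eq_fsbigr => r; rewrite inE => -[x _ <-].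
  under eq_integral do rewrite EFinM -muleA.
  rewrite ge0_integralZl//; last 3 first.
  - apply: emeasurable_funM => //; apply/measurable_EFinP; exact: measurable_indic.
  - by move=> y _; rewrite mule_ge0 ?lee_fin.
  - by rewrite lee_fin.
  congr (_ * _)%E; rewrite /p /= /with_density [LHS]integral_mkcond.
  apply: eq_integral => y _; rewrite patchE indicE; case: ifP => _; by rewrite ?mul1e ?mul0e.
rewrite -[LHS]monotone_convergence//; last 3 first.
- by move=> n; exact: emeasurable_funM.
- by move=> n x _; rewrite mule_ge0 ?lee_fin.
- by move=> x _ m n mn; rewrite lee_wpmul2r ?lee_fin//; exact: nd_gE.
apply: eq_integral => t _.
apply/cvg_lim => //; apply: cvgeZr => //; exact: cvg_nnsfun_approx.
Qed.

Lemma integral_with_density (f : T -> R) : measurable_fun setT f ->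
  (\int[p]_x (f x)%:E = \int[P]_x (f x * h x)%:E)%E.
Proof.
move=> mf; rewrite [LHS]integralE [RHS]integralE.
rewrite !ge0_integral_with_density//; [|exact/measurable_funeneg/measurable_EFinP
  |exact/measurable_funepos/measurable_EFinP].
congr (_ - _)%E; apply: eq_integral => x _.
- by rewrite !funeposE /= EFinM maxe_pMl ?mul0e ?lee_fin.
- by rewrite !funenegE /= -mulNr EFinM maxe_pMl ?mul0e ?lee_fin.
Qed.

End density_probability.

(** Normalization in y is asked for every x, as each [k x] must be a probability; normalization in x
    may fail on a nu-null set, which accommodates null cells. *)
Lemma coupling_of_density {R : realType} {d : measure_display} {X : measurableType d} {n : nat}
  (mu : probability X R) (nu : probability (n.-tuple R) R) (H : X * n.-tuple R -> R) :
  measurable_fun setT H -> (forall z, 0 <= H z) ->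
  (forall x, \int[nu]_y (H (x, y))%:E = 1)%E ->
  {ae nu, forall y, \int[mu]_x (H (x, y))%:E = 1}%E ->
  exists (pi : probability (X * n.-tuple R)%type R) (k : X -> probability (n.-tuple R) R),
    [/\ is_coupling mu nu pi, is_disintegration mu pi k &
      forall x (f : n.-tuple R -> R), measurable_fun setT f ->
        (\int[k x]_y (f y)%:E = \int[nu]_y (f y * H (x, y))%:E)%E].
Proof.
move=> mH H0 H1 H1'.
have mHx x : measurable_fun setT (fun y => H (x, y)).
  exact: measurableT_comp.
have mHy y : measurable_fun setT (fun x => H (x, y)).
  exact: measurableT_comp.
have mEH : measurable_fun setT (EFin \o H) by exact/measurable_EFinP.
have Hpi : (\int[mu \x nu]_z (H z)%:E = 1)%E.
  rewrite (fubini_tonelli1 (EFin \o H))//.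
  rewrite /fubini_F /=; under eq_integral do rewrite H1.
  exact: integral_prob_cst.
pose pi : probability (X * n.-tuple R)%type R := with_density (mu \x nu)%E H mH H0 Hpi.
pose k x : probability (n.-tuple R) R :=
  with_density nu (fun y => H (x, y)) (mHx x) (fun y => H0 (x, y)) (H1 x).
pose HB (B : set (n.-tuple R)) z := (H z * \1_B z.2)%:E.
have mHB B : measurable B -> measurable_fun setT (HB B).
  move=> mB; apply/measurable_EFinP; apply: measurable_funM => //.
  by apply: (measurableT_comp (measurable_indic mB)).
have HB0 B z : (0 <= HB B z)%E by rewrite lee_fin mulr_ge0// ?indicE.
have kE x B : measurable B -> k x B = (\int[nu]_y (HB B (x, y)))%E.
  move=> mB; rewrite /k /= /with_density integral_mkcond; apply: eq_integral => y _.
  by rewrite patchE /HB /= indicE; case: ifP => _; rewrite ?mulr1 ?mulr0.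
have disE A B : measurable A -> measurable B ->
    pi (A `*` B) = (\int[mu]_(x in A) k x B)%E.
  move=> mA mB.
  have -> : pi (A `*` B) = (\int[mu \x nu]_(z in A `*` B) (H z)%:E)%E by [].
  rewrite [LHS]integral_mkcond.
  pose G z := ((H z * \1_B z.2) * \1_A z.1)%:E.
  have mG : measurable_fun setT G.
    apply/measurable_EFinP; apply: measurable_funM.
      by apply/measurable_EFinP; exact: mHB.
    by apply: (measurableT_comp (measurable_indic mA)).
  transitivity (\int[mu \x nu]_z G z)%E.
    apply: eq_integral => -[x y] _; rewrite patchE /G /= !indicE.
    have -> : ((x, y) \in A `*` B) = (x \in A) && (y \in B).
      by apply/idP/andP => [/set_mem[/= ? ?]|[/set_mem ? /set_mem ?]]; [split; exact/mem_set|exact/mem_set].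
    by case: (x \in A); case: (y \in B); rewrite /= ?mulr1 ?mulr0.
  rewrite (fubini_tonelli1 G)//; last first.
    by move=> z; rewrite lee_fin !mulr_ge0// indicE.
  rewrite [RHS]integral_mkcond; apply: eq_integral => x _.
  rewrite patchE /fubini_F /G; case: ifPn => xA.
    by rewrite kE//; apply: eq_integral => y _; rewrite [\1_A _]indicE xA mulr1.
  by rewrite integral0_eq// => y _; rewrite [\1_A _]indicE (negbTE xA) mulr0.
exists pi, k; split.
- split => [A mA|B mB].
    rewrite disE//.
    transitivity (\int[mu]_(x in A) (cst 1%E x))%E.
      by apply: eq_integral => x _; exact: probability_setT.
    by rewrite integral_cst// mul1e.
  rewrite disE//; transitivity (\int[mu]_x fubini_F nu (HB B) x)%E.
    by apply: eq_integral => x _; rewrite kE.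
  rewrite -(fubini_tonelli1 (HB B))//; last exact: mHB.
  rewrite (fubini_tonelli2 (HB B))//; last exact: mHB.
  transitivity (\int[nu]_y (\1_B y)%:E)%E; last by rewrite integral_indic// setIT.
  apply: ae_eq_integral => //.
  - by apply: measurable_fun_fubini_tonelli_G => //; exact: mHB.
  - by apply/measurable_EFinP; exact: measurable_indic.
  apply: filterS H1' => y Hy _; rewrite /fubini_G /HB /= indicE.
  case: (y \in B).
    by under eq_integral do rewrite mulr1.
  by rewrite integral0_eq// => x _; rewrite mulr0.
- split; last exact: disE.
  move=> B mB; rewrite (_ : (fun x => k x B) = fubini_F nu (HB B)).
    by apply: measurable_fun_fubini_tonelli_F => //; exact: mHB.
  by apply/funext => x; rewrite kE.
- by move=> x f mf; exact: integral_with_density.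
Qed.

(** * Duality for bounded Lipschitz costs *)

(** The one-sided bound behind every inf-convolution below; exchanging x and y gives the Lipschitz
    estimate. *)
Lemma inf_lipschitz {R : realType} {T A : Type} (dist : T -> T -> R) (S : set A)
    (f : A -> T -> R) (L : R) (x y : T) : S !=set0 ->
  has_lbound [set f a x | a in S] -> (forall a, S a -> f a x <= f a y + L * dist x y) ->
  inf [set f a x | a in S] <= inf [set f a y | a in S] + L * dist x y.
Proof.
move=> [a0 Sa0] lbx hf; rewrite -lerBlDr; apply: lb_le_inf; first by exists (f a0 y), a0.
move=> _ [a Sa <-]; rewrite lerBlDr (le_trans _ (hf a Sa))//.
by apply: ge_inf => //; exists a.
Qed.

Section finite_valued.
Context {R : realType} {d : measure_display} {T : measurableType d} (P : probability T R).

Lemma bounded_integrable (f : T -> R) (B : R) : measurable_fun setT f ->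
  (forall x, `|f x| <= B) -> P.-integrable setT (EFin \o f).
Proof.
move=> mf fB; apply: (@le_integrable _ _ _ P setT measurableT _ (EFin \o cst B)).
- exact/measurable_EFinP.
- by move=> x _; rewrite /= lee_fin (le_trans (fB x))// ler_norm.
- exact: finite_measure_integrable_cst.
Qed.

Context {I : finType} (K : T -> I).
Hypothesis mK : forall i, measurable (K @^-1` [set i]).

Definition cell_mass (i : I) : R := fine (P (K @^-1` [set i])).

Lemma cell_mass_ge0 i : 0 <= cell_mass i.
Proof. exact: fine_ge0. Qed.

Lemma cell_massE i : P (K @^-1` [set i]) = (cell_mass i)%:E.
Proof. by rewrite fineK// fin_num_measure. Qed.

Lemma Rintegral_partition (f : T -> R) : P.-integrable setT (EFin \o f) ->
  \int[P]_x f x = \sum_i \int[P]_(x in K @^-1` [set i]) f x.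
Proof.
move=> intf; under [RHS]eq_bigr do rewrite Rintegral_mkcond.
rewrite -Rintegral_sum//.
  congr Rintegral; apply/funext => x; rewrite (bigD1 (K x))//= big1 ?addr0.
    by rewrite patchE mem_set.
  by move=> i iK; rewrite patchE memNset//= => Ki; move: iK; rewrite Ki eqxx.
move=> i; rewrite -restrict_EFin; apply/(integrable_mkcond _ (mK i)).
by apply: integrableS intf => //; exact: mK.
Qed.

Lemma integrable_finite_valued (f : I -> R) : P.-integrable setT (EFin \o (f \o K)).
Proof.
apply: (bounded_integrable (f \o K) (\sum_i `|f i|)).
  exact: (measurable_fin_glue K (fun i _ => f i)).
by move=> x; rewrite (bigD1 (K x))//= lerDl sumr_ge0.
Qed.

Lemma Rintegral_finite_valued (f : I -> R) :
  \int[P]_x f (K x) = \sum_i cell_mass i * f i.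
Proof.
rewrite Rintegral_partition; last exact: integrable_finite_valued.
apply: eq_bigr => i _; rewrite mulrC -[RHS]Rintegral_cst//.
by apply: eq_Rintegral => x; rewrite inE /= => ->.
Qed.

Lemma sum_cell_mass : \sum_i cell_mass i = 1.
Proof.
have := Rintegral_finite_valued (fun=> 1); rewrite Rintegral_prob_cst => ->.
by apply: eq_bigr => i _; rewrite mulr1.
Qed.

End finite_valued.

(** * Extension of discrete potentials to the whole space *)

Section discrete_dual_extension.
Context {R : realType} {X : Type} {n : nat} {I J : finType} (dX : X -> X -> R)
  (c : X -> n.-tuple R -> R) (L : R) (xs : I -> X) (i0 : I) (v : J -> R)
  (Y : J -> n.-tuple R) (phiI : I -> R) (psiJ : J -> R).
Hypotheses (dXm : is_metric dX) (L0 : 0 <= L) (v1 : \sum_j v j = 1)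
  (cL : forall x x' y y', `|c x y - c x' y'| <= L * (dX x x' + l1dist y y')).

(** In the application [Y j] is the integral of y over cell j, not its mean, so the cell masses do
    not appear. *)
Definition bary (theta : J -> R) : n.-tuple R :=
  [tuple \sum_j theta j * tnth (Y j) a | a < n].

Hypothesis dual : forall i theta, is_density v theta ->
  c (xs i) (bary theta) <= phiI i + \sum_j psiJ j * theta j.

Let dXx x : dX x x = 0. Proof. by have [_ h _ _] := dXm; apply/h. Qed.
Let dXC x y : dX x y = dX y x. Proof. by have [_ _ h _] := dXm. Qed.
Let dXT x y z : dX x z <= dX x y + dX y z. Proof. by have [_ _ _ h] := dXm. Qed.

Let c_le x x' y y' : c x y <= c x' y' + L * (dX x x' + l1dist y y').
Proof. by have := le_trans (ler_norm _) (cL x x' y y'); lra. Qed.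

Let G (theta : J -> R) (z : n.-tuple R) : R :=
  \sum_j psiJ j * theta j + L * l1dist z (bary theta).
Let D : set (J -> R) := [set theta | is_density v theta].

Definition psi_ext (z : n.-tuple R) : R := inf [set G theta z | theta in D].

Let D0 : D !=set0.
Proof. by exists (fun=> 1); split => //; under eq_bigr do rewrite mulr1. Qed.

(** Moving the argument of c from z to the barycenter costs at most L times their distance, which is
    the penalty contained in [G]. *)
Let G_ge i theta z : D theta -> c (xs i) z - phiI i <= G theta z.
Proof.
move=> dth; have := dual i theta dth; have := c_le (xs i) (xs i) z (bary theta).
by rewrite dXx add0r /G; lra.
Qed.

Let lbG z : has_lbound [set G theta z | theta in D].
Proof. by exists (c (xs i0) z - phiI i0) => _ [theta dth <-]; exact: G_ge. Qed.

Lemma psi_ext_le theta z : is_density v theta ->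
  psi_ext z <= \sum_j psiJ j * theta j + L * l1dist z (bary theta).
Proof. by move=> dth; apply: ge_inf => //; exists theta. Qed.

Lemma psi_ext_ge i z : c (xs i) z <= phiI i + psi_ext z.
Proof.
rewrite -lerBlDl; apply: lb_le_inf.
  by have [th dth] := D0; exists (G th z), th.
by move=> _ [th dth <-]; exact: G_ge.
Qed.

Lemma psi_ext_lipschitz y z : `|psi_ext y - psi_ext z| <= L * l1dist y z.
Proof.
have h u w : psi_ext u <= psi_ext w + L * l1dist u w.
  apply: (@inf_lipschitz _ _ _ l1dist) => // th dth.
  by rewrite /G -addrA lerD2l -mulrDr ler_wpM2l// addrC l1dist_triangle.
have h1 := h y z; have h2 := h z y; rewrite (l1distC z y) in h2.
by rewrite ler_norml; apply/andP; split; lra.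
Qed.

(** [G] is jointly convex in theta and z, and densities form a convex set; a partial infimum of such
    a function is convex. *)
Lemma psi_ext_convex : convex_fun psi_ext.
Proof.
move=> t y z /andP[t0 t1]; have t1' : 0 <= 1 - t by lra.
apply/ler_addgt0Pr => e e0.
have near_inf u : exists2 th, D th & G th u < psi_ext u + e.
  have [|_ [th dth <-] h] := @inf_adherent _ [set G theta u | theta in D] e e0; last by exists th.
  by split; [have [th dth] := D0; exists (G th u), th|exact: lbG].
have [th1 [p1 s1] h1] := near_inf y; have [th2 [p2 s2] h2] := near_inf z.
pose th j := t * th1 j + (1 - t) * th2 j.
have dth : D th.
  split=> [j|]; first by rewrite addr_ge0// mulr_ge0.
  under eq_bigr do rewrite mulrDr mulrCA [X in _ + X]mulrCA.
  by rewrite big_split /= -!mulr_sumr s1 s2; lra.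
rewrite (le_trans (psi_ext_le th _ dth))//.
have -> : \sum_j psiJ j * th j = t * \sum_j psiJ j * th1 j + (1 - t) * \sum_j psiJ j * th2 j.
  by rewrite !mulr_sumr -big_split; apply: eq_bigr => j _ /=; rewrite /th; ring.
have hd : l1dist (tconvcomb t y z) (bary th) <=
    t * l1dist y (bary th1) + (1 - t) * l1dist z (bary th2).
  rewrite /l1dist !mulr_sumr -big_split; apply: ler_sum => a _ /=.
  rewrite -[X in X * `|_| + _](ger0_norm t0) -[X in _ + X * _](ger0_norm t1') -!normrM.
  rewrite (le_trans _ (ler_normD _ _))// !tnth_mktuple le_eqVlt; apply/orP; left; apply/eqP.
  congr (`|_|); rewrite !mulrBr !mulr_sumr.
  have -> : \sum_j th j * tnth (Y j) a =
      \sum_j t * (th1 j * tnth (Y j) a) + \sum_j (1 - t) * (th2 j * tnth (Y j) a).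
    by rewrite -big_split; apply: eq_bigr => j _ /=; rewrite /th; ring.
  by ring.
have hL := ler_wpM2l L0 hd.
have g1 := ler_wpM2l t0 (ltW h1); have g2 := ler_wpM2l t1' (ltW h2).
by move: g1 g2 hL; rewrite /G !mulrDr; lra.
Qed.

Let F (i : I) (x : X) : R := phiI i + L * dX x (xs i).

Definition phi_ext (x : X) : R := inf [set F i x | i in setT].

Let F_ge i x z : c x z - psi_ext z <= F i x.
Proof.
have := c_le x (xs i) z z; rewrite l1distxx addr0 => h.
by have := psi_ext_ge i z; rewrite /F; lra.
Qed.

Let o : n.-tuple R := [tuple 0 | a < n].

Let lbF x : has_lbound [set F i x | i in setT].
Proof. by exists (c x o - psi_ext o) => _ [i _ <-]; exact: F_ge. Qed.

Lemma phi_ext_le i x : phi_ext x <= phiI i + L * dX x (xs i).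
Proof. by apply: ge_inf => //; exists i. Qed.

Lemma phi_psi_ext_ge x z : c x z <= phi_ext x + psi_ext z.
Proof.
rewrite -lerBlDr; apply: lb_le_inf; first by exists (F i0 x), i0.
by move=> _ [i _ <-]; exact: F_ge.
Qed.

Lemma phi_ext_lipschitz x y : `|phi_ext x - phi_ext y| <= L * dX x y.
Proof.
have h u w : phi_ext u <= phi_ext w + L * dX u w.
  apply: (@inf_lipschitz _ _ _ dX) => //; first by exists i0.
  by move=> i _; rewrite /F -addrA lerD2l -mulrDr ler_wpM2l// addrC dXT.
have h1 := h x y; have h2 := h y x; rewrite (dXC y x) in h2.
by rewrite ler_norml; apply/andP; split; lra.
Qed.

End discrete_dual_extension.

Section dual_cost.
Context {R : realType} {n : nat} (nu : probability (n.-tuple R) R) {J : finType}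
  (jdx : n.-tuple R -> J).
Hypotheses (mj : forall j, measurable (jdx @^-1` [set j]))
  (inu : nu.-integrable setT (EFin \o l1norm)).

Definition cell_moment (j : J) : n.-tuple R :=
  [tuple \int[nu]_(y in jdx @^-1` [set j]) tnth y a | a < n].

Lemma integrable_tnth a : nu.-integrable setT (EFin \o (fun y : n.-tuple R => tnth y a)).
Proof.
apply: le_integrable inu => //; first by apply/measurable_EFinP; exact: measurable_tnth.
move=> y _; rewrite /= lee_fin [leRHS]ger0_norm ?l1norm_ge0//.
by rewrite /l1norm (bigD1 a)//= lerDl sumr_ge0.
Qed.

Let mass := cell_mass nu jdx.

Let integrable_cell j (f : n.-tuple R -> R) : nu.-integrable setT (EFin \o f) ->
  nu.-integrable (jdx @^-1` [set j]) (EFin \o f).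
Proof. by apply: integrableS => //; exact: mj. Qed.

Lemma Rintegral_density (theta : J -> R) (f : n.-tuple R -> R) :
  nu.-integrable setT (EFin \o f) -> nu.-integrable setT (EFin \o (fun y => f y * theta (jdx y))) ->
  \int[nu]_y (f y * theta (jdx y)) =
  \sum_j theta j * \int[nu]_(y in jdx @^-1` [set j]) f y.
Proof.
move=> intf intft; rewrite (Rintegral_partition nu jdx mj)//.
apply: eq_bigr => j _; rewrite mulrC -RintegralZr//; last exact: integrable_cell.
by apply: eq_Rintegral => y; rewrite inE /= => ->.
Qed.

Lemma cell_moment_dist (j : J) (z : n.-tuple R) :
  nu.-integrable setT (EFin \o (l1dist ^~ z)) ->
  \sum_(a < n) `|mass j * tnth z a - tnth (cell_moment j) a| <=
  \int[nu]_(y in jdx @^-1` [set j]) l1dist y z.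
Proof.
move=> idz.
have icst (r : R) : nu.-integrable (jdx @^-1` [set j]) (EFin \o cst r).
  exact: finite_measure_integrable_cst.
have ia a := integrable_cell j _ (integrable_tnth a).
have id a : nu.-integrable (jdx @^-1` [set j]) (EFin \o (fun y : n.-tuple R => tnth z a - tnth y a)).
  by have := integrableB (mj j) (icst (tnth z a)) (ia a).
have ida a : nu.-integrable (jdx @^-1` [set j]) (EFin \o (fun y : n.-tuple R => `|tnth y a - tnth z a|)).
  have := integrable_abse (id a).
  rewrite (_ : (abse \o _) = EFin \o (fun y : n.-tuple R => `|tnth y a - tnth z a|))//.
  by apply/funext => y /=; rewrite distrC.
rewrite Rintegral_sum//; apply: ler_sum => a _.
rewrite tnth_mktuple mulrC -Rintegral_cst// -RintegralB//; do ?[exact: icst|exact: ia].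
rewrite (le_trans (le_normr_Rintegral _ _))//.
by under eq_Rintegral do rewrite distrC.
Qed.

(** On each cell psi is compared with the density concentrated on that cell. The distances from y to
    [ys j] and from [ys j] to the cell's centre of mass each integrate to at most [D j], whence the
    factor 2. *)
Lemma psi_ext_integral_le (psi : n.-tuple R -> R) (psiJ : J -> R) (L e : R)
    (ys : J -> n.-tuple R) : 0 <= L ->
  nu.-integrable setT (EFin \o psi) ->
  (forall j, nu.-integrable setT (EFin \o (l1dist ^~ (ys j)))) ->
  nu.-integrable setT (fun y => (l1dist y (ys (jdx y)))%:E) ->
  \int[nu]_y l1dist y (ys (jdx y)) <= e ->
  (forall j, mass j = 0 -> psiJ j = 0) ->
  (forall theta z, is_density mass theta ->
    psi z <= \sum_j psiJ j * theta j + L * l1dist z (bary cell_moment theta)) ->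
  \int[nu]_y psi y <= \sum_j psiJ j + 2 * L * e.
Proof.
move=> L0 ipsi idy idys de psi0 hpsi.
pose D j := \int[nu]_(y in jdx @^-1` [set j]) l1dist y (ys j).
have De : \sum_j D j <= e.
  rewrite (le_trans _ de)// (Rintegral_partition nu jdx mj)// le_eqVlt; apply/orP; left; apply/eqP.
  by apply: eq_bigr => j _; apply: eq_Rintegral => y; rewrite inE /= => ->.
have D0 j : 0 <= D j by apply: Rintegral_ge0 => y _; exact: l1dist_ge0.
apply: (@le_trans _ _ (\sum_j (psiJ j + 2 * L * D j))); last first.
  by rewrite big_split /= -mulr_sumr lerD2l ler_wpM2l// mulr_ge0.
rewrite (Rintegral_partition nu jdx mj)//; apply: ler_sum => j _.
(* A null cell cannot carry a normalized density; its integral is zero, and so is [psiJ j]. *)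
have [vj|vj] := eqVneq (mass j) 0.
  rewrite psi0// add0r /Rintegral null_set_integral//.
  - by rewrite mulr_ge0// mulr_ge0.
  - by apply: measurable_funTS; exact: measurable_int ipsi.
  - by have := cell_massE nu jdx mj j; rewrite (vj : cell_mass nu jdx j = 0).
have vj0 : 0 < mass j by rewrite lt_neqAle eq_sym vj cell_mass_ge0.
pose theta j' : R := if j' == j then (mass j)^-1 else 0.
have sumtheta (F : J -> R) : \sum_j' F j' * theta j' = F j / mass j.
  rewrite (bigD1 j)//= /theta eqxx big1 ?addr0// => j' /negbTE ->.
  by rewrite mulr0.
have dth : is_density mass theta.
  split; last by rewrite sumtheta divff.
  by move=> j'; rewrite /theta; case: ifP => // _; rewrite invr_ge0 cell_mass_ge0.
set b := bary cell_moment theta.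
pose E := l1dist (ys j) b.
have ED : mass j * E <= D j.
  rewrite (le_trans _ (cell_moment_dist j (ys j) (idy j)))// /E mulr_sumr.
  apply: ler_sum => a _; rewrite -{1}(ger0_norm (ltW vj0)) -normrM mulrBr.
  rewrite le_eqVlt; apply/orP; left; apply/eqP; congr (`|_ - _|).
  rewrite /b tnth_mktuple; under eq_bigr do rewrite mulrC.
  by rewrite sumtheta mulrC divfK.
pose K := psiJ j / mass j + L * E.
have icst : nu.-integrable (jdx @^-1` [set j]) (EFin \o cst K).
  exact: finite_measure_integrable_cst.
have id : nu.-integrable (jdx @^-1` [set j]) (EFin \o (fun y => L * l1dist y (ys j))).
  rewrite (_ : _ \o _ = fun y => (L%:E * (l1dist y (ys j))%:E)%E)//.
  by apply: integrableZl => //; exact: integrable_cell.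
apply: (@le_trans _ _ (\int[nu]_(y in jdx @^-1` [set j]) (K + L * l1dist y (ys j)))).
  apply: le_Rintegral => //; first exact: integrable_cell.
    by have := integrableD (mj j) icst id.
  move=> y _; rewrite (le_trans (hpsi theta y dth))// sumtheta /K -addrA lerD2l -mulrDr.
  by rewrite ler_wpM2l// addrC l1dist_triangle.
rewrite RintegralD// Rintegral_cst// RintegralZl//; last exact: integrable_cell.
rewrite -/(D j) -[fine _]/(mass j) /K mulrDl divfK//.
have -> : L * E * mass j = L * (mass j * E) by ring.
by have := ler_wpM2l L0 ED; lra.
Qed.

End dual_cost.

(** * From mixtures of discrete kernels to a genuine kernel *)

Section primal_realization.
Context {R : realType} {d : measure_display} {X : measurableType d} {n N : nat}
  (mu : probability X R) (nu : probability (n.-tuple R) R) {J : finType}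
  (idx : X -> 'I_N) (jdx : n.-tuple R -> J).
Hypotheses (mi : forall i, measurable (idx @^-1` [set i]))
  (mj : forall j, measurable (jdx @^-1` [set j]))
  (inu : nu.-integrable setT (EFin \o l1norm))
  (cut : forall (A : set X) (t : R), measurable A -> 0 <= t -> (t%:E <= mu A)%E ->
     exists E, [/\ measurable E, E `<=` A & mu E = t%:E]).

Let m := cell_mass mu idx.
Let v := cell_mass nu jdx.

(** A point of cell i with label k uses the density that the k-th selection assigns to i. Leaving F
    arbitrary lets one identity give both the value and the second marginal. *)
Lemma selection_realization (s : seq (R * @selection R 'I_N J v)) :
  \sum_(p <- s) `|p.1| = 1 ->
  exists (K : finType) (kap : X -> K) (f : K -> J -> R),
    [/\ forall k, measurable (kap @^-1` [set k]), forall k, is_density v (f k) &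
      forall F : 'I_N -> (J -> R) -> R,
        \int[mu]_x F (idx x) (f (kap x)) = mix_value m v F s].
Proof.
move=> s1.
pose ws := [seq `|p.1| | p <- s].
have ws1 : \sum_(w <- ws) w = 1 by rewrite big_map.
have ws0 : forall w, w \in ws -> 0 <= w.
  by apply/allP; rewrite /ws; elim: (s) => //= p t ->; rewrite normr_ge0.
have dis (i j : 'I_N) : i != j -> idx @^-1` [set i] `&` idx @^-1` [set j] = set0.
  by move=> ij; apply/seteqP; split => // x [/= -> ij']; rewrite ij' eqxx in ij.
have [] := split_weights mu N cut m ws (fun i => idx @^-1` [set i])
  (cell_mass_ge0 mu idx) ws0 mi dis.
  by move=> i; rewrite ws1 mulr1 cell_massE.
move=> g [mg gP].
have d1 : is_density v (fun=> 1).
  by split => //; under eq_bigr do rewrite mulr1; exact: sum_cell_mass.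
pose def : R * @selection R 'I_N J v :=
  (0, exist (fun f => forall i, is_density v (f i)) (fun=> fun=> 1) (fun=> d1)).
(* Labels beyond the list are gathered in one extra label, where [f] falls back on [def]; [cm0]
   shows that it has no mass. *)
pose G x : 'I_(size s).+1 := inord (minn (g x) (size s)).
have GE x : G x = minn (g x) (size s) :> nat by rewrite inordK// ltnS geq_minr.
pose kap x := (idx x, G x).
pose f (k : 'I_N * 'I_(size s).+1) := sval (nth def s k.2).2 k.1.
have mG k : measurable (G @^-1` [set k]).
  rewrite (_ : _ @^-1` _ = \bigcup_(l in [set l | minn l (size s) = k]) g @^-1` [set l]).
    by apply: bigcup_measurable => l _; exact: mg.
  apply/seteqP; split => x /=; first by move=> <-; exists (g x) => //=; rewrite GE.
  by move=> [l /= lk gl]; apply: ord_inj; rewrite GE gl.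
have kapE i k : kap @^-1` [set (i, k)] = idx @^-1` [set i] `&` G @^-1` [set k].
  by apply/seteqP; split => x /=; rewrite /kap; [case=> -> ->|case=> -> ->].
have mkap k : measurable (kap @^-1` [set k]).
  by case: k => i k; rewrite kapE; exact: measurableI.
exists ('I_N * 'I_(size s).+1)%type, kap, f; split => //.
  by move=> [i k]; exact: (svalP (nth def s k).2 i).
have cmE i (k : 'I_(size s)) : cell_mass mu kap (i, widen_ord (leqnSn _) k) =
    m i * `|(nth def s k).1|.
  rewrite /cell_mass kapE (_ : G @^-1` _ = g @^-1` [set val k]).
    have kws : (val k < size ws)%N by rewrite /ws size_map; exact: ltn_ord.
    have wsE : nth 0 ws k = `|(nth def s k).1| by exact: nth_map.
    by rewrite (gP i _ kws) /= wsE.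
  apply/seteqP; split => x /=.
    move=> /(congr1 val); rewrite /= GE => h.
    by move: (ltn_ord k); rewrite -h gtn_min ltnn orbF => gs; rewrite (minn_idPl (ltnW gs)).
  by move=> gk; apply: ord_inj; rewrite GE gk /= (minn_idPl (ltnW (ltn_ord k))).
have sumE (F : 'I_N -> (J -> R) -> R) :
    \sum_i \sum_(k < size s) m i * `|(nth def s k).1| * F i (f (i, widen_ord (leqnSn _) k)) =
    mix_value m v F s.
  rewrite exchange_big /= /mix_value (big_nth def) big_mkord.
  apply: eq_bigr => k _; rewrite mulr_sumr; apply: eq_bigr => i _; rewrite /f /=; ring.
have pairE (F : 'I_N * 'I_(size s).+1 -> R) : \sum_p F p = \sum_i \sum_k F (i, k).
  by rewrite pair_bigA /=; apply: eq_bigr => -[].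
have tot := sum_cell_mass mu kap mkap.
(* The proper labels already exhaust the total mass 1. *)
have cm0 i : cell_mass mu kap (i, ord_max) = 0.
  have : \sum_i cell_mass mu kap (i, ord_max) = 0.
    move: tot; rewrite pairE.
    under eq_bigr do rewrite big_ord_recr /=.
    rewrite big_split /=; under eq_bigr do under eq_bigr do rewrite cmE.
    have -> : \sum_i \sum_(k < size s) m i * `|(nth def s k).1| = 1.
      transitivity (mix_value m v (fun _ _ => 1) s).
        by rewrite -sumE; apply: eq_bigr => l _; apply: eq_bigr => k _; rewrite mulr1.
      rewrite /mix_value -[RHS]s1; apply: eq_bigr => p _.
      rewrite -[RHS]mulr1 -[X in _ = _ * X](sum_cell_mass mu idx mi); congr (_ * _).
      by apply: eq_bigr => l _; exact: mulr1.
    by lra.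
  move=> /eqP; rewrite psumr_eq0; last by move=> ? _; exact: cell_mass_ge0.
  by move=> /allP/(_ i (mem_index_enum _))/eqP.
move=> F; rewrite (Rintegral_finite_valued mu kap mkap (fun k => F k.1 (f k))).
rewrite pairE -sumE; apply: eq_bigr => i _.
rewrite big_ord_recr /= cm0 mul0r addr0.
by apply: eq_bigr => k _; rewrite cmE.
Qed.

Lemma coupling_of_selections (s : seq (R * @selection R 'I_N J v)) :
  represents m v s (fun=> 1) ->
  exists (K : finType) (kap : X -> K) (f : K -> J -> R)
    (pi : probability (X * n.-tuple R)%type R) (k : X -> probability (n.-tuple R) R),
    [/\ is_coupling mu nu pi, is_disintegration mu pi k,
      forall k, measurable (kap @^-1` [set k]),
      forall x, barycenter (k x) = bary (cell_moment nu jdx) (f (kap x)) &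
      (forall k, is_density v (f k)) /\ forall F : 'I_N -> (J -> R) -> R,
        \int[mu]_x F (idx x) (f (kap x)) = mix_value m v F s].
Proof.
move=> rs.
have sumv : \sum_j v j = 1 by exact: sum_cell_mass.
have s1 : \sum_(p <- s) `|p.1| = 1.
  rewrite -(mix_mass m v (sum_cell_mass mu idx mi)).
  by under eq_bigr do rewrite rs mulr1.
have [K [kap [f [mkap df fE]]]] := selection_realization s s1.
pose H (z : X * n.-tuple R) := f (kap z.1) (jdx z.2).
have mH : measurable_fun setT H.
  apply: (@measurable_fin_glue _ _ _ _ _ (fun z : X * n.-tuple R => (kap z.1, jdx z.2))
    (fun kj _ => f kj.1 kj.2)) => // -[k j].
  rewrite (_ : _ @^-1` _ = (kap @^-1` [set k]) `*` (jdx @^-1` [set j])).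
    exact: measurableX.
  by apply/seteqP; split => -[x y] /= [-> ->].
have [|||pi [k [cpl dis kE]]] := coupling_of_density mu nu H mH.
- by move=> z; exact: (df _).1.
- move=> x; have ifin := integrable_finite_valued nu jdx mj (f (kap x)).
  have := Rintegral_finite_valued nu jdx mj (f (kap x)); rewrite (df _).2 /Rintegral => h.
  by rewrite -[LHS]fineK ?h//; exact: integrable_fin_num ifin.
(* [represents] determines the marginal density only on cells of positive mass; the remaining cells
   form a null set. *)
- have aej j : {ae nu, forall y, jdx y = j -> v j != 0}.
    have [vj|vj] := eqVneq (v j) 0; last by apply: aeW => y _.
    exists (jdx @^-1` [set j]); split => //.
      by have := cell_massE nu jdx mj j; rewrite -/(v j) vj.
    by move=> y /= /not_implyP[].
  have aeall : {ae nu, forall y, forall j, jdx y = j -> v j != 0} by exact: filter_forall.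
  apply: filterS aeall => y /(_ (jdx y) erefl) vy.
  have ifin := integrable_finite_valued mu kap mkap (fun k => f k (jdx y)).
  have h := fE (fun _ theta => theta (jdx y)).
  have {}h : \int[mu]_x f (kap x) (jdx y) = 1.
    by apply: (mulfI vy); rewrite h; exact: rs.
  move: h; rewrite /Rintegral => h.
  by rewrite -[LHS]fineK ?h//; exact: integrable_fin_num ifin.
exists K, kap, f, pi, k; split => //.
move=> x; apply: eq_from_tnth => a; rewrite !tnth_mktuple kE; last exact: measurable_tnth.
have := Rintegral_density nu jdx mj (f (kap x)) (fun y => tnth y a) (integrable_tnth nu inu a).
rewrite /Rintegral => -> //; first by apply: eq_bigr => j _; rewrite tnth_mktuple.
pose B := \sum_j `|f (kap x) j|.
apply: (@le_integrable _ _ _ nu setT measurableT _ (fun y => (B%:E * (tnth y a)%:E)%E)).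
- apply/measurable_EFinP; apply: measurable_funM; first exact: measurable_tnth.
  exact: (measurable_fin_glue jdx (fun j _ => f (kap x) j)).
- move=> y _; rewrite /= lee_fin !normrM mulrC ler_wpM2r//.
  by rewrite (le_trans _ (ler_norm _))// /B (bigD1 (jdx y))//= lerDl sumr_ge0.
- by apply: integrableZl => //; exact: integrable_tnth.
Qed.

End primal_realization.

Section lipschitz_duality.
Context {R : realType} {d : measure_display} {X : measurableType d} {n : nat}
  (mu : probability X R) (nu : probability (n.-tuple R) R)
  (dX : X -> X -> R) (x0 : X) (c : X -> n.-tuple R -> R) (M L : R).
Hypotheses (dXm : is_metric dX) (dXs : mseparable dX)
  (mE : (measurable : set (set X)) = <<s mopen dX >>)
  (mu0 : forall x, mu [set x] = 0%E)
  (imu : mu.-integrable setT (EFin \o (dX ^~ x0)))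
  (inu : nu.-integrable setT (EFin \o l1norm)).
Hypotheses (L0 : 0 <= L) (cM : forall x y, `|c x y| <= M)
  (cL : forall x x' y y', `|c x y - c x' y'| <= L * (dX x x' + l1dist y y')).

Let dX0 x y : 0 <= dX x y. Proof. by case: dXm. Qed.

Let dXxx x : dX x x = 0. Proof. by have [_ h _ _] := dXm; apply/h. Qed.

Let mdX y : measurable_fun setT (dX ^~ y).
Proof.
apply: (mcontinuous_measurable dX) => //.
apply: (mlipschitz_continuous dX _ 1) => // x x'.
have [_ _ hC hT] := dXm; have h1 := hT x x' y; have h2 := hT x' x y.
by rewrite (hC x' x) in h2; rewrite mul1r ler_norml; apply/andP; split; lra.
Qed.

Let mc y : measurable_fun setT (c ^~ y).
Proof.
apply: (mcontinuous_measurable dX) => //.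
apply: (mlipschitz_continuous dX _ L) => // x x'.
by rewrite (le_trans (cL x x' y y))// l1distxx addr0.
Qed.

Let o : n.-tuple R := [tuple 0 | a < n].

Let l1dist_o y : l1dist y o = l1norm y.
Proof. by apply: eq_bigr => a _; rewrite tnth_mktuple subr0. Qed.

Lemma lipschitz_duality (e : R) : 0 < e ->
  exists (phi : X -> R) (psi : n.-tuple R -> R)
    (pi : probability (X * n.-tuple R)%type R) (k : X -> probability (n.-tuple R) R),
    [/\ (forall x x', `|phi x - phi x'| <= L * dX x x') /\
        (forall y y', `|psi y - psi y'| <= L * l1dist y y'),
      convex_fun psi, forall x y, c x y <= phi x + psi y,
      is_coupling mu nu pi /\ is_disintegration mu pi k &
      \int[mu]_x phi x + \int[nu]_y psi y <= \int[mu]_x c x (barycenter (k x)) + e].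
Proof.
(* The errors are L eta from phi, 2 L eta from psi, L eta from the cost, and eta from
   near-optimality of the mixture. *)
move=> e0; pose eta := e / (4 * L + 1).
have D0 : 0 < 4 * L + 1 by move: L0; lra.
have eta0 : 0 < eta by rewrite divr_gt0.
have etaE : 4 * L * eta + eta = e by rewrite /eta; field; rewrite gt_eqF.
have [s sP] := dXs.
have [N1 [idx [xs [mi iidx didx]]]] := quantization mu dX s x0 eta dX0 mdX sP imu eta0.
have [q qP] := @dense_tuples R n.
have inu' : nu.-integrable setT (EFin \o (l1dist ^~ o)).
  by rewrite (_ : l1dist ^~ o = l1norm)//; apply/funext => y; exact: l1dist_o.
have [N2 [jdx [ys [mj ijdx djdx]]]] :=
  quantization nu l1dist q o eta l1dist_ge0 measurable_l1dist qP inu' eta0.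
pose m := cell_mass mu idx; pose v := cell_mass nu jdx.
have m1 : \sum_i m i = 1 by exact: sum_cell_mass.
have v1 : \sum_j v j = 1 by exact: sum_cell_mass.
pose Y := cell_moment nu jdx.
pose cost i theta := c (xs i) (bary Y theta).
have [phiI [psiJ [dual mphi psi0 Upsi]]] := finite_duality m v cost M
  (cell_mass_ge0 mu idx) m1 (cell_mass_ge0 nu jdx) v1 (fun i theta _ => cM _ _).
have [S rS US] := Upsi eta eta0.
have cut := atomless_separable_cut mu dX dXm dXs mE mu0.
have [K [kap [f [pi [k [cpl dis mkap bE [df FE]]]]]]] :=
  coupling_of_selections mu nu idx jdx mi mj inu cut S rS.
pose phi := phi_ext dX L xs phiI.
pose psi := psi_ext L v Y psiJ.
have phiL x x' : `|phi x - phi x'| <= L * dX x x'.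
  exact: (phi_ext_lipschitz dX c L xs ord0 v Y phiI psiJ dXm L0 v1 cL dual).
have psiL y y' : `|psi y - psi y'| <= L * l1dist y y'.
  exact: (psi_ext_lipschitz dX c L xs ord0 v Y phiI psiJ dXm L0 v1 cL dual).
exists phi, psi, pi, k; split => //.
- exact: (psi_ext_convex dX c L xs ord0 v Y phiI psiJ dXm L0 v1 cL dual).
- exact: (phi_psi_ext_ge dX c L xs ord0 v Y phiI psiJ dXm v1 cL dual).
have mphi' : measurable_fun setT phi.
  by apply: (mcontinuous_measurable dX) => //; exact: (mlipschitz_continuous dX _ L).
have mpsi : measurable_fun setT psi.
  apply: econtinuous_measurable; apply: econtinuous_l1.
  exact: (mlipschitz_continuous l1dist _ L l1dist_ge0 psiL).
have iphi : mu.-integrable setT (EFin \o phi).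
  apply: (@le_integrable _ _ _ mu setT measurableT _
    (fun x => ((`|phi x0|)%:E + L%:E * (dX x x0)%:E)%E)).
  - exact/measurable_EFinP.
  - move=> x _; rewrite /= lee_fin (le_trans _ (ler_norm _))//.
    by have := phiL x x0; have := ler_normD (phi x - phi x0) (phi x0); rewrite subrK; lra.
  - apply: integrableD => //; first exact: finite_measure_integrable_cst.
    exact: integrableZl.
have ipsi : nu.-integrable setT (EFin \o psi).
  apply: (@le_integrable _ _ _ nu setT measurableT _
    (fun y => ((`|psi o|)%:E + L%:E * (l1norm y)%:E)%E)).
  - exact/measurable_EFinP.
  - move=> y _; rewrite /= lee_fin (le_trans _ (ler_norm _))//.
    have := psiL y o; have := ler_normD (psi y - psi o) (psi o).
    by rewrite subrK l1dist_o; lra.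
  - apply: integrableD => //; first exact: finite_measure_integrable_cst.
    exact: integrableZl.
have didx' : \int[mu]_x dX x (xs (idx x)) <= eta.
  by rewrite -lee_fin /Rintegral fineK//; exact: integrable_fin_num.
have djdx' : \int[nu]_y l1dist y (ys (jdx y)) <= eta.
  by rewrite -lee_fin /Rintegral fineK//; exact: integrable_fin_num.
have iLidx : mu.-integrable setT (EFin \o (fun x => L * dX x (xs (idx x)))).
  by rewrite (_ : _ \o _ = fun x => (L%:E * (dX x (xs (idx x)))%:E)%E)//; exact: integrableZl.
have hphi : \int[mu]_x phi x <= L * eta.
  apply: (@le_trans _ _ (\int[mu]_x (phiI (idx x) + L * dX x (xs (idx x))))).
    apply: le_Rintegral => //.
      by have := integrableD measurableT (integrable_finite_valued mu idx mi phiI) iLidx.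
    move=> x _; exact: (phi_ext_le dX c L xs v Y phiI psiJ dXm v1 cL dual).
  rewrite RintegralD//; last exact: (integrable_finite_valued mu idx mi phiI).
  rewrite (Rintegral_finite_valued mu idx mi) RintegralZl//.
  by have := ler_wpM2l L0 didx'; move: mphi; rewrite /m; lra.
have hpsi : \int[nu]_y psi y <= \sum_j psiJ j + 2 * L * eta.
  apply: (psi_ext_integral_le nu jdx mj inu psi psiJ L eta ys) => //.
  - move=> j; apply: (@le_integrable _ _ _ nu setT measurableT _
      (fun y => ((l1norm y)%:E + (l1norm (ys j))%:E)%E)).
    + by apply/measurable_EFinP; exact: measurable_l1dist.
    + move=> y _; rewrite /= lee_fin (le_trans _ (ler_norm _))// ger0_norm ?l1dist_ge0//.
      exact: l1dist_le_norm.
    + by apply: integrableD => //; exact: finite_measure_integrable_cst.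
  - move=> theta z dth; exact: (psi_ext_le dX c L xs ord0 v Y phiI psiJ dXm cL dual).
have icb : mu.-integrable setT (EFin \o (fun x => c x (bary Y (f (kap x))))).
  apply: (bounded_integrable mu _ M) => //.
  exact: (@measurable_fin_glue _ _ _ _ _ kap (fun k x => c x (bary Y (f k))) mkap).
(* The barycenters agree exactly, so only x is moved, to the representative of its cell. *)
have hc : mix_value m v cost S <= \int[mu]_x c x (barycenter (k x)) + L * eta.
  rewrite -FE; under [X in _ <= X + _]eq_Rintegral do rewrite bE -/Y.
  apply: (@le_trans _ _ (\int[mu]_x (c x (bary Y (f (kap x))) + L * dX x (xs (idx x))))).
    apply: le_Rintegral => //.
    - apply: (bounded_integrable mu _ M) => //; last by move=> x; exact: cM.
      apply: (@measurable_fin_glue _ _ _ _ _ idx (fun i x => cost i (f (kap x))) mi) => i.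
      exact: (@measurable_fin_glue _ _ _ _ _ kap (fun k _ => cost i (f k)) mkap).
    - by have := integrableD measurableT icb iLidx.
    - move=> x _; rewrite /cost.
      have := le_trans (ler_norm _) (cL (xs (idx x)) x (bary Y (f (kap x))) (bary Y (f (kap x)))).
      have [_ _ hC _] := dXm; rewrite l1distxx addr0 (hC (xs _)); lra.
  rewrite RintegralD// lerD2l RintegralZl//; exact: ler_wpM2l.
by lra.
Qed.

End lipschitz_duality.

(** * Approximation by bounded Lipschitz costs *)

Section uniform_on_balls.
Context {R : realType} {X : Type} {n : nat} (dX : X -> X -> R).

Let tup (v : 'rV[R]_n) : n.-tuple R := [tuple v ord0 i | i < n].

(** Compactness is available in y only: the estimate is uniform over a box in y but local around one
    fixed x. Row vectors provide the compact box. *)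
Lemma mecontinuous2_uniform (c : X -> n.-tuple R -> R) (x : X) (rho e : R) :
  mecontinuous2 dX c -> 0 < e ->
  exists2 del, 0 < del & forall y, l1norm y <= rho -> forall x1 x2 y',
    dX x x1 < del -> dX x x2 < del -> l1dist y y' < del -> `|c x1 y - c x2 y'| < e.
Proof.
move=> cc e0.
pose box : set 'rV[R]_n := [set v | forall i, `[- rho, rho]%classic (v ord0 i)].
have cbox : compact box by apply: (@rV_compact R n (fun=> `[- rho, rho]%classic)) => i; exact: segment_compact.
pose P (del : R) (v : 'rV[R]_n) := forall x1 x2 y', dX x x1 < del -> dX x x2 < del ->
  l1dist (tup v) y' < del -> `|c x1 (tup v) - c x2 y'| < e.
have l1tup (v v' : 'rV[R]_n) (r : R) : (forall i, `|v ord0 i - v' ord0 i| < r / n.+1%:R) -> 0 < r ->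
    l1dist (tup v) (tup v') < r.
  move=> h r0; apply: (@le_lt_trans _ _ (\sum_(i < n) r / n.+1%:R)).
    by apply: ler_sum => i _; rewrite !tnth_mktuple ltW.
  rewrite sumr_const card_ord -[_ *+ n]mulr_natr -mulrA gtr_pMr//.
  by rewrite mulrC ltr_pdivrMr// mul1r ltr_nat.
have ncov := (compact_near_coveringP box).1 cbox R (0:R)^'+ P _.
have : \forall del \near (0:R)^'+, box `<=` P del.
  apply: ncov => v _.
  have e20 : 0 < e / 2 by lra.
  have [r r0 hr] := cc x (tup v) (e / 2) e20.
  exists (ball v (r / 2 / n.+1%:R), [set del | 0 < del < r / 2]) => /=.
    split; first by apply: nbhsx_ballx; rewrite !divr_gt0.
    near=> del; apply/andP; split => //=.
    by near: del; apply: nbhs_right_lt; rewrite divr_gt0.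
  move=> [v' del] /= [[_ vv'] /andP[del0 delr]] x1 x2 y' h1 h2 h3.
  have d1 : l1dist (tup v) (tup v') < r / 2.
    by apply: l1tup; rewrite ?divr_gt0// => i; exact: vv'.
  have lt1 z : l1dist (tup v') z < r / 2 -> tnorm (tsub (tup v) z) < r.
    move=> hz; rewrite (le_lt_trans (tnorm_le_l1norm _))// -l1dist_tsub.
    by have := l1dist_triangle (tup v) (tup v') z; lra.
  have a1 : `|c x (tup v) - c x1 (tup v')| < e / 2.
    by apply: hr; [lra|apply: lt1; rewrite l1distxx divr_gt0].
  have a2 : `|c x (tup v) - c x2 y'| < e / 2 by apply: hr; [lra|apply: lt1; lra].
  have := ler_distD (c x (tup v)) (c x1 (tup v')) (c x2 y').
  by rewrite (distrC _ (c x (tup v))) /P; lra.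
move=> near_box.
have : \forall del \near (0:R)^'+, 0 < del /\ box `<=` P del.
  by near=> del; split => //; near: del; exact: near_box.
move=> /filter_ex[del [del0 hdel]]; exists del => // y yrho x1 x2 y' h1 h2 h3.
pose v : 'rV[R]_n := \row_i tnth y i.
have yE : y = tup v by apply: eq_from_tnth => i; rewrite tnth_mktuple mxE.
rewrite yE in h3 *; apply: (hdel v) => // i; rewrite /= mxE in_itv /= -ler_norml.
by rewrite (le_trans _ yrho)// /l1norm (bigD1 i)//= lerDl sumr_ge0.
Unshelve. all: by end_near.
Qed.

End uniform_on_balls.

Section small_majorants.
Context {R : realType} {d : measure_display} {X : measurableType d} {n : nat}
  (mu : probability X R) (nu : probability (n.-tuple R) R) (r : R)
  (dX : X -> X -> R) (x0 : X).
Hypotheses (r1 : 1 <= r) (dXm : is_metric dX)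
  (mE : (measurable : set (set X)) = <<s mopen dX >>)
  (mur : (\int[mu]_x (dX x x0 `^ r)%:E < +oo)%E)
  (nur : (\int[nu]_y (tnorm y `^ r)%:E < +oo)%E).

Definition admissible_cont (a : X -> R) : Prop :=
  mcontinuous dX a /\ exists C, forall x, `|a x| <= C * (1 + dX x x0) `^ r.

Definition admissible_convex (b : n.-tuple R -> R) : Prop :=
  convex_fun b /\ exists C, forall y, `|b y| <= C * (1 + tnorm y) `^ r.

(* [c'] is as good as [c] up to [e]: the majorant in [y] is convex, so Jensen controls it
   along barycenters. *)
Definition close_costs (e : R) (c c' : X -> n.-tuple R -> R) : Prop :=
  exists a b, [/\ admissible_cont a, admissible_convex b,
    \int[mu]_x a x <= e, \int[nu]_y b y <= e &
    forall x y, `|c x y - c' x y| <= a x + b y].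

Let dX0 x y : 0 <= dX x y. Proof. by case: dXm. Qed.
Let dXxx x : dX x x = 0. Proof. by have [_ h _ _] := dXm; apply/h. Qed.
Let dXC x y : dX x y = dX y x. Proof. by have [_ _ h _] := dXm. Qed.
Let dXT x y z : dX x z <= dX x y + dX y z. Proof. by have [_ _ _ h] := dXm. Qed.

Lemma dist_dist_le x y z : `|dX x z - dX y z| <= dX x y.
Proof.
by rewrite ler_norml; have := dXT x y z; have := dXT y x z; rewrite (dXC y x) => h1 h2;
  apply/andP; split; lra.
Qed.

Lemma mcontinuous_dist z : mcontinuous dX (dX ^~ z).
Proof.
apply: (mlipschitz_continuous dX _ 1) => // x y.
by rewrite mul1r dist_dist_le.
Qed.

Lemma measurable_dist z : measurable_fun setT (dX ^~ z).
Proof. by apply: (mcontinuous_measurable dX) => //; exact: mcontinuous_dist. Qed.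

Lemma integrable_admissible_cont a : admissible_cont a -> mu.-integrable setT (EFin \o a).
Proof.
move=> [ca [C aC]].
apply: (integrable_growth_powR mu (dX ^~ x0) r r1 _ _ mur a C) => //.
- exact: measurable_dist.
- exact: (mcontinuous_measurable dX).
Qed.

Lemma integrable_admissible_convex b : admissible_convex b -> nu.-integrable setT (EFin \o b).
Proof.
move=> [cb [C bC]].
apply: (integrable_growth_powR nu (@tnorm R n) r r1 tnorm_ge0 measurable_tnorm nur b C) => //.
by apply: econtinuous_measurable; exact: convex_growth_continuous bC.
Qed.

Lemma mcontinuousD a a' : mcontinuous dX a -> mcontinuous dX a' ->
  mcontinuous dX (fun x => a x + a' x).
Proof.
move=> ca ca' x e e0; have e20 : 0 < e / 2 by lra.
have [r0 r00 h] := ca x _ e20; have [r0' r00' h'] := ca' x _ e20.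
exists (Num.min r0 r0'); first by rewrite lt_min r00.
move=> y; rewrite lt_min => /andP[/h hy /h' hy'].
have -> : a x + a' x - (a y + a' y) = (a x - a y) + (a' x - a' y) by ring.
by have := ler_normD (a x - a y) (a' x - a' y); lra.
Qed.

Lemma admissible_contD a a' : admissible_cont a -> admissible_cont a' ->
  admissible_cont (fun x => a x + a' x).
Proof.
move=> [ca [C aC]] [ca' [C' aC']]; split; first exact: mcontinuousD.
exists (C + C') => x; rewrite mulrDl (le_trans (ler_normD _ _))//.
by rewrite lerD ?aC ?aC'.
Qed.

Lemma admissible_convexD b b' : admissible_convex b -> admissible_convex b' ->
  admissible_convex (fun y => b y + b' y).
Proof.
move=> [cb [C bC]] [cb' [C' bC']]; split; first exact: convex_funD.
exists (C + C') => y; rewrite mulrDl (le_trans (ler_normD _ _))//.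
by rewrite lerD ?bC ?bC'.
Qed.

Lemma close_costs_trans e e' c c' c'' : close_costs e c c' -> close_costs e' c' c'' ->
  close_costs (e + e') c c''.
Proof.
move=> [a [b [aa ab ia ib h]]] [a' [b' [aa' ab' ia' ib' h']]].
exists (fun x => a x + a' x), (fun y => b y + b' y); split.
- exact: admissible_contD.
- exact: admissible_convexD.
- by rewrite RintegralD ?lerD//; exact: integrable_admissible_cont.
- by rewrite RintegralD ?lerD//; exact: integrable_admissible_convex.
- move=> x y; have := ler_distD (c' x y) (c x y) (c'' x y).
  by have := h x y; have := h' x y; lra.
Qed.

(** With D near - m, this bounds the part above level m of a function of growth |y|^r. As the
    positive part of a convex function it is convex, and it vanishes as D decreases. *)
Definition excess {k : nat} (C D : R) (y : k.-tuple R) : R :=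
  Num.max 0 (C * l1norm y `^ r + D).

Lemma convex_excess k C D : 0 <= C -> convex_fun (@excess k C D).
Proof.
move=> C0; apply: convex_fun_max0; apply: convex_funD; last exact: convex_fun_cst.
by apply: convex_funZ => //; exact: convex_l1norm_powR.
Qed.

Lemma excess_le k C D (y : k.-tuple R) : 0 <= C ->
  0 <= excess C D y <= C * l1norm y `^ r + `|D|.
Proof.
move=> C0; rewrite /excess le_max lexx /= ge_max.
rewrite addr_ge0 ?mulr_ge0 ?powR_ge0//= lerD2l; exact: ler_norm.
Qed.

Lemma excess_growth k C D (y : k.-tuple R) : 0 <= C ->
  `|excess C D y| <= (C * k%:R `^ r + `|D|) * (1 + tnorm y) `^ r.
Proof.
move=> C0; have /andP[h0 h] := @excess_le k C D y C0.
rewrite ger0_norm// (le_trans h)// mulrDl lerD//.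
  rewrite -mulrA ler_wpM2l// (le_trans (l1norm_powR_le r r1 y))//.
  rewrite ler_wpM2l ?powR_ge0//; apply: ge0_ler_powR; rewrite ?nnegrE ?tnorm_ge0//.
  - by move: r1; lra.
  - by rewrite addr_ge0// tnorm_ge0.
  - by rewrite lerDr.
rewrite ler_peMr// (le_trans _ (le_1D_powR r _ (tnorm_ge0 y) r1))//.
by rewrite lerDl tnorm_ge0.
Qed.

(** The distance to x0 seen as a vector of R^1, so that the facts on [excess] apply on X as well. *)
Let single (x : X) : 1.-tuple R := [tuple dX x x0 | _ < 1].

Let l1norm_single x : l1norm (single x) = dX x x0.
Proof. by rewrite /l1norm big_ord1 tnth_mktuple ger0_norm. Qed.

Lemma admissible_excess_dist C D : 0 <= C -> admissible_cont (fun x => excess C D (single x)).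
Proof.
move=> C0; split.
  have ce : econtinuous (@excess 1 C D).
    apply: (convex_growth_continuous _ r (C * 1%:R `^ r + `|D|) r1); first exact: convex_excess.
    by move=> y; exact: excess_growth.
  move=> x e e0; have [del del0 h] := econtinuous_l1E _ ce (single x) e e0.
  exists del => // x' xx'; apply: h; apply: le_lt_trans xx'.
  by rewrite /l1dist big_ord1 !tnth_mktuple dist_dist_le.
exists (C + `|D|) => x; have /andP[h0 h] := @excess_le 1 C D (single x) C0.
rewrite ger0_norm// (le_trans h)// l1norm_single mulrDl lerD//.
  rewrite ler_wpM2l//; apply: ge0_ler_powR; rewrite ?nnegrE//.
  - by move: r1; lra.
  - by rewrite addr_ge0.
  - by rewrite lerDr.
rewrite ler_peMr// (le_trans _ (le_1D_powR r _ (dX0 x x0) r1))//.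
by rewrite lerDl.
Qed.

Let Rintegral_lt_of {d'} {T : measurableType d'} (P : probability T R) (f : T -> R) (e : R) :
  P.-integrable setT (EFin \o f) -> (\int[P]_x (f x)%:E < e%:E)%E -> \int[P]_x f x <= e.
Proof.
move=> intf /ltW; rewrite -lee_fin /Rintegral fineK//; exact: integrable_fin_num.
Qed.

Lemma excess_cvg0 (t C D : R) : (fun m : nat => Num.max 0 (C * t + (D - m%:R))) @ \oo --> 0.
Proof.
apply/cvgrPdist_lt => e e0; near=> m.
rewrite sub0r normrN (_ : Num.max _ _ = 0) ?normr0//.
apply/max_idPl; rewrite addrA subr_le0.
by near: m; exact: nbhs_infty_ger.
Unshelve. all: by end_near.
Qed.

(** Truncating at m1 + m2 splits the excess of |c| into a part in x above m1, which also takes the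
    constant term of the growth bound, and a part in y above m2. *)
Lemma clamp_approximation (c : X -> n.-tuple R -> R) (C e : R) : 0 < e ->
  mecontinuous2 dX c ->
  (forall x y, `|c x y| <= C * (1 + dX x x0 `^ r + tnorm y `^ r)) ->
  exists M c', [/\ mecontinuous2 dX c', forall x y, `|c' x y| <= M & close_costs e c c'].
Proof.
move=> e0 cc cC; pose C' := `|C|; have C'0 : 0 <= C' by exact: normr_ge0.
have [m1 hm1] : exists m : nat, \int[mu]_x excess C' (C' - m%:R) (single x) <= e.
  have ia (D : R) := integrable_admissible_cont _ (admissible_excess_dist C' D C'0).
  have [||||m hm] := @dominated_small _ _ _ mu
    (fun m x => excess C' (C' - m%:R) (single x))
    (fun x => C' * dX x x0 `^ r + C') e e0.
  - move=> m; apply: (mcontinuous_measurable dX) => //.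
    exact: (admissible_excess_dist C' (C' - m%:R) C'0).1.
  - apply: (integrable_growth mu (dX ^~ x0) r (measurable_dist x0) mur _ C').
      apply: measurable_funD => //; apply: measurable_funM => //.
      by apply: measurable_powRT; exact: measurable_dist.
    by move=> x; rewrite ger0_norm ?addr_ge0 ?mulr_ge0 ?powR_ge0//; lra.
  - move=> m x; rewrite /excess le_max lexx /= l1norm_single ge_max.
    rewrite addr_ge0 ?mulr_ge0 ?powR_ge0//= lerD2l; have := ler0n R m; lra.
  - by move=> x; exact: excess_cvg0.
  by exists m; exact: Rintegral_lt_of.
have [m2 hm2] : exists m : nat, \int[nu]_y @excess n C' (0 - m%:R) y <= e.
  have ab (D : R) : admissible_convex (@excess n C' D).
    split; first exact: convex_excess.
    by exists (C' * n%:R `^ r + `|D|) => y; exact: excess_growth.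
  have [||||m hm] := @dominated_small _ _ _ nu
    (fun m y => excess C' (0 - m%:R) y) (fun y => C' * l1norm y `^ r) e e0.
  - move=> m; apply: econtinuous_measurable.
    by have [cb [B bB]] := ab (0 - m%:R); exact: convex_growth_continuous bB.
  - rewrite (_ : _ \o _ = fun y => (C'%:E * (l1norm y `^ r)%:E)%E)//.
    by apply: integrableZl => //; exact: (integrable_l1norm_powR nu r).
  - move=> m y; rewrite /excess le_max lexx /= ge_max mulr_ge0 ?powR_ge0//=.
    by have := ler0n R m; lra.
  - by move=> y; exact: excess_cvg0.
  by exists m; apply: Rintegral_lt_of => //; exact: integrable_admissible_convex.
pose M : R := m1%:R + m2%:R; have M0 : 0 <= M by rewrite addr_ge0.
pose clamp (u : R) := Num.max (- M) (Num.min M u).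
have clampM u : `|clamp u| <= M.
  rewrite /clamp ler_norml; apply/andP; split; first by rewrite le_max lexx.
  by rewrite ge_max ge_min lexx /= andbT; lra.
have clamp_lip u w : `|clamp u - clamp w| <= `|u - w|.
  rewrite /clamp.
  case: (leP M u) => h1; case: (leP M w) => h2.
  - by rewrite subrr normr0.
  - case: (leP (- M) M) => h3; last lra.
    case: (leP (- M) w) => h4; rewrite !ger0_norm; lra.
  - case: (leP (- M) M) => h3; last lra.
    by case: (leP (- M) u) => h4; rewrite distrC [leRHS]distrC !ger0_norm; lra.
  - case: (leP (- M) u) => h3; case: (leP (- M) w) => h4 //.
    + by rewrite !ger0_norm; lra.
    + by rewrite distrC [leRHS]distrC !ger0_norm; lra.
    + by rewrite subrr normr0.
exists M, (fun x y => clamp (c x y)); split => //.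
  move=> x y e' e'0; have [del del0 h] := cc x y e' e'0.
  by exists del => // x' y' h1 h2; rewrite (le_lt_trans (clamp_lip _ _))// h.
exists (fun x => excess C' (C' - m1%:R) (single x)), (@excess n C' (0 - m2%:R)); split => //.
- exact: admissible_excess_dist.
- split; first exact: convex_excess.
  by exists (C' * n%:R `^ r + `|0 - m2%:R|) => y; exact: excess_growth.
move=> x y.
have h1 : `|c x y - clamp (c x y)| <= Num.max 0 (`|c x y| - M).
  rewrite /clamp le_max; case: (leP M (c x y)) => h1.
    by apply/orP; right; rewrite max_r; [rewrite !ger0_norm; lra|lra].
  case: (leP (- M) (c x y)) => h2; first by rewrite subrr normr0 lexx.
  by apply/orP; right; rewrite !ler0_norm; lra.
have /andP[e1 _] := @excess_le 1 C' (C' - m1%:R) (single x) C'0.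
have /andP[e2 _] := @excess_le n C' (0 - m2%:R) y C'0.
rewrite (le_trans h1)// ge_max addr_ge0//=.
have l1 : C' * l1norm (single x) `^ r + (C' - m1%:R) <= excess C' (C' - m1%:R) (single x).
  by rewrite /excess le_max lexx orbT.
have l2 : C' * l1norm y `^ r + (0 - m2%:R) <= excess C' (0 - m2%:R) y.
  by rewrite /excess le_max lexx orbT.
have gy : tnorm y `^ r <= l1norm y `^ r.
  apply: ge0_ler_powR; rewrite ?nnegrE ?tnorm_ge0 ?l1norm_ge0 ?tnorm_le_l1norm//.
  by move: r1; lra.
have := le_trans (cC x y) (ler_wpM2r _ (ler_norm C)).
rewrite !addr_ge0 ?powR_ge0// => /(_ isT); rewrite -/C' => hc.
have := ler_wpM2l C'0 gy; rewrite l1norm_single in l1.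
by move: hc l1 l2; rewrite /M !mulrDr; lra.
Qed.

End small_majorants.

(** * Lipschitz regularization of a bounded continuous cost *)

Section pasch_hausdorff.
Context {R : realType} {X : Type} {n : nat} (dX : X -> X -> R) (x0 : X).
Hypothesis dXm : is_metric dX.
Variables (c : X -> n.-tuple R -> R) (M : R).
Hypotheses (cc : mecontinuous2 dX c) (cM : forall x y, `|c x y| <= M).

Let dX0 x y : 0 <= dX x y. Proof. by case: dXm. Qed.
Let dXxx x : dX x x = 0. Proof. by have [_ h _ _] := dXm; apply/h. Qed.
Let dXC x y : dX x y = dX y x. Proof. by have [_ _ h _] := dXm. Qed.
Let dXT x y z : dX x z <= dX x y + dX y z. Proof. by have [_ _ _ h] := dXm. Qed.

Let o : n.-tuple R := [tuple 0 | a < n].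

Let M0 : 0 <= M. Proof. by rewrite (le_trans _ (cM x0 o)). Qed.

Let dist2 (u w : X * n.-tuple R) : R := dX u.1 w.1 + l1dist u.2 w.2.

Let dist20 u w : 0 <= dist2 u w.
Proof. by rewrite addr_ge0// l1dist_ge0. Qed.

Let G (K : R) (w u : X * n.-tuple R) : R := c w.1 w.2 + K * dist2 u w.

(** The Pasch-Hausdorff envelope: for K >= 0, the largest K-Lipschitz minorant of c. *)
Definition pasch (K : R) (u : X * n.-tuple R) : R := inf [set G K w u | w in setT].

Let setT0 : [set: X * n.-tuple R] !=set0. Proof. by exists (x0, o). Qed.

Let lbG K u : 0 <= K -> lbound [set G K w u | w in setT] (- M).
Proof.
move=> K0 _ [w _ <-]; have := cM w.1 w.2; rewrite ler_norml => /andP[h _].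
by rewrite /G (le_trans h)// lerDl mulr_ge0.
Qed.

Lemma pasch_le K u w : 0 <= K -> pasch K u <= c w.1 w.2 + K * dist2 u w.
Proof. by move=> K0; apply: ge_inf; [exists (- M); exact: lbG|exists w]. Qed.

Lemma pasch_le_cost K x y : 0 <= K -> pasch K (x, y) <= c x y.
Proof.
by move=> K0; have := pasch_le K (x, y) (x, y) K0; rewrite /dist2 /= dXxx l1distxx addr0 mulr0 addr0.
Qed.

Lemma pasch_bound K u : 0 <= K -> `|pasch K u| <= M.
Proof.
move=> K0; rewrite ler_norml; apply/andP; split.
  by apply: lb_le_inf; [exists (G K u u), u|exact: lbG].
case: u => x y; rewrite (le_trans (pasch_le_cost K x y K0))//.
by have := cM x y; rewrite ler_norml => /andP[].
Qed.

Lemma pasch_lipschitz K x x' y y' : 0 <= K ->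
  `|pasch K (x, y) - pasch K (x', y')| <= K * (dX x x' + l1dist y y').
Proof.
move=> K0.
have h u w : pasch K u <= pasch K w + K * dist2 u w.
  apply: (@inf_lipschitz _ _ _ dist2) => //; first by exists (- M); exact: lbG.
  move=> v _; rewrite /G -addrA lerD2l -mulrDr ler_wpM2l// /dist2.
  by have := dXT u.1 w.1 v.1; have := l1dist_triangle u.2 w.2 v.2; lra.
have h1 := h (x, y) (x', y'); have h2 := h (x', y') (x, y).
rewrite /dist2 /= (dXC x') (l1distC y') in h2; rewrite /dist2 /= in h1.
by rewrite ler_norml; apply/andP; split; lra.
Qed.

Let gap K (w : X * n.-tuple R) : R := c w.1 w.2 - pasch K w.

Let gap_ge0 K w : 0 <= K -> 0 <= gap K w.
Proof. by case: w => x y K0; rewrite subr_ge0; exact: pasch_le_cost. Qed.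

Let gap_le K w : 0 <= K -> gap K w <= 2 * M.
Proof.
move=> K0; have := pasch_bound K w K0; have := cM w.1 w.2.
by rewrite !ler_norml /gap => /andP[a b] /andP[a' b']; lra.
Qed.

Variable rho : R.
Hypothesis rho0 : 0 < rho.

Let B : set (X * n.-tuple R) := [set w | l1norm w.2 <= rho].
Let E K (w : X * n.-tuple R) (x : X) : R := K * dX x w.1 - gap K w.

(* The supremum of the gap over the ball of radius [rho] in [y], regularized in [x] so
   that it becomes Lipschitz. *)
Definition gap_majorant K (x : X) : R := - inf [set E K w x | w in B].

Let o_norm : l1norm o = 0.
Proof. by rewrite /l1norm big1// => i _; rewrite tnth_mktuple normr0. Qed.

Let B0 : B !=set0. Proof. by exists (x0, o); rewrite /B /= o_norm ltW. Qed.

Let lbE K x : 0 <= K -> lbound [set E K w x | w in B] (- (2 * M)).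
Proof.
move=> K0 _ [w _ <-]; rewrite /E; have := gap_le K w K0.
by have := mulr_ge0 K0 (dX0 x w.1); lra.
Qed.

Lemma gap_majorant_ge K x y : 0 <= K -> l1norm y <= rho ->
  c x y - pasch K (x, y) <= gap_majorant K x.
Proof.
move=> K0 yrho; rewrite /gap_majorant lerNr.
have -> : - (c x y - pasch K (x, y)) = E K (x, y) x by rewrite /E /gap /= dXxx; ring.
by apply: ge_inf; [exists (- (2 * M)); exact: lbE|exists (x, y)].
Qed.

Lemma gap_majorant_bound K x : 0 <= K -> 0 <= gap_majorant K x <= 2 * M.
Proof.
move=> K0; apply/andP; split.
  apply: (le_trans (gap_ge0 K (x, o) K0)).
  by apply: gap_majorant_ge => //; rewrite o_norm ltW.
rewrite /gap_majorant lerNl; apply: lb_le_inf; last exact: lbE.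
by have [w Bw] := B0; exists (E K w x), w.
Qed.

Lemma gap_majorant_lipschitz K x x' : 0 <= K ->
  `|gap_majorant K x - gap_majorant K x'| <= K * dX x x'.
Proof.
move=> K0.
have h u w : inf [set E K v u | v in B] <= inf [set E K v w | v in B] + K * dX u w.
  apply: (@inf_lipschitz _ _ _ dX) => //; first by exists (- (2 * M)); exact: lbE.
  move=> v _; rewrite /E -addrAC lerD2r -mulrDr ler_wpM2l// addrC; exact: dXT.
have h1 := h x x'; have h2 := h x' x; rewrite (dXC x') in h2.
by rewrite /gap_majorant ler_norml; apply/andP; split; lra.
Qed.

(** Both the base point x1 of the gap and a competitor (x2, y') in the envelope pay K times their
    distance. For large K, distances of at least del/2 cost more than 2 M, so only points near x
    matter, and there c varies by less than e/2. *)
Lemma gap_majorant_cvg x : (fun m : nat => gap_majorant m.+1%:R x) @ \oo --> 0.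
Proof.
apply/cvgrPdist_lt => e e0; have e20 : 0 < e / 2 by lra.
have [del del0 hdel] := mecontinuous2_uniform dX c x rho (e / 2) cc e20.
near=> m; set K : R := m.+1%:R.
have K0 : 0 < K by rewrite ltr0n.
have Kdel : 2 * M < K * (del / 2).
  rewrite -ltr_pdivrMr ?divr_gt0// /K.
  apply: (@lt_le_trans _ _ m%:R); last by rewrite ler_nat.
  by near: m; exact: nbhs_infty_gtr.
have /andP[a0 _] := gap_majorant_bound K x (ltW K0).
rewrite sub0r normrN ger0_norm//; apply: (@le_lt_trans _ _ (e / 2)); last lra.
rewrite /gap_majorant lerNl; apply: lb_le_inf.
  by have [w Bw] := B0; exists (E K w x), w.
move=> _ [[x1 y] /= yrho <-]; rewrite /E /=.
have small t : t < del / 2 \/ 2 * M <= K * t.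
  have [|h] := ltP t (del / 2); [by left|right].
  by rewrite (le_trans (ltW Kdel))// ler_pM2l.
have gle := gap_le K (x1, y) (ltW K0).
have [hx|hx] := small (dX x x1); last by lra.
have -> : - (e / 2) <= K * dX x x1 - gap K (x1, y) = (gap K (x1, y) <= K * dX x x1 + e / 2).
  by rewrite lerBrDr addrC -lerBrDr opprK addrC.
apply: (@le_trans _ _ (e / 2)); last by rewrite lerDr mulr_ge0// ltW.
rewrite /gap /= lerBlDr -lerBlDl; apply: lb_le_inf.
  by exists (G K (x1, y) (x1, y)), (x1, y).
move=> _ [[x2 y'] _ <-]; rewrite /G /=.
have ex : dX x1 x2 <= dist2 (x1, y) (x2, y') by rewrite /dist2 /= lerDl l1dist_ge0.
have ey : l1dist y y' <= dist2 (x1, y) (x2, y') by rewrite /dist2 /= lerDr.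
have [hw|hw] := small (dist2 (x1, y) (x2, y')).
  have := hdel y yrho x1 x2 y' _ _ _.
  have t1 : dX x x1 < del by lra.
  have t2 : dX x x2 < del by have := dXT x x1 x2; lra.
  have t3 : l1dist y y' < del by lra.
  move=> /(_ t1 t2 t3) hc; have := le_lt_trans (ler_norm _) hc.
  have : 0 <= K * dist2 (x1, y) (x2, y') by rewrite mulr_ge0// ltW.
  by lra.
have := cM x1 y; have := cM x2 y'; rewrite !ler_norml => /andP[? ?] /andP[? ?].
lra.
Unshelve. all: by end_near.
Qed.

End pasch_hausdorff.

(** For |y| <= rho the gap is bounded by [gap_majorant], a function of x with small integral;
    outside, it is at most 2 M <= (2 M / rho) |y|, which is convex in y. *)
Lemma lipschitz_approximation {R : realType} {d : measure_display} {X : measurableType d}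
  {n : nat} (mu : probability X R) (nu : probability (n.-tuple R) R) (r : R)
  (dX : X -> X -> R) (x0 : X) (c : X -> n.-tuple R -> R) (M e : R) :
  1 <= r -> is_metric dX -> (measurable : set (set X)) = <<s mopen dX >> ->
  (\int[nu]_y (tnorm y `^ r)%:E < +oo)%E -> 0 < e ->
  mecontinuous2 dX c -> (forall x y, `|c x y| <= M) ->
  exists L c', [/\ 0 <= L, forall x y, `|c' x y| <= M,
    forall x x' y y', `|c' x y - c' x' y'| <= L * (dX x x' + l1dist y y') &
    close_costs mu nu r dX x0 e c c'].
Proof.
move=> r1 dXm mE nur e0 cc cM.
have dX0 x y : 0 <= dX x y by case: dXm.
have M0 : 0 <= M by rewrite (le_trans _ (cM x0 [tuple 0 | a < n])).
have i1 := integrable_l1norm nu r r1 nur.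
pose I1 := \int[nu]_y l1norm y.
have I10 : 0 <= I1 by apply: Rintegral_ge0 => y _; exact: l1norm_ge0.
(* Makes 2 M / rho times the first moment at most e; the added 1 keeps rho positive. *)
pose rho := (2 * M * I1 + 1) / e.
have rho0 : 0 < rho by rewrite divr_gt0// ltr_wpDl// !mulr_ge0.
have maj_bound m x := gap_majorant_bound dX x0 dXm c M cM rho rho0 m.+1%:R x (ler0n _ _).
have maj_lip m x y := gap_majorant_lipschitz dX x0 dXm c M cM rho rho0 m.+1%:R x y (ler0n _ _).
have maj_cont m : mcontinuous dX (gap_majorant dX c rho m.+1%:R).
  exact: (mlipschitz_continuous dX _ m.+1%:R).
have [||||m hm] := @dominated_small _ _ _ mu (fun m x => gap_majorant dX c rho m.+1%:R x)
  (fun=> 2 * M) e e0.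
- by move=> m; apply: (mcontinuous_measurable dX).
- exact: finite_measure_integrable_cst.
- by move=> m x; exact: maj_bound.
- by move=> x; exact: (gap_majorant_cvg dX x0 dXm c M cc cM rho rho0).
have ia : mu.-integrable setT (EFin \o gap_majorant dX c rho m.+1%:R).
  apply: (bounded_integrable mu _ (2 * M)); first exact: (mcontinuous_measurable dX).
  by move=> x; have /andP[h1 h2] := maj_bound m x; rewrite ger0_norm.
exists m.+1%:R, (fun x y => pasch dX c m.+1%:R (x, y)); split => //.
- by move=> x y; exact: (pasch_bound dX dXm c M cM m.+1%:R (x, y) (ler0n _ _)).
- by move=> x x' y y'; exact: (pasch_lipschitz dX x0 dXm c M cM m.+1%:R x x' y y' (ler0n _ _)).
exists (gap_majorant dX c rho m.+1%:R), (fun y => (2 * M / rho) * l1norm y).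
have pow1 (t : R) : 0 <= t -> 1 <= (1 + t) `^ r.
  by move=> t0; rewrite (le_trans _ (le_1D_powR r t t0 r1))// lerDl.
have D0 : 0 <= 2 * M / rho by apply: divr_ge0; [rewrite mulr_ge0|exact: ltW].
split.
- split => //; exists (2 * M) => x; have /andP[h1 h2] := maj_bound m x.
  by rewrite ger0_norm// (le_trans h2)// ler_peMr ?mulr_ge0// pow1.
- split; first by apply: convex_funZ => //; exact: convex_l1norm.
  exists (2 * M / rho * n%:R) => y.
  rewrite ger0_norm; last by apply: mulr_ge0 => //; exact: l1norm_ge0.
  rewrite -[leRHS]mulrA ler_wpM2l// (le_trans (l1norm_le_tnorm y))// ler_wpM2l//.
  by rewrite (le_trans _ (le_1D_powR r _ (tnorm_ge0 y) r1))// lerDr.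
- by rewrite -lee_fin /Rintegral fineK ?ltW//; exact: integrable_fin_num.
- rewrite RintegralZl// -/I1 mulrAC ler_pdivrMr//.
  have -> : e * rho = 2 * M * I1 + 1 by rewrite /rho mulrC divfK ?gt_eqF.
  by rewrite lerDl.
- move=> x y.
  have gle := pasch_le_cost dX dXm c M cM m.+1%:R x y (ler0n _ _).
  rewrite ger0_norm ?subr_ge0//.
  have /andP[h1 h2] := maj_bound m x.
  have [yrho|yrho] := leP (l1norm y) rho.
    rewrite (le_trans (gap_majorant_ge dX dXm c M cM rho _ x y (ler0n _ _) yrho))//.
    by rewrite lerDl; apply: mulr_ge0 => //; exact: l1norm_ge0.
  have := pasch_bound dX dXm c M cM m.+1%:R (x, y) (ler0n _ _); have := cM x y.
  rewrite !ler_norml => /andP[a1 a2] /andP[a3 a4].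
  have : 2 * M <= 2 * M / rho * l1norm y.
    by rewrite mulrAC ler_pdivlMr// ler_wpM2l ?mulr_ge0// ltW.
  by lra.
Qed.

(** * Conclusion *)

Section strong_duality.
Context {R : realType} {d : measure_display} {X : measurableType d} {n : nat}
  (mu : probability X R) (nu : probability (n.-tuple R) R) (r : R)
  (dX : X -> X -> R) (x0 : X).
Hypotheses (r1 : 1 <= r) (dXm : is_metric dX) (dXs : mseparable dX)
  (mE : (measurable : set (set X)) = <<s mopen dX >>)
  (mu0 : forall x, mu [set x] = 0%E)
  (mur : (\int[mu]_x (dX x x0 `^ r)%:E < +oo)%E)
  (nur : (\int[nu]_y (tnorm y `^ r)%:E < +oo)%E).

Let dX0 x y : 0 <= dX x y. Proof. by case: dXm. Qed.
Let dXxx x : dX x x = 0. Proof. by have [_ h _ _] := dXm; apply/h. Qed.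

Lemma mecontinuous2_econtinuous (c : X -> n.-tuple R -> R) x :
  mecontinuous2 dX c -> econtinuous (c x).
Proof.
move=> cc y e e0; have [del del0 h] := cc x y e e0; exists del => // y' yy'.
by apply: h => //; rewrite dXxx.
Qed.

Lemma mecontinuous2_measurable (c : X -> n.-tuple R -> R) y :
  mecontinuous2 dX c -> measurable_fun setT (c ^~ y).
Proof.
move=> cc; apply: (mcontinuous_measurable dX) => // x e e0.
have [del del0 h] := cc x y e e0; exists del => // x' xx'; apply: h => //.
by rewrite (le_lt_trans (tnorm_le_l1norm _))// -l1dist_tsub l1distxx.
Qed.

Lemma lipschitz_admissible_cont (L : R) (phi : X -> R) : 0 <= L ->
  (forall x x', `|phi x - phi x'| <= L * dX x x') -> admissible_cont r dX x0 phi.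
Proof.
move=> L0 phiL; split; first exact: (mlipschitz_continuous dX _ L).
exists (`|phi x0| + L) => x.
rewrite (@le_trans _ _ ((`|phi x0| + L) * (1 + dX x x0)))//; last first.
  by rewrite ler_wpM2l ?addr_ge0// le_1D_powR.
have := phiL x x0; have := ler_normD (phi x - phi x0) (phi x0); rewrite subrK.
have : 0 <= `|phi x0| * dX x x0 by rewrite mulr_ge0.
by rewrite mulrDl !mulrDr; lra.
Qed.

Lemma lipschitz_admissible_convex (L : R) (psi : n.-tuple R -> R) : 0 <= L ->
  (forall y y', `|psi y - psi y'| <= L * l1dist y y') -> convex_fun psi ->
  admissible_convex r psi.
Proof.
move=> L0 psiL cpsi; split => //; pose o : n.-tuple R := [tuple 0 | a < n].
have l1o y : l1dist y o = l1norm y.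
  by apply: eq_bigr => a _; rewrite tnth_mktuple subr0.
exists (`|psi o| + L * n%:R) => y.
have Ln : 0 <= L * n%:R by rewrite mulr_ge0.
rewrite (@le_trans _ _ ((`|psi o| + L * n%:R) * (1 + tnorm y)))//; last first.
  by rewrite ler_wpM2l ?addr_ge0// le_1D_powR// tnorm_ge0.
have := psiL y o; have := ler_normD (psi y - psi o) (psi o); rewrite subrK l1o.
have := ler_wpM2l L0 (l1norm_le_tnorm y); rewrite mulrA.
have : 0 <= `|psi o| * tnorm y by rewrite mulr_ge0// tnorm_ge0.
by rewrite mulrDl !mulrDr; lra.
Qed.

Lemma strong_duality (c : X -> n.-tuple R -> R) (C e : R) : 0 < e ->
  mecontinuous2 dX c ->
  (forall x y, `|c x y| <= C * (1 + dX x x0 `^ r + tnorm y `^ r)) ->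
  exists (phi : X -> R) (psi : n.-tuple R -> R)
    (pi : probability (X * n.-tuple R)%type R) (k : X -> probability (n.-tuple R) R),
    [/\ admissible_cont r dX x0 phi, admissible_convex r psi,
      forall x y, c x y <= phi x + psi y,
      is_coupling mu nu pi /\ is_disintegration mu pi k &
      \int[mu]_x phi x + \int[nu]_y psi y <= \int[mu]_x c x (barycenter (k x)) + e].
Proof.
(* The two approximations give a and b integrals of at most 2 t each. Their sum, 4 t, is paid in the
   potentials and again in returning from [c2] to [c]; [lipschitz_duality] adds t. *)
move=> e0 cc cC; pose t := e / 9; have t0 : 0 < t by rewrite /t; lra.
have mdist := measurable_dist dX dXm mE x0.
have [M [c1 [cc1 c1M close1]]] := clamp_approximation mu nu r dX x0 r1 dXm mE mur nur c C t t0 cc cC.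
have [L [c2 [L0 c2M c2L close2]]] :=
  lipschitz_approximation mu nu r dX x0 c1 M t r1 dXm mE nur t0 cc1 c1M.
have [a [b [aa ab ia ib hab]]] :=
  close_costs_trans mu nu r dX x0 r1 dXm mE mur nur t t c c1 c2 close1 close2.
have imu : mu.-integrable setT (EFin \o (dX ^~ x0)).
  exact: (integrable_base mu (dX ^~ x0) r r1 (fun x => dX0 x x0) mdist mur).
have inu := integrable_l1norm nu r r1 nur.
have [phi [psi [pi [k [[phiL psiL] cpsi c2le [cpl dis] hval]]]]] :=
  lipschitz_duality mu nu dX x0 c2 M L dXm dXs mE mu0 imu inu L0 c2M c2L t t0.
have aphi := lipschitz_admissible_cont L phi L0 phiL.
have apsi := lipschitz_admissible_convex L psi L0 psiL cpsi.
have iphi := integrable_admissible_cont mu r dX x0 r1 dXm mE mur _ aphi.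
have ipsi := integrable_admissible_convex nu r r1 nur _ apsi.
have ia' := integrable_admissible_cont mu r dX x0 r1 dXm mE mur _ aa.
have ib' := integrable_admissible_convex nu r r1 nur _ ab.
exists (fun x => phi x + a x), (fun y => psi y + b y), pi, k; split => //.
- exact: admissible_contD.
- exact: admissible_convexD.
- move=> x y; have := c2le x y; have := le_trans (ler_norm _) (hab x y); lra.
have cc2 x : econtinuous (c2 x).
  apply: econtinuous_l1; apply: (mlipschitz_continuous l1dist _ L l1dist_ge0) => y y'.
  by rewrite (le_trans (c2L x x y y'))// dXxx add0r.
have mc2 y : measurable_fun setT (c2 ^~ y).
  apply: (mcontinuous_measurable dX) => //; apply: (mlipschitz_continuous dX _ L) => // x x'.
  by rewrite (le_trans (c2L x x' y y))// l1distxx addr0.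
have ic : mu.-integrable setT (EFin \o (fun x => c x (barycenter (k x)))).
  apply: (coupling_cost_integrable mu nu r (dX ^~ x0) r1 mdist mur nur
    pi k cpl dis c C) => //.
  - by move=> x; exact: mecontinuous2_econtinuous.
  - by move=> y; exact: mecontinuous2_measurable.
have ic2 : mu.-integrable setT (EFin \o (fun x => c2 x (barycenter (k x)))).
  apply: (coupling_cost_integrable mu nu r (dX ^~ x0) r1 mdist mur nur
    pi k cpl dis c2 M) => //.
  move=> x y; have MM : 0 <= M by rewrite (le_trans _ (c2M x y)).
  by rewrite (le_trans (c2M x y))// ler_peMr// -addrA lerDl addr_ge0// powR_ge0.
pose F x y := c2 x y - c x y.
have econtB (f g : n.-tuple R -> R) : econtinuous f -> econtinuous g ->
    econtinuous (fun y => f y - g y).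
  move=> cf cg y e' e'0; have e2 : 0 < e' / 2 by lra.
  have [d1 d10 h1] := cf y _ e2; have [d2 d20 h2] := cg y _ e2.
  exists (Num.min d1 d2); first by rewrite lt_min d10.
  move=> y'; rewrite lt_min => /andP[/h1 hf /h2 hg].
  have -> : f y - g y - (f y' - g y') = (f y - f y') - (g y - g y') by ring.
  by have := ler_normB (f y - f y') (g y - g y'); lra.
(* Weak duality for the cost [c2 - c], with the error majorants a and b as potentials. *)
have hF : \int[mu]_x c2 x (barycenter (k x)) <=
    \int[mu]_x c x (barycenter (k x)) + (\int[mu]_x a x + \int[nu]_y b y).
  rewrite -lerBlDl -RintegralB//.
  have := weak_duality mu nu r (dX ^~ x0) r1 mdist mur nur pi k cpl dis
    F (M + C) a b.
  have FL : forall x y, `|F x y| <= (M + C) * (1 + dX x x0 `^ r + tnorm y `^ r).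
    move=> x y; rewrite mulrDl (le_trans (ler_normB _ _))// lerD// (le_trans (c2M x y))//.
    have MM : 0 <= M by rewrite (le_trans _ (c2M x y)).
    by rewrite ler_peMr// -addrA lerDl addr_ge0// powR_ge0.
  have iF : mu.-integrable setT (EFin \o (fun x => F x (barycenter (k x)))).
    by have := integrableB measurableT ic2 ic.
  move=> /(_ _ _ FL ia' ab.1 ab.2) h.
  rewrite -lee_fin EFinD /Rintegral !fineK; [|exact: integrable_fin_num..].
  apply: h.
  - by move=> x; apply: econtB => //; exact: mecontinuous2_econtinuous.
  - by move=> y; apply: measurable_funB => //; exact: mecontinuous2_measurable.
  - move=> x y; have := hab x y; rewrite distrC => h; exact: le_trans (ler_norm _) h.
rewrite !RintegralD//.
have te : e = 9 * t by rewrite /t; field.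
by move: hval hF ia ib; rewrite te; lra.
Qed.

End strong_duality.

Theorem theorem1p5 (R : realType) (r : R) (dd : measure_display)
  (X : measurableType dd) (dX : X -> X -> R) (x0 : X) (n : nat)
  (mu : probability X R) (nu : probability (n.-tuple R) R)
  (c : X -> n.-tuple R -> R) :
  1 <= r ->
  (* X is Polish, dX a compatible complete metric, measurable sets = Borel sets *)
  is_metric dX -> mcomplete dX -> mseparable dX ->
  (measurable : set (set X)) = <<s mopen dX >> ->
  (* mu is continuous (atomless) *)
  (forall x, mu [set x] = 0%E) ->
  (* finite r-th moments *)
  (\int[mu]_x (dX x x0 `^ r)%:E < +oo)%E ->
  (\int[nu]_y (tnorm y `^ r)%:E < +oo)%E ->
  (* c continuous with growth of order dX(x,x0)^r + |y|^r *)
  mecontinuous2 dX c ->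
  (exists C : R, forall x y, `|c x y| <= C * (1 + dX x x0 `^ r + tnorm y `^ r)) ->
  let V := ereal_sup [set v | exists pi k, is_coupling mu nu pi /\
             is_disintegration mu pi k /\
             v = (\int[mu]_x (c x (barycenter (k x)))%:E)%E] in
  let D1 := ereal_inf [set v | exists (phi : X -> R) (psi : n.-tuple R -> R)
             (Delta : n.-tuple R -> n.-tuple R),
             [/\ mcontinuous dX phi /\ econtinuous psi,
                 (exists C : R, forall x, `|phi x| <= C * (1 + dX x x0) `^ r) /\
                 (exists C : R, forall y, `|psi y| <= C * (1 + tnorm y) `^ r),
                 measurable_fun setT Delta,
                 (forall x y1 y2, c x y1 <= phi x + psi y2 + tdot (Delta y1) (tsub y2 y1)) &
                 v = (\int[mu]_x (phi x)%:E + \int[nu]_y (psi y)%:E)%E]] in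
  let D2 := ereal_inf [set v | exists (phi : X -> R) (psi : n.-tuple R -> R),
             [/\ mcontinuous dX phi /\ econtinuous psi,
                 (exists C : R, forall x, `|phi x| <= C * (1 + dX x x0) `^ r) /\
                 (exists C : R, forall y, `|psi y| <= C * (1 + tnorm y) `^ r),
                 (forall x y, c x y <= phi x + psi y),
                 convex_fun psi &
                 v = (\int[mu]_x (phi x)%:E + \int[nu]_y (psi y)%:E)%E]] in
  V = D1 /\ D1 = D2.
Proof.
move=> r1 dXm _ dXs mE mu0 mur nur cc [C cC] V D1 D2.
have dX0 x y : 0 <= dX x y by case: dXm.
have mdist := measurable_dist dX dXm mE x0.
have inu := integrable_l1norm nu r r1 nur.
have iphi phi : mcontinuous dX phi -> (exists C, forall x, `|phi x| <= C * (1 + dX x x0) `^ r) ->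
    mu.-integrable setT (EFin \o phi).
  by move=> h1 h2; exact: (integrable_admissible_cont mu r dX x0 r1 dXm mE mur phi (conj h1 h2)).
have ipsi (psi : n.-tuple R -> R) : econtinuous psi ->
    (exists C, forall y, `|psi y| <= C * (1 + tnorm y) `^ r) ->
    nu.-integrable setT (EFin \o psi).
  move=> h1 [C' h2].
  apply: (integrable_growth_powR nu (@tnorm R n) r r1 tnorm_ge0 measurable_tnorm nur psi C') => //.
  exact: econtinuous_measurable.
have VD2 : (V <= D2)%E.
  apply: ge_ereal_sup => _ [pi [k [cpl [dis ->]]]].
  apply: le_ereal_inf_tmp => _ [phi [psi [[cphi cpsi] [gphi gpsi] hc convpsi ->]]].
  apply: (weak_duality mu nu r (dX ^~ x0) r1 mdist mur nur pi k cpl dis c C) => //.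
  - by move=> x; exact: (mecontinuous2_econtinuous dX dXm).
  - by move=> y; exact: (mecontinuous2_measurable dX mE).
  - exact: iphi.
have D21 : (D2 <= D1)%E.
  apply: le_ereal_inf_tmp => _ [phi [psi [Delta [[cphi cpsi] [gphi [C' gpsi]] _ hc ->]]]].
  have [psi' [conv' [C'' gpsi'] hc' psi'le]] :=
    dual_convexify c phi psi Delta x0 r C' r1 gpsi hc.
  have cpsi' := convex_growth_continuous psi' r C'' r1 conv' gpsi'.
  apply: (@le_trans _ _ (\int[mu]_x (phi x)%:E + \int[nu]_y (psi' y)%:E)%E).
    apply: ereal_inf_lbound; exists phi, psi'; split => //; split => //.
    by exists C''.
  apply: leeD2l; apply: le_integral => //.
  - by apply: ipsi => //; exists C''.
  - by apply: ipsi => //; exists C'.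
  - by move=> y _; rewrite lee_fin.
have D12 : (D1 <= D2)%E.
  apply: le_ereal_inf_tmp => _ [phi [psi [[cphi cpsi] [gphi gpsi] hc convpsi ->]]].
  apply/lee_addgt0Pr => e e0.
  have I0 : 0 <= \int[nu]_y l1norm y by apply: Rintegral_ge0 => y _; exact: l1norm_ge0.
  (* Chosen so that t (1 + |y|) has integral exactly e under nu. *)
  pose t := e / (1 + \int[nu]_y l1norm y).
  have t0 : 0 < t by rewrite divr_gt0// ltr_pwDl.
  have [Delta [mD hD]] := convex_measurable_subgradient c phi psi t t0 convpsi cpsi hc.
  have apsi' : admissible_convex r (fun y : n.-tuple R => psi y + t * (1 + l1norm y)).
    apply: admissible_convexD; first by split.
    apply: (lipschitz_admissible_convex r r1 t _ (ltW t0)).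
      move=> y y'; rewrite -mulrBr opprD addrACA subrr add0r normrM (gtr0_norm t0).
      rewrite ler_wpM2l ?(ltW t0)// ler_norml; apply/andP; split.
        by have := l1norm_le_dist y' y; rewrite l1distC; lra.
      by have := l1norm_le_dist y y'; lra.
    apply: convex_funZ; first exact: ltW.
    by apply: convex_funD; [exact: convex_fun_cst|exact: convex_l1norm].
  have [conv' [C' g']] := apsi'.
  apply: (@le_trans _ _ (\int[mu]_x (phi x)%:E +
      \int[nu]_y (psi y + t * (1 + l1norm y))%:E)%E).
    apply: ereal_inf_lbound; exists phi, (fun y => psi y + t * (1 + l1norm y)), Delta.
    split => //; split => //; first exact: convex_growth_continuous g'.
    by exists C'.
  rewrite -[leRHS]addeA leeD2l//.
  have i1 : nu.-integrable setT (EFin \o (fun y : n.-tuple R => 1 + l1norm y)).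
    have := integrableD measurableT (finite_measure_integrable_cst nu 1 measurableT) inu.
    by [].
  have it : nu.-integrable setT (fun y : n.-tuple R => (t * (1 + l1norm y))%:E).
    by rewrite (_ : (fun _ => _) = (fun y => (t%:E * (1 + l1norm y)%:E)%E))//; exact: integrableZl.
  have ip := ipsi psi cpsi gpsi.
  under eq_integral do rewrite EFinD.
  rewrite integralD// leeD2l//.
  have -> : (\int[nu]_y (t * (1 + l1norm y))%:E = (\int[nu]_y (t * (1 + l1norm y)))%R%:E)%E.
    by rewrite /Rintegral fineK//; exact: integrable_fin_num.
  rewrite lee_fin RintegralZl// RintegralD//; last exact: finite_measure_integrable_cst.
  by rewrite Rintegral_prob_cst /t divfK// gt_eqF// ltr_pwDl.
have D2V : (D2 <= V)%E.
  apply/lee_addgt0Pr => e e0.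
  have [phi [psi [pi [k [[cphi gphi] apsi hc [cpl dis] hval]]]]] :=
    strong_duality mu nu r dX x0 r1 dXm dXs mE mu0 mur nur c C e e0 cc cC.
  have [convpsi [C' gpsi]] := apsi.
  have cpsi := convex_growth_continuous psi r C' r1 convpsi gpsi.
  have gpsi' : exists C, forall y, `|psi y| <= C * (1 + tnorm y) `^ r by exists C'.
  have ic : mu.-integrable setT (EFin \o (fun x => c x (barycenter (k x)))).
    apply: (coupling_cost_integrable mu nu r (dX ^~ x0) r1 mdist mur nur pi k cpl dis c C) => //.
    - by move=> x; exact: (mecontinuous2_econtinuous dX dXm).
    - by move=> y; exact: (mecontinuous2_measurable dX mE).
  apply: (@le_trans _ _ (\int[mu]_x (phi x)%:E + \int[nu]_y (psi y)%:E)%E).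
    by apply: ereal_inf_lbound; exists phi, psi.
  apply: (@le_trans _ _ (\int[mu]_x (c x (barycenter (k x)))%:E + e%:E)%E).
    have fin1 := integrable_fin_num measurableT (iphi phi cphi gphi).
    have fin2 := integrable_fin_num measurableT (ipsi psi cpsi gpsi').
    have fin3 := integrable_fin_num measurableT ic.
    by move: hval; rewrite /Rintegral -lee_fin !EFinD !fineK.
  by rewrite leeD2r//; apply: ereal_sup_ubound; exists pi, k.
have D1D2 : D1 = D2 by apply/eqP; rewrite eq_le D12.
split => //; rewrite D1D2; apply/eqP; rewrite eq_le VD2; exact: D2V.
Qed.
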